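(* Let $f$ be an entire function for which there exist constants $A,B,C,r_0>1$ such that \[ A\log M(r,f)\leq \log M(Cr,f)\leq B\log M(r,f)\quad\text{for all } r\geq r_0 . \] Then there exist $\alpha_1,\alpha_2,\eta>0$ such that for all $q,\lambda\geq 0$ we have $\operatorname{dens}\bigl(T(f,\alpha_1,\alpha_2,q,\lambda),A(R)\bigr)>\eta$ for all sufficiently large $R$.
   Context: $M(r,f)=\max_{|z|=r}|f(z)|$. For $R>0$, $A(R)=\{z\in\mathbb C: R\le |z|\le 2R\}$. For measurable $X,Y\subset\mathbb C$ with $0<\operatorname{area}(Y)<\infty$, $\operatorname{dens}(X,Y)=\operatorname{area}(X\cap Y)/\operatorname{area}(Y)$, where area is planar Lebesgue measure. For $\alpha_1,\alpha_2,q,\lambda\ge 0$, $T(f,\alpha_1,\alpha_2,q,\lambda)$ is the set of all $z\in\mathbb C$ such that (i) $\alpha_1\log M(|z|,f)\le \left|\frac{zf'(z)}{f(z)}\right|\le \alpha_2\log M(|z|,f)$; (ii) $|f(z)|\ge |z|^q$; and (iii) $\left|\frac{\zeta f'(\zeta)}{f(\zeta)}\right|\le \alpha_2\log M(|\zeta|,f)$ for all $\zeta$ with $|\zeta-z|\le \lambda |z|/\log M(|z|,f)$ (in particular $f$ has no zeros in this closed disk).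
   Formalization: The function f is additionally assumed to be non-constant, since f ≡ 1 satisfies the growth condition (log M = 0) but the conclusion fails for it when q > 0. *)

(* Defs.v *)
From Stdlib Require Import Reals Lra ClassicalEpsilon.
Open Scope R_scope.

Definition Cplx : Type := (R * R)%type.
Definition Cadd (z w : Cplx) : Cplx := (fst z + fst w, snd z + snd w).
Definition Csub (z w : Cplx) : Cplx := (fst z - fst w, snd z - snd w).
Definition Cmul (z w : Cplx) : Cplx :=
  (fst z * fst w - snd z * snd w, fst z * snd w + snd z * fst w).
Definition Cinv (z : Cplx) : Cplx :=
  let d := fst z * fst z + snd z * snd z in (fst z / d, - snd z / d).
Definition Cdiv (z w : Cplx) : Cplx := Cmul z (Cinv w).
Definition Cmod (z : Cplx) : R := sqrt (fst z * fst z + snd z * snd z).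

Definition is_Cderiv (f f' : Cplx -> Cplx) (z : Cplx) : Prop :=
  forall eps : R, 0 < eps -> exists delta : R, 0 < delta /\
    forall h : Cplx, h <> (0, 0) -> Cmod h < delta ->
      Cmod (Csub (Cdiv (Csub (f (Cadd z h)) (f z)) h) (f' z)) < eps.

Definition entire_with_deriv (f f' : Cplx -> Cplx) : Prop := forall z, is_Cderiv f f' z.

Definition M (f : Cplx -> Cplx) (r : R) : R :=
  epsilon (inhabits 0)
    (fun m => is_lub (fun y => exists z : Cplx, Cmod z = r /\ y = Cmod (f z)) m).

Record rect := mkRect { rx1 : R; rx2 : R; ry1 : R; ry2 : R }.
Definition rect_area (Q : rect) : R :=
  Rmax 0 (rx2 Q - rx1 Q) * Rmax 0 (ry2 Q - ry1 Q).
Definition in_rect (Q : rect) (z : Cplx) : Prop :=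
  rx1 Q <= fst z <= rx2 Q /\ ry1 Q <= snd z <= ry2 Q.

Definition cover_sums (X : Cplx -> Prop) (s : R) : Prop :=
  exists Q : nat -> rect,
    (forall z, X z -> exists n, in_rect (Q n) z) /\
    infinite_sum (fun n => rect_area (Q n)) s.

Definition is_glb (E : R -> Prop) (m : R) : Prop :=
  (forall x, E x -> m <= x) /\ (forall b, (forall x, E x -> b <= x) -> b <= m).

(* Lebesgue outer measure (coincides with area on measurable sets;
   used here only for bounded sets, where it is finite). *)
Definition area (X : Cplx -> Prop) : R :=
  epsilon (inhabits 0) (fun m => is_glb (cover_sums X) m).

Definition dens (X Y : Cplx -> Prop) : R :=
  area (fun z => X z /\ Y z) / area Y.

Definition annulus (R0 : R) (z : Cplx) : Prop := R0 <= Cmod z <= 2 * R0.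

Definition T (f f' : Cplx -> Cplx) (a1 a2 q lam : R) (z : Cplx) : Prop :=
  a1 * ln (M f (Cmod z)) <= Cmod (Cdiv (Cmul z (f' z)) (f z)) /\
  Cmod (Cdiv (Cmul z (f' z)) (f z)) <= a2 * ln (M f (Cmod z)) /\
  Rpower (Cmod z) q <= Cmod (f z) /\
  (forall zeta : Cplx,
     Cmod (Csub zeta z) <= lam * Cmod z / ln (M f (Cmod z)) ->
     f zeta <> (0, 0) /\
     Cmod (Cdiv (Cmul zeta (f' zeta)) (f zeta)) <= a2 * ln (M f (Cmod zeta))).

(* Main.v *)
(** Let [L = log M], and let [w] be a maximum point of [f] on [|z| = 3R/2]. By Jensen's inequality
    and a Borel-Caratheodory estimate, [f'/f] near [w] is a sum of [1/(z-a)] over [O(L)] zeros [a]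
    plus an error [O(L/R)]; hence [|f'/f| = O(L/R)] outside a set of small density, even on
    neighbourhoods of size [R/L]. For the lower bound, put [v = 1/2 log(|f|^2 + ka^2)] with
    [ka = M(13R/10)]. By the maximum principle the average of [v] over a small configuration of
    points around [w] is at least [L(3R/2)], while around [4w/5] it is at most [L(13R/10) + log 2];
    by the growth condition these differ by at least [c L], so the average of [|grad v|] over some
    intermediate configuration is at least [c L/R]. Since [|grad v|] is negligible where [|f|] is
    smaller than [|z|^q] and the contribution of the neighbourhoods of the zeros is small, the set
    where [|f'/f|] is comparable to [L/R] has positive density. Configurations are fine square
    lattices, so that outer measure enters only through finitely many rectangles. *)

Require Import Defs.
From Stdlib Require Import Reals Lra Lia List ClassicalEpsilon Classical.
From Coquelicot Require Import Coquelicot.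
Import ListNotations.
Open Scope R_scope.

(** * Complex differentiability *)

(** Measurability of [T] is never discussed: every covering of the relevant set by rectangles is
    shown to have total area at least [eta R^2], which bounds the infimum [area] from below. A given
    covering is made finite by compactness before the mesh of the lattice is chosen, so that the
    boundary error of each rectangle vanishes as the mesh tends to 0.

    The density must not depend on [q] and [lam]. They enter only effects of lower order: the
    excluded neighbourhoods of the zeros have total area [O(R^2/L)], and [|z|^q] is negligible
    because the growth condition lifts [M] above every power. Both are absorbed by taking [R] large.

    The term [ka^2] flattens [v] where [|f|] is far below [ka]: the drop of [v] cannot be spent
    where [|f|] is small, and the gradient stays bounded at zeros.

    The growth condition compares only radii of the fixed ratio [Cc], whereas the drop has to occur
    inside a disc about [w] that is smaller than [|w|]. The local form [growth_local] provides it
    for every ratio above 1. *)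

Lemma lt_Rmin (x a b : R) : x < Rmin a b -> x < a /\ x < b.
Proof. intros H. apply Rmin_Rgt in H. lra. Qed.

Lemma Cmod_triangle' (x y : C) : Cmod (x - y) <= Cmod x + Cmod y.
Proof.
  unfold Cminus. replace (Cmod y) with (Cmod (- y)) by apply Cmod_opp. apply Cmod_triangle.
Qed.

Lemma Cmod_sub_sym (x y : C) : Cmod (x - y) = Cmod (y - x).
Proof. rewrite <- Cmod_opp. f_equal. ring. Qed.

Lemma Cmod_rev_triangle (x y : C) : Cmod x - Cmod y <= Cmod (x - y).
Proof.
  assert (H := Cmod_triangle (x - y) y). replace (x - y + y)%C with x in H by ring. lra.
Qed.

Lemma im_le_Cmod (z : C) : Rabs (Im z) <= Cmod z.
Proof. eapply Rle_trans; [apply Rmax_r | apply Rmax_Cmod]. Qed.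

Lemma Cmod_le_sum (z : C) : Cmod z <= Rabs (Re z) + Rabs (Im z).
Proof.
  destruct z as [x y]. unfold Cmod, Re, Im; simpl fst; simpl snd.
  rewrite <- (sqrt_Rsqr (Rabs x + Rabs y)).
  2:{ pose proof (Rabs_pos x); pose proof (Rabs_pos y); lra. }
  apply sqrt_le_1_alt. unfold Rsqr.
  pose proof (Rabs_pos x); pose proof (Rabs_pos y).
  rewrite <- (pow2_abs x), <- (pow2_abs y). nra.
Qed.

Lemma Cmod_sqr (z : C) : Cmod z * Cmod z = Re z * Re z + Im z * Im z.
Proof. generalize (Cmod2_alt z). intros H. simpl in H. lra. Qed.

Definition cis (t : R) : C := (cos t, sin t).

Lemma Cmod_cis (t : R) : Cmod (cis t) = 1.
Proof.
  unfold Cmod, cis; simpl fst; simpl snd.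
  replace (cos t ^ 2 + sin t ^ 2) with 1. apply sqrt_1.
  generalize (sin2_cos2 t). unfold Rsqr. simpl. lra.
Qed.

Lemma cis_plus (s t : R) : cis (s + t) = (cis s * cis t)%C.
Proof.
  unfold cis, Cmult; simpl. rewrite cos_plus, sin_plus. f_equal; ring.
Qed.

Lemma polar_unit (x y : R) : x * x + y * y = 1 ->
  exists t, 0 <= t <= 2 * PI /\ (x, y) = cis t.
Proof.
  intros H. pose proof PI_RGT_0.
  assert (Hx : -1 <= x <= 1) by (split; nra).
  destruct (acos_bound x) as [Ha Hb].
  assert (Hs : sin (acos x) = Rabs y).
  { rewrite sin_acos by exact Hx. rewrite <- sqrt_Rsqr_abs. f_equal. unfold Rsqr. lra. }
  destruct (Rle_dec 0 y) as [Hy | Hy].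
  - exists (acos x). split; [lra|]. unfold cis. rewrite cos_acos by exact Hx.
    rewrite Hs, Rabs_pos_eq by exact Hy. reflexivity.
  - exists (2 * PI - acos x). split; [lra|]. unfold cis.
    rewrite cos_minus, sin_minus, cos_2PI, sin_2PI, cos_acos by exact Hx.
    rewrite Hs, Rabs_left by lra. f_equal; ring.
Qed.

Lemma polar (z : C) : exists t, 0 <= t <= 2 * PI /\ z = (RtoC (Cmod z) * cis t)%C.
Proof.
  destruct (Ceq_dec z 0) as [-> | Hz].
  - exists 0. split. pose proof PI_RGT_0; lra. rewrite Cmod_0. ring.
  - pose proof (proj1 (Cmod_gt_0 z) Hz) as Hp.
    destruct (polar_unit (Re z / Cmod z) (Im z / Cmod z)) as [t [Ht He]].
    + pose proof (Cmod_sqr z). field_simplify; [|lra].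
      apply Rmult_eq_reg_r with (Cmod z ^ 2). 2: nra.
      field_simplify; [|lra]. simpl. nra.
    + exists t. split; [exact Ht|]. rewrite <- He.
      destruct z as [x y]. unfold Re, Im, RtoC, Cmult in *. simpl fst in *; simpl snd in *.
      f_equal; field; lra.
Qed.

(** * Continuity of complex-valued maps *)

Lemma continuous_C_pair {U : UniformSpace} (f : U -> C) (x : U) :
  continuous (fun u => Re (f u)) x -> continuous (fun u => Im (f u)) x -> continuous f x.
Proof.
  intros H1 H2.
  apply (continuous_ext (fun u => (Re (f u), Im (f u)))).
  { intros u. destruct (f u); reflexivity. }
  intros P [eps HP].
  assert (Q1 := H1 _ (locally_ball (Re (f x)) eps)).
  assert (Q2 := H2 _ (locally_ball (Im (f x)) eps)).
  unfold filtermap in *. generalize (filter_and _ _ Q1 Q2).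
  apply filter_imp. intros u [A1 A2]. apply HP. split; assumption.
Qed.

Lemma continuous_Re {U : UniformSpace} (f : U -> C) (x : U) :
  continuous f x -> continuous (fun u => Re (f u)) x.
Proof.
  intros H. apply (continuous_comp f Re); [exact H|]. unfold Re. destruct (f x). apply continuous_fst.
Qed.

Lemma continuous_Im {U : UniformSpace} (f : U -> C) (x : U) :
  continuous f x -> continuous (fun u => Im (f u)) x.
Proof.
  intros H. apply (continuous_comp f Im); [exact H|]. unfold Im. destruct (f x). apply continuous_snd.
Qed.

Ltac cont_ReIm :=
  match goal with
  | |- continuous (fun _ => Re _) _ => apply continuous_Re; assumption
  | |- continuous (fun _ => Im _) _ => apply continuous_Im; assumption
  end.

Lemma continuous_Rplus {U : UniformSpace} (f g : U -> R) (x : U) :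
  continuous f x -> continuous g x -> continuous (fun u => f u + g u) x.
Proof. intros; apply (continuous_plus f g); assumption. Qed.

Lemma continuous_Rminus {U : UniformSpace} (f g : U -> R) (x : U) :
  continuous f x -> continuous g x -> continuous (fun u => f u - g u) x.
Proof. intros; apply (continuous_minus f g); assumption. Qed.

Lemma continuous_Ropp {U : UniformSpace} (f : U -> R) (x : U) :
  continuous f x -> continuous (fun u => - f u) x.
Proof. intros; apply (continuous_opp f); assumption. Qed.

Lemma continuous_Rmult {U : UniformSpace} (f g : U -> R) (x : U) :
  continuous f x -> continuous g x -> continuous (fun u => f u * g u) x.
Proof. intros; apply (continuous_mult f g); assumption. Qed.

Lemma continuous_Rcomp {U : UniformSpace} (f : U -> R) (g : R -> R) (x : U) :
  continuous f x -> continuity_pt g (f x) -> continuous (fun u => g (f u)) x.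
Proof.
  intros H1 H2. apply (continuous_comp f g); [exact H1|].
  apply continuity_pt_filterlim. exact H2.
Qed.

Lemma continuous_inv_R {U : UniformSpace} (f : U -> R) (x : U) :
  continuous f x -> f x <> 0 -> continuous (fun u => / f u) x.
Proof.
  intros H1 H2. apply (continuous_Rcomp f Rinv); [exact H1|].
  apply (continuity_pt_inv (fun y => y)); [apply derivable_continuous_pt, derivable_pt_id | exact H2].
Qed.

Lemma continuous_Cplus {U : UniformSpace} (f g : U -> C) (x : U) :
  continuous f x -> continuous g x -> continuous (fun u => (f u + g u)%C) x.
Proof.
  intros Hf Hg. apply continuous_C_pair.
  - apply (continuous_ext (fun u => Re (f u) + Re (g u))); [reflexivity|].
    apply continuous_Rplus; apply continuous_Re; assumption.
  - apply (continuous_ext (fun u => Im (f u) + Im (g u))); [reflexivity|].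
    apply continuous_Rplus; apply continuous_Im; assumption.
Qed.

Lemma continuous_Copp {U : UniformSpace} (f : U -> C) (x : U) :
  continuous f x -> continuous (fun u => (- f u)%C) x.
Proof.
  intros Hf. apply continuous_C_pair.
  - apply (continuous_ext (fun u => - Re (f u))); [reflexivity|].
    apply continuous_Ropp; apply continuous_Re; assumption.
  - apply (continuous_ext (fun u => - Im (f u))); [reflexivity|].
    apply continuous_Ropp; apply continuous_Im; assumption.
Qed.

Lemma continuous_Cminus {U : UniformSpace} (f g : U -> C) (x : U) :
  continuous f x -> continuous g x -> continuous (fun u => (f u - g u)%C) x.
Proof. intros. apply continuous_Cplus; [|apply continuous_Copp]; assumption. Qed.

Lemma continuous_Cmult {U : UniformSpace} (f g : U -> C) (x : U) :
  continuous f x -> continuous g x -> continuous (fun u => (f u * g u)%C) x.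
Proof.
  intros Hf Hg. apply continuous_C_pair.
  - apply (continuous_ext (fun u => Re (f u) * Re (g u) - Im (f u) * Im (g u))); [reflexivity|].
    apply continuous_Rminus; apply continuous_Rmult; cont_ReIm.
  - apply (continuous_ext (fun u => Re (f u) * Im (g u) + Im (f u) * Re (g u))); [reflexivity|].
    apply continuous_Rplus; apply continuous_Rmult; cont_ReIm.
Qed.

Lemma C_norm2_neq_0 (z : C) : z <> 0%C -> Re z ^ 2 + Im z ^ 2 <> 0.
Proof.
  intros Hz H. apply Hz. destruct z as [a b]. unfold Re, Im in H; simpl in H.
  assert (a = 0) by nra. assert (b = 0) by nra. subst. reflexivity.
Qed.

Lemma continuous_Cinv {U : UniformSpace} (f : U -> C) (x : U) :
  continuous f x -> f x <> 0%C -> continuous (fun u => (/ f u)%C) x.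
Proof.
  intros Hf Hn.
  assert (Hd : continuous (fun u => / (Re (f u) ^ 2 + Im (f u) ^ 2)) x).
  { apply (continuous_inv_R (fun u => Re (f u) ^ 2 + Im (f u) ^ 2)).
    2: apply C_norm2_neq_0, Hn.
    apply (continuous_ext (fun u => Re (f u) * Re (f u) + Im (f u) * Im (f u))).
    { intros u; simpl; ring. }
    apply continuous_Rplus; apply continuous_Rmult; cont_ReIm. }
  apply continuous_C_pair.
  - apply (continuous_ext (fun u => Re (f u) * / (Re (f u) ^ 2 + Im (f u) ^ 2))); [reflexivity|].
    apply continuous_Rmult; [apply continuous_Re; exact Hf | exact Hd].
  - apply (continuous_ext (fun u => - Im (f u) * / (Re (f u) ^ 2 + Im (f u) ^ 2))); [reflexivity|].
    apply continuous_Rmult; [apply continuous_Ropp, continuous_Im; exact Hf | exact Hd].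
Qed.

Lemma continuous_Cdiv {U : UniformSpace} (f g : U -> C) (x : U) :
  continuous f x -> continuous g x -> g x <> 0%C -> continuous (fun u => (f u / g u)%C) x.
Proof. intros. apply continuous_Cmult; [|apply continuous_Cinv]; assumption. Qed.

Lemma continuous_RtoC {U : UniformSpace} (f : U -> R) (x : U) :
  continuous f x -> continuous (fun u => RtoC (f u)) x.
Proof.
  intros H. apply continuous_C_pair; [exact H|].
  apply (continuous_const 0).
Qed.

Lemma continuous_cis {U : UniformSpace} (f : U -> R) (x : U) :
  continuous f x -> continuous (fun u => cis (f u)) x.
Proof.
  intros H. apply continuous_C_pair.
  - apply (continuous_Rcomp f cos); [exact H | apply continuity_cos].
  - apply (continuous_Rcomp f sin); [exact H | apply continuity_sin].
Qed.

Lemma continuous_Cmod {U : UniformSpace} (f : U -> C) (x : U) :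
  continuous f x -> continuous (fun u => Cmod (f u)) x.
Proof.
  intros H. unfold Cmod.
  apply (continuous_Rcomp (fun u => fst (f u) ^ 2 + snd (f u) ^ 2) sqrt).
  - apply (continuous_ext (fun u => Re (f u) * Re (f u) + Im (f u) * Im (f u))).
    { intros u; unfold Re, Im; simpl; ring. }
    apply continuous_Rplus; apply continuous_Rmult; cont_ReIm.
  - apply continuity_pt_sqrt. nra.
Qed.

Lemma continuous_C_eps {U : UniformSpace} (f : U -> C) (x : U) :
  continuous f x -> forall eps, 0 < eps -> locally x (fun u => Cmod (f u - f x) < eps).
Proof.
  intros H eps He.
  assert (H' : continuous (fun u => Cmod (f u - f x)) x).
  { apply continuous_Cmod, continuous_Cminus; [exact H | apply continuous_const]. }
  assert (H2 := H' _ (locally_ball (Cmod (f x - f x)) (mkposreal eps He))).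
  revert H2. unfold filtermap. apply filter_imp. intros u Hu.
  replace (f x - f x)%C with (RtoC 0) in Hu by ring. rewrite Cmod_0 in Hu.
  unfold ball in Hu; simpl in Hu. unfold AbsRing_ball, abs, minus, plus, opp in Hu; simpl in Hu.
  pose proof (Rle_abs (Cmod (f u - f x) + - 0)). lra.
Qed.

(** Neighbourhoods in [C] come from the product structure, that is from the maximum of the two
    coordinates; this lemma and the next exchange them for discs of [Cmod]. *)
Lemma locally_C_ball (z : C) (P : C -> Prop) :
  locally z P -> exists d, 0 < d /\ forall h, Cmod h < d -> P (z + h)%C.
Proof.
  intros [d H]. exists d. split; [apply cond_pos|]. intros h Hh. apply H.
  destruct z as [a b], h as [u v]. pose proof (Rmax_Cmod (u, v)) as Hm. simpl in Hm.
  pose proof (Rmax_l (Rabs u) (Rabs v)). pose proof (Rmax_r (Rabs u) (Rabs v)).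
  split; simpl; unfold ball; simpl; unfold AbsRing_ball, abs, minus, plus, opp; simpl;
    [replace (a + u + - a) with u by ring | replace (b + v + - b) with v by ring]; lra.
Qed.

Lemma ball_locally_C (z : C) (P : C -> Prop) (d : R) :
  0 < d -> (forall h, Cmod h < d -> P (z + h)%C) -> locally z P.
Proof.
  intros Hd H. assert (H2 : 0 < d / 2) by lra. exists (mkposreal _ H2).
  intros y [H3 H4]. replace y with (z + (y - z))%C by ring. apply H.
  destruct z as [a b], y as [u v].
  unfold ball in H3, H4; simpl in H3, H4; unfold AbsRing_ball, abs, minus, plus, opp in H3, H4;
    simpl in H3, H4.
  eapply Rle_lt_trans; [apply Cmod_le_sum|]. unfold Re, Im; simpl. lra.
Qed.

Lemma continuous_C_intro (f : C -> C) (z : C) :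
  (forall eps, 0 < eps -> exists d, 0 < d /\ forall h, Cmod h < d -> Cmod (f (z + h) - f z)%C < eps) ->
  continuous f z.
Proof.
  intros H P [eps HP]. destruct (H eps (cond_pos eps)) as [d [Hd H']].
  apply (ball_locally_C z _ d Hd). intros h Hh. apply HP.
  specialize (H' h Hh). set (a := f z) in *. set (b := f (z + h)%C) in *.
  pose proof (re_le_Cmod (b - a)) as R1. pose proof (im_le_Cmod (b - a)) as R2.
  split; unfold ball; simpl; unfold AbsRing_ball, abs, minus, plus, opp; simpl;
    unfold Re, Im in *; simpl in *; lra.
Qed.

Lemma continuous_C_elim (f : C -> C) (z : C) : continuous f z ->
  forall eps, 0 < eps -> exists d, 0 < d /\ forall h, Cmod h < d -> Cmod (f (z + h) - f z)%C < eps.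
Proof. intros H eps He. apply (locally_C_ball z _ (continuous_C_eps f z H eps He)). Qed.

(** Differentiability without a quotient: [h = 0] needs no exception, and for sums, products and
    compositions only error terms have to be added up. *)
Definition cder (f : C -> C) (z d : C) : Prop :=
  forall eps, 0 < eps -> exists delta, 0 < delta /\ forall h : C, Cmod h < delta ->
    Cmod (f (z + h) - f z - d * h)%C <= eps * Cmod h.

Lemma cder_const (c z : C) : cder (fun _ => c) z 0.
Proof.
  intros eps He. exists 1. split; [lra|]. intros h _.
  replace (c - c - 0 * h)%C with (RtoC 0) by ring. rewrite Cmod_0.
  pose proof (Cmod_ge_0 h). nra.
Qed.

Lemma cder_id (z : C) : cder (fun u => u) z 1.
Proof.
  intros eps He. exists 1. split; [lra|]. intros h _.
  replace (z + h - z - 1 * h)%C with (RtoC 0) by ring. rewrite Cmod_0.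
  pose proof (Cmod_ge_0 h). nra.
Qed.

Lemma cder_plus (f g : C -> C) (z a b : C) :
  cder f z a -> cder g z b -> cder (fun u => f u + g u)%C z (a + b)%C.
Proof.
  intros Hf Hg eps He.
  destruct (Hf (eps / 2)) as [d1 [Hd1 H1]]; [lra|].
  destruct (Hg (eps / 2)) as [d2 [Hd2 H2]]; [lra|].
  exists (Rmin d1 d2). split; [apply Rmin_pos; assumption|]. intros h Hh.
  destruct (lt_Rmin _ _ _ Hh) as [L1 L2]. specialize (H1 h L1). specialize (H2 h L2).
  replace (f (z + h) + g (z + h) - (f z + g z) - (a + b) * h)%C
    with ((f (z + h) - f z - a * h) + (g (z + h) - g z - b * h))%C by ring.
  eapply Rle_trans; [apply Cmod_triangle|]. lra.
Qed.

Lemma cder_lip (f : C -> C) (z d : C) : cder f z d ->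
  exists delta, 0 < delta /\ forall h, Cmod h < delta -> Cmod (f (z + h) - f z)%C <= (Cmod d + 1) * Cmod h.
Proof.
  intros H. destruct (H 1) as [e [He H1]]; [lra|]. exists e. split; [exact He|].
  intros h Hh. specialize (H1 h Hh).
  replace (f (z + h) - f z)%C with ((f (z + h) - f z - d * h) + d * h)%C by ring.
  eapply Rle_trans; [apply Cmod_triangle|]. rewrite Cmod_mult. lra.
Qed.

Lemma cder_continuous (f : C -> C) (z d : C) : cder f z d -> continuous f z.
Proof.
  intros H. apply continuous_C_intro. intros eps He.
  destruct (cder_lip f z d H) as [e [Hp H1]].
  pose proof (Cmod_ge_0 d).
  exists (Rmin e (eps / (Cmod d + 1))). split.
  { apply Rmin_pos; [exact Hp|]. apply Rdiv_lt_0_compat; lra. }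
  intros h Hh. destruct (lt_Rmin _ _ _ Hh) as [Hh1 Hh2].
  eapply Rle_lt_trans; [apply H1; assumption|].
  apply Rmult_lt_compat_l with (r := Cmod d + 1) in Hh2; [|lra].
  replace ((Cmod d + 1) * (eps / (Cmod d + 1))) with eps in Hh2 by (field; lra). exact Hh2.
Qed.

Lemma cder_mult (f g : C -> C) (z a b : C) :
  cder f z a -> cder g z b -> cder (fun u => f u * g u)%C z (a * g z + f z * b)%C.
Proof.
  intros Hf Hg eps He.
  (* [K] adds up the coefficients of the three error terms below. *)
  set (K := Cmod (g z) + 1 + Cmod (f z) + Cmod a).
  assert (HK : 0 < K).
  { unfold K. pose proof (Cmod_ge_0 (g z)); pose proof (Cmod_ge_0 (f z)); pose proof (Cmod_ge_0 a). lra. }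
  set (e := eps / K). assert (He' : 0 < e) by (apply Rdiv_lt_0_compat; assumption).
  destruct (Hf e He') as [d1 [Hd1 H1]]. destruct (Hg e He') as [d2 [Hd2 H2]].
  destruct (continuous_C_elim g z (cder_continuous g z b Hg) (Rmin e 1)) as [d3 [Hd3 H3]].
  { apply Rmin_pos; lra. }
  exists (Rmin d1 (Rmin d2 d3)). split; [repeat apply Rmin_pos; assumption|].
  intros h Hh.
  destruct (lt_Rmin _ _ _ Hh) as [L1 [L2 L3]%lt_Rmin].
  specialize (H1 h L1). specialize (H2 h L2). specialize (H3 h L3).
  pose proof (Rmin_l e 1). pose proof (Rmin_r e 1).
  replace (f (z + h) * g (z + h) - f z * g z - (a * g z + f z * b) * h)%C with
    ((f (z + h) - f z - a * h) * g (z + h) + (a * h) * (g (z + h) - g z)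
      + f z * (g (z + h) - g z - b * h))%C by ring.
  assert (Hg1 : Cmod (g (z + h)%C) <= Cmod (g z) + 1).
  { replace (g (z + h)%C) with ((g (z + h) - g z) + g z)%C by ring.
    eapply Rle_trans; [apply Cmod_triangle|]. lra. }
  eapply Rle_trans; [apply Cmod_triangle|].
  eapply Rle_trans; [apply Rplus_le_compat_r, Cmod_triangle|].
  rewrite !Cmod_mult.
  pose proof (Cmod_ge_0 h). pose proof (Cmod_ge_0 a). pose proof (Cmod_ge_0 (f z)).
  pose proof (Cmod_ge_0 (g (z+h)%C)). pose proof (Cmod_ge_0 (g (z+h) - g z)%C).
  pose proof (Cmod_ge_0 (f (z + h) - f z - a * h)%C).
  assert (T1 : Cmod (f (z + h) - f z - a * h)%C * Cmod (g (z + h)%C) <= (e * Cmod h) * (Cmod (g z) + 1)).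
  { apply Rmult_le_compat; assumption. }
  assert (T2 : Cmod a * Cmod h * Cmod (g (z + h) - g z)%C <= Cmod a * Cmod h * e).
  { apply Rmult_le_compat_l; [nra | lra]. }
  assert (T3 : Cmod (f z) * Cmod (g (z + h) - g z - b * h)%C <= Cmod (f z) * (e * Cmod h)).
  { apply Rmult_le_compat_l; assumption. }
  replace eps with (e * K) by (unfold e; field; lra). unfold K. nra.
Qed.

Lemma cder_ext_loc (f g : C -> C) (z d : C) (r : R) : 0 < r ->
  (forall h, Cmod h < r -> f (z + h)%C = g (z + h)%C) -> cder f z d -> cder g z d.
Proof.
  intros Hr E H eps He. destruct (H eps He) as [e [Hp H1]].
  exists (Rmin e r). split; [apply Rmin_pos; assumption|].
  intros h Hh. destruct (lt_Rmin _ _ _ Hh) as [L1 L2]. rewrite <- E by exact L2.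
  replace (g z) with (f z).
  - apply H1, L1.
  - replace z with (z + 0)%C by ring. apply E. rewrite Cmod_0. exact Hr.
Qed.

Lemma cder_ext (f g : C -> C) (z d : C) : (forall u, f u = g u) -> cder f z d -> cder g z d.
Proof. intros E. apply (cder_ext_loc f g z d 1); [lra | intros; apply E]. Qed.

Lemma cder_comp (f g : C -> C) (z a b : C) :
  cder g z a -> cder f (g z) b -> cder (fun u => f (g u)) z (b * a)%C.
Proof.
  intros Hg Hf eps He.
  set (K := Cmod a + 1 + Cmod b).
  assert (HK : 0 < K).
  { unfold K. pose proof (Cmod_ge_0 a); pose proof (Cmod_ge_0 b). lra. }
  set (e := eps / K). assert (He' : 0 < e) by (apply Rdiv_lt_0_compat; assumption).
  destruct (Hf e He') as [d1 [Hd1 H1]]. destruct (Hg e He') as [d2 [Hd2 H2]].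
  destruct (continuous_C_elim g z (cder_continuous g z a Hg) d1 Hd1) as [d3 [Hd3 H3]].
  destruct (cder_lip g z a Hg) as [d4 [Hd4 H4]].
  exists (Rmin (Rmin d2 d3) d4). split; [repeat apply Rmin_pos; assumption|].
  intros h Hh.
  destruct (lt_Rmin _ _ _ Hh) as [[L2 L3]%lt_Rmin L4].
  specialize (H2 h L2). specialize (H3 h L3). specialize (H4 h L4).
  specialize (H1 (g (z + h) - g z)%C H3).
  replace (g z + (g (z + h) - g z))%C with (g (z + h)%C) in H1 by ring.
  replace (f (g (z + h)%C) - f (g z) - b * a * h)%C with
    ((f (g (z + h)%C) - f (g z) - b * (g (z + h) - g z)) + b * (g (z + h) - g z - a * h))%C by ring.
  eapply Rle_trans; [apply Cmod_triangle|]. rewrite Cmod_mult.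
  pose proof (Cmod_ge_0 h). pose proof (Cmod_ge_0 b).
  assert (T1 : e * Cmod (g (z + h) - g z)%C <= e * ((Cmod a + 1) * Cmod h)).
  { apply Rmult_le_compat_l; lra. }
  assert (T2 : Cmod b * Cmod (g (z + h) - g z - a * h)%C <= Cmod b * (e * Cmod h)).
  { apply Rmult_le_compat_l; assumption. }
  replace eps with (e * K) by (unfold e; field; lra). unfold K. nra.
Qed.

(** The remainder is exactly [h^2 / (z^2 (z + h))], and [|z + h| >= |z| / 2] once
    [|h| < |z| / 2]. *)
Lemma cder_inv_id (z : C) : z <> 0%C -> cder Cinv z (- / (z * z))%C.
Proof.
  intros Hz eps He. pose proof (proj1 (Cmod_gt_0 z) Hz) as Hp.
  set (K := 2 / (Cmod z * Cmod z * Cmod z)).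
  assert (HK : 0 < K) by (apply Rdiv_lt_0_compat; [lra|]; repeat apply Rmult_lt_0_compat; assumption).
  exists (Rmin (Cmod z / 2) (eps / K)). split.
  { apply Rmin_pos; [lra|]. apply Rdiv_lt_0_compat; assumption. }
  intros h Hh.
  destruct (lt_Rmin _ _ _ Hh) as [L1 L2].
  assert (Hlow : Cmod z / 2 <= Cmod (z + h)%C).
  { pose proof (Cmod_rev_triangle z (-h)%C). rewrite Cmod_opp in H.
    replace (z - - h)%C with (z + h)%C in H by ring. lra. }
  assert (Hn : (z + h)%C <> 0%C) by (apply Cmod_gt_0; lra).
  replace (/ (z + h) - / z - - / (z * z) * h)%C with (h * h / (z * z * (z + h)))%C.
  2:{ field. split; assumption. }
  rewrite Cmod_div by (repeat apply Cmult_neq_0; assumption). rewrite !Cmod_mult.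
  pose proof (Cmod_ge_0 h).
  apply Rle_trans with (Cmod h * Cmod h * K).
  - unfold Rdiv. apply Rmult_le_compat_l; [nra|]. unfold K.
    replace (2 / (Cmod z * Cmod z * Cmod z)) with (/ (Cmod z * Cmod z * (Cmod z / 2))) by (field; lra).
    apply Rinv_le_contravar; [|nra]. repeat apply Rmult_lt_0_compat; lra.
  - apply Rmult_lt_compat_r with (r := K) in L2; [|exact HK].
    replace (eps / K * K) with eps in L2 by (field; lra). nra.
Qed.

Lemma cder_inv (f : C -> C) (z a : C) : cder f z a -> f z <> 0%C ->
  cder (fun u => / f u)%C z (- (a / (f z * f z)))%C.
Proof.
  intros Hf Hn. replace (- (a / (f z * f z)))%C with (- / (f z * f z) * a)%C by (field; exact Hn).
  apply (cder_comp Cinv f); [exact Hf | apply cder_inv_id, Hn].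
Qed.

Lemma cder_scal (c : C) (f : C -> C) (z a : C) : cder f z a -> cder (fun u => c * f u)%C z (c * a)%C.
Proof.
  intros H. replace (c * a)%C with (0 * f z + c * a)%C by ring.
  apply (cder_mult (fun _ => c) f); [apply cder_const | exact H].
Qed.

Lemma cder_minus (f g : C -> C) (z a b : C) :
  cder f z a -> cder g z b -> cder (fun u => f u - g u)%C z (a - b)%C.
Proof.
  intros Hf Hg. apply (cder_ext (fun u => f u + (-1) * g u)%C).
  { intros u; ring. }
  replace (a - b)%C with (a + (-1) * b)%C by ring.
  apply cder_plus; [exact Hf | apply cder_scal; exact Hg].
Qed.

Lemma cder_div (f g : C -> C) (z a b : C) : cder f z a -> cder g z b -> g z <> 0%C ->
  cder (fun u => f u / g u)%C z ((a * g z - f z * b) / (g z * g z))%C.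
Proof.
  intros Hf Hg Hn.
  replace ((a * g z - f z * b) / (g z * g z))%C with (a * / g z + f z * - (b / (g z * g z)))%C
    by (field; exact Hn).
  apply (cder_mult f (fun u => / g u)%C); [exact Hf | apply cder_inv; assumption].
Qed.

Lemma cder_shift (f : C -> C) (a z d : C) : cder f (a + z)%C d -> cder (fun u => f (a + u)%C) z d.
Proof.
  intros H. replace d with (d * (0 + 1))%C by ring.
  apply (cder_comp f (fun u => a + u)%C); [|exact H].
  apply (cder_plus (fun _ => a)); [apply cder_const | apply cder_id].
Qed.

Lemma cder_pow (f : C -> C) (z a : C) (n : nat) : cder f z a -> exists b, cder (fun u => f u ^ n)%C z b.
Proof.
  intros H. induction n as [|n [b Hb]].
  - exists 0%C. apply (cder_ext (fun _ => RtoC 1)); [reflexivity | apply cder_const].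
  - eexists. apply (cder_ext (fun u => f u * f u ^ n)%C); [intros; symmetry; apply Cpow_S |].
    apply (cder_mult f (fun u => f u ^ n)%C); [exact H | exact Hb].
Qed.

Lemma cder_unique (f : C -> C) (z a b : C) : cder f z a -> cder f z b -> a = b.
Proof.
  intros Ha Hb. apply NNPP. intros Hn.
  assert (Hp : 0 < Cmod (a - b)).
  { apply Cmod_gt_0. intros H. apply Hn. replace a with (a - b + b)%C by ring. rewrite H. ring. }
  destruct (Ha (Cmod (a - b) / 3)) as [d1 [Hd1 H1]]; [lra|].
  destruct (Hb (Cmod (a - b) / 3)) as [d2 [Hd2 H2]]; [lra|].
  set (t := Rmin d1 d2 / 2).
  assert (Ht : 0 < Rmin d1 d2) by (apply Rmin_pos; assumption).
  assert (Hm : Cmod (RtoC t) = t) by (rewrite Cmod_R; apply Rabs_pos_eq; unfold t; lra).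
  pose proof (Rmin_l d1 d2). pose proof (Rmin_r d1 d2).
  specialize (H1 t ltac:(rewrite Hm; unfold t; lra)). specialize (H2 t ltac:(rewrite Hm; unfold t; lra)).
  assert (H3 : Cmod ((a - b) * t) <= 2 * (Cmod (a - b) / 3) * t).
  { replace ((a - b) * t)%C with ((f (z + t) - f z - b * t) - (f (z + t) - f z - a * t))%C by ring.
    eapply Rle_trans; [apply Cmod_triangle'|]. rewrite Hm in *. lra. }
  rewrite Cmod_mult, Hm in H3. assert (0 < t) by (unfold t; lra). nra.
Qed.

(** The passage to real calculus: along a line, the real and imaginary parts become differentiable
    functions of one real variable. *)
Lemma cder_line (f : C -> C) (a b d : C) (t : R) : cder f (a + RtoC t * b)%C d ->
  is_derive (fun s : R => Re (f (a + RtoC s * b)%C)) t (Re (d * b)) /\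
  is_derive (fun s : R => Im (f (a + RtoC s * b)%C)) t (Im (d * b)).
Proof.
  intros H. pose proof (Cmod_ge_0 b) as Hb.
  assert (Key : forall eps, 0 < eps -> exists delta, 0 < delta /\ forall u : R, u <> 0 -> Rabs u < delta ->
    Cmod (f (a + RtoC (t + u) * b) - f (a + RtoC t * b) - RtoC u * (d * b))%C < eps * Rabs u).
  { intros eps He. destruct (H (eps / (Cmod b + 1))) as [e [Hp H1]]; [apply Rdiv_lt_0_compat; lra|].
    exists (e / (Cmod b + 1)). split; [apply Rdiv_lt_0_compat; lra|]. intros u Hu0 Hu.
    specialize (H1 (RtoC u * b)%C).
    replace (a + RtoC t * b + RtoC u * b)%C with (a + RtoC (t + u) * b)%C in H1 by (rewrite RtoC_plus; ring).
    replace (d * (RtoC u * b))%C with (RtoC u * (d * b))%C in H1 by ring.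
    rewrite Cmod_mult, Cmod_R in H1.
    apply Rmult_lt_compat_r with (r := Cmod b + 1) in Hu; [|lra].
    replace (e / (Cmod b + 1) * (Cmod b + 1)) with e in Hu by (field; lra).
    pose proof (Rabs_pos_lt u Hu0).
    eapply Rle_lt_trans; [apply H1; nra|].
    replace (eps / (Cmod b + 1) * (Rabs u * Cmod b)) with (eps * Rabs u * (Cmod b / (Cmod b + 1))) by (field; lra).
    assert (Cmod b / (Cmod b + 1) < 1) by (apply Rmult_lt_reg_r with (Cmod b + 1); [lra|]; field_simplify; lra).
    assert (0 < eps * Rabs u) by (apply Rmult_lt_0_compat; assumption). nra. }
  split; apply is_derive_Reals; intros eps He; destruct (Key eps He) as [e [Hp H1]];
    exists (mkposreal e Hp); intros u Hu0 Hu; specialize (H1 u Hu0 Hu);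
    pose proof (Rabs_pos_lt u Hu0) as Hup;
    set (X := f (a + RtoC (t + u) * b)%C) in *; set (Y := f (a + RtoC t * b)%C) in *.
  - replace ((Re X - Re Y) / u - Re (d * b)) with ((Re (X - Y - RtoC u * (d * b)))%C / u).
    2:{ destruct X, Y, (d*b)%C. unfold Re. simpl. field. exact Hu0. }
    unfold Rdiv. rewrite Rabs_mult, Rabs_inv.
    apply Rmult_lt_reg_r with (Rabs u); [exact Hup|].
    rewrite Rmult_assoc, Rinv_l, Rmult_1_r by lra. eapply Rle_lt_trans; [apply re_le_Cmod|exact H1].
  - replace ((Im X - Im Y) / u - Im (d * b)) with ((Im (X - Y - RtoC u * (d * b)))%C / u).
    2:{ destruct X, Y, (d*b)%C. unfold Im. simpl. field. exact Hu0. }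
    unfold Rdiv. rewrite Rabs_mult, Rabs_inv.
    apply Rmult_lt_reg_r with (Rabs u); [exact Hup|].
    rewrite Rmult_assoc, Rinv_l, Rmult_1_r by lra. eapply Rle_lt_trans; [apply im_le_Cmod|exact H1].
Qed.

(** * Bisection and Goursat's lemma *)

Lemma half_pow_lt (d : R) (K : R) : 0 < d -> exists n : nat, K * (/ 2) ^ n < d.
Proof.
  intros Hd. destruct (Rle_dec K 0) as [HK | HK].
  - exists 0%nat. simpl. lra.
  - destruct (pow_lt_1_zero (/ 2)) with (y := d / K) as [n Hn].
    + rewrite Rabs_pos_eq; lra.
    + apply Rdiv_lt_0_compat; lra.
    + exists n. specialize (Hn n (le_n n)).
      rewrite Rabs_pos_eq in Hn by (apply pow_le; lra).
      apply Rmult_lt_compat_l with (r := K) in Hn; [|lra].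
      replace (K * (d / K)) with d in Hn by (field; lra). exact Hn.
Qed.

Lemma nested_intervals (a b : nat -> R) :
  (forall n, a n <= a (S n)) -> (forall n, b (S n) <= b n) -> (forall n, a n <= b n) ->
  exists z, forall n, a n <= z <= b n.
Proof.
  intros Ha Hb Hab.
  assert (Ma : forall n k, a n <= a (n + k)%nat).
  { intros n k. induction k as [|k IH]; [rewrite Nat.add_0_r; lra|].
    rewrite Nat.add_succ_r. specialize (Ha (n + k)%nat). lra. }
  assert (Mb : forall n k, b (n + k)%nat <= b n).
  { intros n k. induction k as [|k IH]; [rewrite Nat.add_0_r; lra|].
    rewrite Nat.add_succ_r. specialize (Hb (n + k)%nat). lra. }
  assert (H : forall m n, a m <= b n).
  { intros m n. specialize (Ma m n). specialize (Mb n m). specialize (Hab (m + n)%nat).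
    rewrite (Nat.add_comm n m) in Mb. lra. }
  destruct (completeness (fun x => exists n, x = a n)) as [z [Hz1 Hz2]].
  - exists (b 0%nat). intros x [n ->]. apply H.
  - exists (a 0%nat). exists 0%nat. reflexivity.
  - exists z. intros n. split.
    + apply Hz1. exists n. reflexivity.
    + apply Hz2. intros x [m ->]. apply H.
Qed.

(* The common core of Goursat's lemma and of the Heine-Borel theorem. *)
Lemma bisection (P : R -> R -> R -> R -> Prop) (X1 X2 Y1 Y2 : R) :
  X1 <= X2 -> Y1 <= Y2 ->
  (forall x1 x2 y1 y2, X1 <= x1 -> x1 <= x2 -> x2 <= X2 -> Y1 <= y1 -> y1 <= y2 -> y2 <= Y2 ->
     P x1 ((x1 + x2) / 2) y1 ((y1 + y2) / 2) -> P ((x1 + x2) / 2) x2 y1 ((y1 + y2) / 2) ->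
     P x1 ((x1 + x2) / 2) ((y1 + y2) / 2) y2 -> P ((x1 + x2) / 2) x2 ((y1 + y2) / 2) y2 ->
     P x1 x2 y1 y2) ->
  (forall x y, X1 <= x <= X2 -> Y1 <= y <= Y2 -> exists d, 0 < d /\
     forall x1 x2 y1 y2, X1 <= x1 -> x1 <= x <= x2 -> x2 <= X2 -> Y1 <= y1 -> y1 <= y <= y2 -> y2 <= Y2 ->
       x2 - x1 < d -> y2 - y1 < d -> P x1 x2 y1 y2) ->
  P X1 X2 Y1 Y2.
Proof.
  intros HX HY Hq Hloc. apply NNPP. intros HnP.
  pose (Q := fun s : R * R * (R * R) => P (fst (fst s)) (snd (fst s)) (fst (snd s)) (snd (snd s))).
  pose (step := fun s : R * R * (R * R) =>
    let x1 := fst (fst s) in let x2 := snd (fst s) in let y1 := fst (snd s) in let y2 := snd (snd s) in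
    let q1 := ((x1, (x1 + x2) / 2), (y1, (y1 + y2) / 2)) in
    let q2 := (((x1 + x2) / 2, x2), (y1, (y1 + y2) / 2)) in
    let q3 := ((x1, (x1 + x2) / 2), ((y1 + y2) / 2, y2)) in
    let q4 := (((x1 + x2) / 2, x2), ((y1 + y2) / 2, y2)) in
    (* [q4] is taken untested: if [P] held on the other three quarters and on [q4], then [Hq] would
       give it on the whole rectangle. *)
    if excluded_middle_informative (Q q1) then
      if excluded_middle_informative (Q q2) then
        if excluded_middle_informative (Q q3) then q4 else q3
      else q2
    else q1).
  pose (good := fun s : R * R * (R * R) =>
    X1 <= fst (fst s) /\ fst (fst s) <= snd (fst s) /\ snd (fst s) <= X2 /\
    Y1 <= fst (snd s) /\ fst (snd s) <= snd (snd s) /\ snd (snd s) <= Y2 /\ ~ Q s).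
  assert (Hstep : forall s, good s -> good (step s) /\
     fst (fst s) <= fst (fst (step s)) /\ snd (fst (step s)) <= snd (fst s) /\
     fst (snd s) <= fst (snd (step s)) /\ snd (snd (step s)) <= snd (snd s) /\
     snd (fst (step s)) - fst (fst (step s)) = (snd (fst s) - fst (fst s)) / 2 /\
     snd (snd (step s)) - fst (snd (step s)) = (snd (snd s) - fst (snd s)) / 2).
  { intros [[x1 x2] [y1 y2]] (G1 & G2 & G3 & G4 & G5 & G6 & G7).
    specialize (Hq x1 x2 y1 y2). unfold step, good; simpl in *.
    repeat match goal with |- context [excluded_middle_informative ?p] =>
      destruct (excluded_middle_informative p) end; simpl; repeat split; try lra; try assumption.
    intros Hq4. apply G7. apply Hq; assumption. }
  pose (s := fix s n := match n with O => ((X1, X2), (Y1, Y2)) | S n => step (s n) end).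
  assert (Hs : forall n, good (s n)).
  { induction n as [|n IH]; [unfold good; simpl; repeat split; try lra; exact HnP|].
    apply Hstep. exact IH. }
  assert (Hw : forall n, snd (fst (s n)) - fst (fst (s n)) = (X2 - X1) * (/ 2) ^ n /\
                         snd (snd (s n)) - fst (snd (s n)) = (Y2 - Y1) * (/ 2) ^ n).
  { induction n as [|n [I1 I2]]; [simpl; lra|].
    destruct (Hstep _ (Hs n)) as (_ & _ & _ & _ & _ & E1 & E2).
    change (s (S n)) with (step (s n)). rewrite E1, E2, I1, I2. simpl. lra. }
  destruct (nested_intervals (fun n => fst (fst (s n))) (fun n => snd (fst (s n)))) as [x Hx].
  { intros n. apply (Hstep _ (Hs n)). }
  { intros n. apply (Hstep _ (Hs n)). }
  { intros n. apply (Hs n). }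
  destruct (nested_intervals (fun n => fst (snd (s n))) (fun n => snd (snd (s n)))) as [y Hy].
  { intros n. apply (Hstep _ (Hs n)). }
  { intros n. apply (Hstep _ (Hs n)). }
  { intros n. apply (Hs n). }
  destruct (Hloc x y (Hx 0%nat) (Hy 0%nat)) as [d [Hd H]].
  destruct (half_pow_lt d (Rmax (X2 - X1) (Y2 - Y1)) Hd) as [n Hn].
  assert (Hp : 0 < (/ 2) ^ n) by (apply pow_lt; lra).
  pose proof (Rmax_l (X2 - X1) (Y2 - Y1)). pose proof (Rmax_r (X2 - X1) (Y2 - Y1)).
  destruct (Hw n) as [W1 W2]. destruct (Hs n) as (G1 & G2 & G3 & G4 & G5 & G6 & G7).
  apply G7. unfold Q. specialize (Hx n). specialize (Hy n). simpl in Hx, Hy. apply H; try assumption; nra.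
Qed.

(** * Integrals of complex-valued functions of a real variable *)

Ltac eqR := match goal with |- ?a = ?b => change (@eq R a b) end.

(** Componentwise, so that every rule is inherited from the real integral [RInt]. *)
Definition CI (g : R -> C) (a b : R) : C :=
  (RInt (fun t => Re (g t)) a b, RInt (fun t => Im (g t)) a b).

Definition cont_on (g : R -> C) (a b : R) : Prop := forall t, a <= t <= b -> continuous g t.

Lemma ex_RInt_Re (g : R -> C) (a b : R) : a <= b -> cont_on g a b -> ex_RInt (fun t => Re (g t)) a b.
Proof.
  intros Hab H. apply (ex_RInt_continuous (V := R_CompleteNormedModule)).
  intros z Hz. rewrite Rmin_left, Rmax_right in Hz by lra. apply continuous_Re, H, Hz.
Qed.

Lemma ex_RInt_Im (g : R -> C) (a b : R) : a <= b -> cont_on g a b -> ex_RInt (fun t => Im (g t)) a b.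
Proof.
  intros Hab H. apply (ex_RInt_continuous (V := R_CompleteNormedModule)).
  intros z Hz. rewrite Rmin_left, Rmax_right in Hz by lra. apply continuous_Im, H, Hz.
Qed.

Lemma CI_ext (f g : R -> C) (a b : R) : a <= b -> (forall t, a <= t <= b -> f t = g t) -> CI f a b = CI g a b.
Proof.
  intros Hab H. unfold CI. f_equal; apply RInt_ext; intros x Hx;
    rewrite Rmin_left, Rmax_right in Hx by lra; rewrite H by lra; reflexivity.
Qed.

Lemma CI_plus (f g : R -> C) (a b : R) : a <= b -> cont_on f a b -> cont_on g a b ->
  CI (fun t => f t + g t)%C a b = (CI f a b + CI g a b)%C.
Proof.
  intros Hab Hf Hg. unfold CI, Cplus. simpl.
  f_equal.
  - apply (RInt_plus (V := R_CompleteNormedModule) (fun t => Re (f t)) (fun t => Re (g t)));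
      apply ex_RInt_Re; assumption.
  - apply (RInt_plus (V := R_CompleteNormedModule) (fun t => Im (f t)) (fun t => Im (g t)));
      apply ex_RInt_Im; assumption.
Qed.

Lemma RInt_lin2 (u v : R -> R) (p q a b : R) : ex_RInt u a b -> ex_RInt v a b ->
  RInt (fun t => p * u t + q * v t) a b = p * RInt u a b + q * RInt v a b.
Proof.
  intros Hu Hv.
  rewrite (RInt_plus (V := R_CompleteNormedModule) (fun t => p * u t) (fun t => q * v t)).
  - rewrite (RInt_scal (V := R_CompleteNormedModule) u), (RInt_scal (V := R_CompleteNormedModule) v)
      by assumption. reflexivity.
  - apply (ex_RInt_scal (V := R_CompleteNormedModule) u). exact Hu.
  - apply (ex_RInt_scal (V := R_CompleteNormedModule) v). exact Hv.
Qed.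

Lemma CI_scal (c : C) (g : R -> C) (a b : R) : a <= b -> cont_on g a b ->
  CI (fun t => c * g t)%C a b = (c * CI g a b)%C.
Proof.
  intros Hab Hg. pose proof (ex_RInt_Re g a b Hab Hg). pose proof (ex_RInt_Im g a b Hab Hg).
  unfold CI, Cmult. simpl. f_equal.
  - rewrite (RInt_ext _ (fun t => fst c * Re (g t) + (- snd c) * Im (g t))).
    2:{ intros t _. unfold Re, Im; simpl. ring. }
    rewrite RInt_lin2 by assumption. eqR; ring.
  - rewrite (RInt_ext _ (fun t => fst c * Im (g t) + snd c * Re (g t))).
    2:{ intros t _. unfold Re, Im; simpl. ring. }
    rewrite RInt_lin2 by assumption. eqR; ring.
Qed.

Lemma CI_minus (f g : R -> C) (a b : R) : a <= b -> cont_on f a b -> cont_on g a b ->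
  CI (fun t => f t - g t)%C a b = (CI f a b - CI g a b)%C.
Proof.
  intros Hab Hf Hg.
  rewrite (CI_ext (fun t => f t - g t)%C (fun t => f t + (-1) * g t)%C) by (exact Hab || (intros; ring)).
  rewrite (CI_plus f (fun t => (-1) * g t)%C), CI_scal; try assumption.
  - ring.
  - intros t Ht. apply continuous_Cmult; [apply continuous_const | apply Hg, Ht].
Qed.

Lemma CI_const (c : C) (a b : R) : CI (fun _ => c) a b = (RtoC (b - a) * c)%C.
Proof.
  unfold CI. rewrite !(RInt_const (V := R_CompleteNormedModule)).
  destruct c as [u v]. unfold RtoC, Cmult, scal, Re, Im; simpl. unfold mult; simpl. f_equal; ring.
Qed.

Lemma CI_Chasles (g : R -> C) (a b c : R) : a <= b -> b <= c -> cont_on g a c ->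
  (CI g a b + CI g b c)%C = CI g a c.
Proof.
  intros Hab Hbc Hg. unfold CI, Cplus. simpl.
  assert (H1 : cont_on g a b) by (intros t Ht; apply Hg; lra).
  assert (H2 : cont_on g b c) by (intros t Ht; apply Hg; lra).
  f_equal.
  - apply (RInt_Chasles (V := R_CompleteNormedModule) (fun t => Re (g t))); apply ex_RInt_Re; assumption.
  - apply (RInt_Chasles (V := R_CompleteNormedModule) (fun t => Im (g t))); apply ex_RInt_Im; assumption.
Qed.

Lemma CI_bound (g : R -> C) (a b K : R) : a <= b -> cont_on g a b ->
  (forall t, a <= t <= b -> Cmod (g t) <= K) -> Cmod (CI g a b) <= (b - a) * K.
Proof.
  intros Hab Hg HK.
  destruct (Ceq_dec (CI g a b) 0) as [E | Hn].
  { rewrite E, Cmod_0. apply Rmult_le_pos; [lra|].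
    eapply Rle_trans; [apply (Cmod_ge_0 (g a)) | apply HK; lra]. }
  pose proof (proj1 (Cmod_gt_0 _) Hn) as Hp.
  set (I := CI g a b) in *.
  (* multiply by the conjugate so that the integral becomes real *)
  assert (E : CI (fun t => Cconj I * g t)%C a b = (Cconj I * I)%C) by (apply CI_scal; assumption).
  assert (E2 : RInt (fun t => Re (Cconj I * g t)) a b = Cmod I * Cmod I).
  { change (Re (CI (fun t => Cconj I * g t)%C a b) = Cmod I * Cmod I). rewrite E.
    rewrite Cmod_sqr. destruct I; unfold Re, Im; simpl; ring. }
  assert (B : RInt (fun t => Re (Cconj I * g t)) a b <= RInt (fun _ => Cmod I * K) a b).
  { apply RInt_le; [exact Hab | | apply ex_RInt_const |].
    - apply ex_RInt_Re; [exact Hab|]. intros t Ht. apply continuous_Cmult; [apply continuous_const | apply Hg, Ht].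
    - intros t Ht. eapply Rle_trans; [apply Rle_abs|]. eapply Rle_trans; [apply re_le_Cmod|].
      rewrite Cmod_mult, Cmod_conj. apply Rmult_le_compat_l; [lra|]. apply HK; lra. }
  rewrite (RInt_const (V := R_CompleteNormedModule)), E2 in B. unfold scal in B; simpl in B; unfold mult in B; simpl in B.
  apply Rmult_le_reg_l with (Cmod I); [exact Hp|]. lra.
Qed.

Lemma RInt_affine (p q a b : R) : RInt (fun t => p + q * t) a b = p * (b - a) + q * (b * b - a * a) / 2.
Proof.
  replace (p * (b - a) + q * (b * b - a * a) / 2) with
    ((fun t => p * t + q * (t * t) / 2) b - (fun t => p * t + q * (t * t) / 2) a) by (simpl; field).
  apply is_RInt_unique.
  apply (is_RInt_derive (V := R_CompleteNormedModule) (fun t => p * t + q * (t * t) / 2)).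
  - intros x _. auto_derive; [exact I | field].
  - intros x _. apply (continuous_plus (fun _ => p) (fun t => q * t)); [apply continuous_const|].
    apply (continuous_mult (fun _ => q) (fun t => t)); [apply continuous_const | apply continuous_id].
Qed.

(* The integral of [f dz] along the positively oriented boundary of [x1,x2] x [y1,y2]. *)
Definition rect_int (f : C -> C) (x1 x2 y1 y2 : R) : C :=
  (CI (fun x => f (x, y1)) x1 x2 - CI (fun x => f (x, y2)) x1 x2 +
   Ci * (CI (fun y => f (x2, y)) y1 y2 - CI (fun y => f (x1, y)) y1 y2))%C.

Definition cont_rect (f : C -> C) (x1 x2 y1 y2 : R) : Prop :=
  forall x y, x1 <= x <= x2 -> y1 <= y <= y2 -> continuous f (x, y).

Lemma continuous_hor (f : C -> C) (x y : R) : continuous f (x, y) -> continuous (fun s : R => f (s, y)) x.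
Proof.
  intros H. apply (continuous_comp (fun s : R => ((s, y) : C)) f); [|exact H].
  apply continuous_C_pair; [apply continuous_id | apply (continuous_const y)].
Qed.

Lemma continuous_ver (f : C -> C) (x y : R) : continuous f (x, y) -> continuous (fun s : R => f (x, s)) y.
Proof.
  intros H. apply (continuous_comp (fun s : R => ((x, s) : C)) f); [|exact H].
  apply continuous_C_pair; [apply (continuous_const x) | apply continuous_id].
Qed.

Lemma rect_int_split (f : C -> C) (x1 xm x2 y1 ym y2 : R) :
  x1 <= xm -> xm <= x2 -> y1 <= ym -> ym <= y2 -> cont_rect f x1 x2 y1 y2 ->
  rect_int f x1 x2 y1 y2 =
  (rect_int f x1 xm y1 ym + rect_int f xm x2 y1 ym + rect_int f x1 xm ym y2 + rect_int f xm x2 ym y2)%C.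
Proof.
  intros H1 H2 H3 H4 Hc. unfold rect_int.
  assert (Hh : forall y, y1 <= y <= y2 -> (CI (fun x => f (x, y)) x1 xm + CI (fun x => f (x, y)) xm x2)%C
     = CI (fun x => f (x, y)) x1 x2).
  { intros y Hy. apply CI_Chasles; try assumption. intros t Ht. apply continuous_hor, Hc; lra. }
  assert (Hv : forall x, x1 <= x <= x2 -> (CI (fun y => f (x, y)) y1 ym + CI (fun y => f (x, y)) ym y2)%C
     = CI (fun y => f (x, y)) y1 y2).
  { intros x Hx. apply CI_Chasles; try assumption. intros t Ht. apply continuous_ver, Hc; lra. }
  rewrite <- (Hh y1), <- (Hh y2), <- (Hv x1), <- (Hv x2) by lra. ring.
Qed.

(** Affine functions have a primitive; here the four sides are simply computed. These are the
    tangents subtracted in Goursat's lemma. *)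
Lemma rect_int_affine (c0 c1 : C) (x1 x2 y1 y2 : R) :
  rect_int (fun z => c0 + c1 * z)%C x1 x2 y1 y2 = 0%C.
Proof.
  destruct c0 as [p q], c1 as [u v]. unfold rect_int.
  assert (Hh : forall y, CI (fun x : R => ((p, q) + (u, v) * (x, y))%C) x1 x2 =
    ((p - v * y) * (x2 - x1) + u * (x2 * x2 - x1 * x1) / 2,
     (q + u * y) * (x2 - x1) + v * (x2 * x2 - x1 * x1) / 2)).
  { intros y. unfold CI. f_equal.
    - rewrite (RInt_ext _ (fun t => (p - v * y) + u * t)); [apply RInt_affine|].
      intros x _. unfold Re; simpl. ring.
    - rewrite (RInt_ext _ (fun t => (q + u * y) + v * t)); [apply RInt_affine|].
      intros x _. unfold Im; simpl. ring. }
  assert (Hv : forall x, CI (fun y : R => ((p, q) + (u, v) * (x, y))%C) y1 y2 =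
    ((p + u * x) * (y2 - y1) + (- v) * (y2 * y2 - y1 * y1) / 2,
     (q + v * x) * (y2 - y1) + u * (y2 * y2 - y1 * y1) / 2)).
  { intros x. unfold CI. f_equal.
    - rewrite (RInt_ext _ (fun t => (p + u * x) + (- v) * t)); [apply RInt_affine|].
      intros y _. unfold Re; simpl. ring.
    - rewrite (RInt_ext _ (fun t => (q + v * x) + u * t)); [apply RInt_affine|].
      intros y _. unfold Im; simpl. ring. }
  rewrite !Hh, !Hv. unfold Cminus, Cplus, Cmult, Copp, Ci, RtoC; simpl. f_equal; field.
Qed.

Lemma rect_int_bound (f : C -> C) (x1 x2 y1 y2 K : R) : x1 <= x2 -> y1 <= y2 -> cont_rect f x1 x2 y1 y2 ->
  (forall x y, x1 <= x <= x2 -> y1 <= y <= y2 -> Cmod (f (x, y)) <= K) ->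
  Cmod (rect_int f x1 x2 y1 y2) <= 2 * ((x2 - x1) + (y2 - y1)) * K.
Proof.
  intros Hx Hy Hc HK. unfold rect_int.
  assert (Hh : forall y, y1 <= y <= y2 -> Cmod (CI (fun x => f (x, y)) x1 x2) <= (x2 - x1) * K).
  { intros y H. apply CI_bound; [exact Hx | |].
    - intros t Ht. apply continuous_hor, Hc; lra.
    - intros t Ht. apply HK; lra. }
  assert (Hv : forall x, x1 <= x <= x2 -> Cmod (CI (fun y => f (x, y)) y1 y2) <= (y2 - y1) * K).
  { intros x H. apply CI_bound; [exact Hy | |].
    - intros t Ht. apply continuous_ver, Hc; lra.
    - intros t Ht. apply HK; lra. }
  eapply Rle_trans; [apply Cmod_triangle|]. rewrite Cmod_mult, Cmod_Ci, Rmult_1_l.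
  pose proof (Cmod_triangle' (CI (fun x => f (x, y1)) x1 x2) (CI (fun x => f (x, y2)) x1 x2)).
  pose proof (Cmod_triangle' (CI (fun y => f (x2, y)) y1 y2) (CI (fun y => f (x1, y)) y1 y2)).
  pose proof (Hh y1 ltac:(lra)). pose proof (Hh y2 ltac:(lra)).
  pose proof (Hv x1 ltac:(lra)). pose proof (Hv x2 ltac:(lra)). lra.
Qed.

Lemma rect_int_minus (f g : C -> C) (x1 x2 y1 y2 : R) : x1 <= x2 -> y1 <= y2 ->
  cont_rect f x1 x2 y1 y2 -> cont_rect g x1 x2 y1 y2 ->
  rect_int (fun z => f z - g z)%C x1 x2 y1 y2 = (rect_int f x1 x2 y1 y2 - rect_int g x1 x2 y1 y2)%C.
Proof.
  intros Hx Hy Hf Hg. unfold rect_int.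
  assert (Hh : forall y, y1 <= y <= y2 -> CI (fun x => f (x, y) - g (x, y))%C x1 x2 =
    (CI (fun x => f (x, y)) x1 x2 - CI (fun x => g (x, y)) x1 x2)%C).
  { intros y H. apply (CI_minus (fun x => f (x, y)) (fun x => g (x, y))); [exact Hx | |];
      intros t Ht; apply continuous_hor; [apply Hf | apply Hg]; lra. }
  assert (Hv : forall x, x1 <= x <= x2 -> CI (fun y => f (x, y) - g (x, y))%C y1 y2 =
    (CI (fun y => f (x, y)) y1 y2 - CI (fun y => g (x, y)) y1 y2)%C).
  { intros x H. apply (CI_minus (fun y => f (x, y)) (fun y => g (x, y))); [exact Hy | |];
      intros t Ht; apply continuous_ver; [apply Hf | apply Hg]; lra. }
  rewrite (Hh y1), (Hh y2), (Hv x1), (Hv x2) by lra. ring.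
Qed.

(** The bound [eps] times the square of the half-perimeter passes from the four quarters to the
    whole, since halving the sides divides it by 4. Near a point it holds because subtracting the
    tangent does not change the integral, the remainder is at most [eps/2] times the half-perimeter,
    and the path is two half-perimeters long. Then [eps] tends to 0. *)
Theorem goursat (f : C -> C) (X1 X2 Y1 Y2 : R) : X1 <= X2 -> Y1 <= Y2 ->
  (forall x y, X1 <= x <= X2 -> Y1 <= y <= Y2 -> exists d, cder f (x, y) d) ->
  rect_int f X1 X2 Y1 Y2 = 0%C.
Proof.
  intros HX HY Hd.
  assert (Hc : cont_rect f X1 X2 Y1 Y2).
  { intros x y Hx Hy. destruct (Hd x y Hx Hy) as [d H]. exact (cder_continuous _ _ _ H). }
  assert (Main : forall eps, 0 < eps ->
     Cmod (rect_int f X1 X2 Y1 Y2) <= eps * (((X2 - X1) + (Y2 - Y1)) * ((X2 - X1) + (Y2 - Y1)))).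
  { intros eps He.
    apply (bisection (fun x1 x2 y1 y2 => Cmod (rect_int f x1 x2 y1 y2) <=
      eps * (((x2 - x1) + (y2 - y1)) * ((x2 - x1) + (y2 - y1))))); try assumption.
    - intros x1 x2 y1 y2 G1 G2 G3 G4 G5 G6 Q1 Q2 Q3 Q4.
      rewrite (rect_int_split f x1 ((x1 + x2) / 2) x2 y1 ((y1 + y2) / 2) y2) by
        (try lra; intros x y Hx Hy; apply Hc; lra).
      eapply Rle_trans; [apply Cmod_triangle|].
      eapply Rle_trans; [apply Rplus_le_compat_r, Cmod_triangle|].
      eapply Rle_trans; [apply Rplus_le_compat_r, Rplus_le_compat_r, Cmod_triangle|]. nra.
    - intros x y Hx Hy. destruct (Hd x y Hx Hy) as [d H].
      destruct (H (eps / 2)) as [e [Hep He']]; [lra|].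
      exists (e / 2). split; [lra|].
      intros x1 x2 y1 y2 G1 G2 G3 G4 G5 G6 Gx Gy.
      set (A := fun z : C => (f (x, y) - d * (x, y) + d * z)%C).
      assert (HAc : cont_rect A x1 x2 y1 y2).
      { intros u v _ _. unfold A. apply continuous_Cplus; [apply continuous_const|].
        apply continuous_Cmult; [apply continuous_const | apply continuous_id]. }
      assert (Hfc : cont_rect f x1 x2 y1 y2) by (intros u v Hu Hv; apply Hc; lra).
      replace (rect_int f x1 x2 y1 y2) with (rect_int (fun z => f z - A z)%C x1 x2 y1 y2).
      2:{ rewrite rect_int_minus; try assumption; try lra. unfold A. rewrite rect_int_affine. ring. }
      eapply Rle_trans.
      + apply (rect_int_bound _ _ _ _ _ (eps / 2 * ((x2 - x1) + (y2 - y1)))); try lra.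
        * intros u v Hu Hv. apply continuous_Cminus; [apply Hfc | apply HAc]; assumption.
        * intros u v Hu Hv. unfold A.
          specialize (He' ((u, v) - (x, y))%C).
          replace ((x, y) + ((u, v) - (x, y)))%C with ((u, v) : C) in He'
            by (generalize ((u, v) : C) ((x, y) : C); intros; ring).
          replace (f (u, v) - (f (x, y) - d * (x, y) + d * (u, v)))%C with
            (f (u, v) - f (x, y) - d * ((u, v) - (x, y)))%C
            by (generalize ((u, v) : C) ((x, y) : C); intros; ring).
          assert (B : Cmod ((u, v) - (x, y))%C <= (x2 - x1) + (y2 - y1)).
          { eapply Rle_trans; [apply Cmod_le_sum|]. unfold Re, Im; simpl.
            apply Rplus_le_compat; apply Rabs_le; lra. }
          eapply Rle_trans; [apply He'; lra|]. apply Rmult_le_compat_l; lra.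
      + apply Req_le. field. }
  apply Cmod_eq_0. apply Rle_antisym; [|apply Cmod_ge_0].
  apply le_epsilon. intros e He. rewrite Rplus_0_l.
  set (W := ((X2 - X1) + (Y2 - Y1)) * ((X2 - X1) + (Y2 - Y1))) in *.
  assert (HW : 0 <= W) by (unfold W; nra).
  eapply Rle_trans; [apply (Main (e / (W + 1))); apply Rdiv_lt_0_compat; lra|].
  replace (e / (W + 1) * W) with (e * (W / (W + 1))) by (field; lra).
  assert (W / (W + 1) <= 1) by (apply Rmult_le_reg_r with (W + 1); [lra|]; field_simplify; lra). nra.
Qed.

(** * Cauchy's formula *)

Definition cexp (z : C) : C := (RtoC (exp (Re z)) * cis (Im z))%C.

Lemma Cmod_Rcis (r t : R) : 0 <= r -> Cmod (RtoC r * cis t)%C = r.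
Proof. intros Hr. rewrite Cmod_mult, Cmod_cis, Cmod_R, Rabs_pos_eq by exact Hr. ring. Qed.

Lemma derivable_pt_lim_0_bound (g : R -> R) (l : R) : derivable_pt_lim g 0 l ->
  forall eps, 0 < eps -> exists d, 0 < d /\ forall x, Rabs x < d -> Rabs (g x - g 0 - l * x) <= eps * Rabs x.
Proof.
  intros H eps He. destruct (H eps He) as [d Hd]. exists d. split; [apply cond_pos|].
  intros x Hx. destruct (Req_dec x 0) as [-> | Hn].
  { replace (g 0 - g 0 - l * 0) with 0 by ring. rewrite Rabs_R0. lra. }
  specialize (Hd x Hn Hx). rewrite Rplus_0_l in Hd.
  replace (g x - g 0 - l * x) with (((g x - g 0) / x - l) * x) by (field; exact Hn).
  rewrite Rabs_mult. apply Rmult_le_compat_r; [apply Rabs_pos | lra].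
Qed.

(** At 0 the claim reduces to the real derivatives of [exp], [cos] and [sin]; the addition law
    [cexp_plus] carries it to all other points. *)
Lemma cder_cexp_0 : cder cexp 0%C 1%C.
Proof.
  intros eps He.
  set (e := Rmin (eps / 8) 1). assert (Hep : 0 < e) by (apply Rmin_pos; lra).
  assert (He8 : e <= eps / 8) by apply Rmin_l. assert (He1 : e <= 1) by apply Rmin_r.
  destruct (derivable_pt_lim_0_bound exp 1) with (eps := e) as [d1 [Hd1 H1]]; [|exact Hep|].
  { rewrite <- exp_0 at 1. rewrite exp_0. pose proof (derivable_pt_lim_exp 0) as H. rewrite exp_0 in H. exact H. }
  destruct (derivable_pt_lim_0_bound cos 0) with (eps := e) as [d2 [Hd2 H2]]; [|exact Hep|].
  { pose proof (derivable_pt_lim_cos 0) as H. rewrite sin_0, Ropp_0 in H. exact H. }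
  destruct (derivable_pt_lim_0_bound sin 1) with (eps := e) as [d3 [Hd3 H3]]; [|exact Hep|].
  { pose proof (derivable_pt_lim_sin 0) as H. rewrite cos_0 in H. exact H. }
  exists (Rmin (Rmin d1 d2) (Rmin d3 (e / 2))). split; [repeat apply Rmin_pos; lra|].
  intros h Hh. destruct h as [x y].
  destruct (lt_Rmin _ _ _ Hh) as [[L1 L2]%lt_Rmin [L3 L4]%lt_Rmin].
  pose proof (re_le_Cmod (x, y)) as Rx. pose proof (im_le_Cmod (x, y)) as Ry.
  unfold Re, Im in Rx, Ry; simpl fst in Rx; simpl snd in Ry.
  specialize (H1 x ltac:(lra)). specialize (H2 y ltac:(lra)). specialize (H3 y ltac:(lra)).
  rewrite exp_0 in H1. rewrite cos_0 in H2. rewrite sin_0 in H3.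
  replace (cos y - 1 - 0 * y) with (cos y - 1) in H2 by ring.
  replace (sin y - 0 - 1 * y) with (sin y - y) in H3 by ring.
  set (m := Cmod (x, y)) in *.
  pose proof (Rabs_pos x). pose proof (Rabs_pos y).
  assert (E1 : Rabs (exp x - 1) <= e).
  { replace (exp x - 1) with ((exp x - 1 - 1 * x) + x) by ring.
    eapply Rle_trans; [apply Rabs_triang|]. nra. }
  assert (E2 : Rabs (exp x) <= 2).
  { replace (exp x) with ((exp x - 1) + 1) by ring. eapply Rle_trans; [apply Rabs_triang|]. rewrite Rabs_R1. lra. }
  eapply Rle_trans; [apply Cmod_le_sum|].
  replace (Re (cexp (0 + (x, y)) - cexp 0 - 1 * (x, y))%C) with
    ((exp x - 1 - 1 * x) + exp x * (cos y - 1)).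
  2:{ unfold cexp, cis, Re, Im; simpl. rewrite !Rplus_0_l, exp_0, cos_0, sin_0. ring. }
  replace (Im (cexp (0 + (x, y)) - cexp 0 - 1 * (x, y))%C) with
    (exp x * (sin y - y) + (exp x - 1) * y).
  2:{ unfold cexp, cis, Re, Im; simpl. rewrite !Rplus_0_l, exp_0, cos_0, sin_0. ring. }
  eapply Rle_trans; [apply Rplus_le_compat; apply Rabs_triang|].
  rewrite !Rabs_mult.
  assert (T1 : Rabs (exp x) * Rabs (cos y - 1) <= 2 * (e * Rabs y)).
  { apply Rmult_le_compat; try apply Rabs_pos; assumption. }
  assert (T2 : Rabs (exp x) * Rabs (sin y - y) <= 2 * (e * Rabs y)).
  { apply Rmult_le_compat; try apply Rabs_pos; assumption. }
  assert (T3 : Rabs (exp x - 1) * Rabs y <= e * Rabs y).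
  { apply Rmult_le_compat_r; assumption. }
  assert (T4 : e * Rabs x <= e * m) by (apply Rmult_le_compat_l; lra).
  assert (T5 : e * Rabs y <= e * m) by (apply Rmult_le_compat_l; lra).
  assert (0 <= m) by apply Cmod_ge_0.
  assert (e * m <= eps / 8 * m) by (apply Rmult_le_compat_r; assumption).
  assert (0 <= eps * m) by (apply Rmult_le_pos; lra). lra.
Qed.

Lemma cexp_plus (a b : C) : cexp (a + b) = (cexp a * cexp b)%C.
Proof.
  unfold cexp. replace (Re (a + b)%C) with (Re a + Re b) by reflexivity.
  replace (Im (a + b)%C) with (Im a + Im b) by reflexivity.
  rewrite exp_plus, cis_plus, RtoC_mult. ring.
Qed.

Lemma cder_cexp (z : C) : cder cexp z (cexp z).
Proof.
  apply (cder_ext (fun u => cexp z * cexp (- z + u))%C).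
  { intros u. rewrite <- cexp_plus. f_equal. ring. }
  assert (H : cder (fun u => cexp (- z + u)%C) z 1).
  { apply cder_shift. replace (- z + z)%C with (RtoC 0) by ring. apply cder_cexp_0. }
  apply (cder_scal (cexp z)) in H. rewrite Cmult_1_r in H. exact H.
Qed.

(* [circ phi r] is the integral of [phi(z) dz/(i z)] over the circle [|z| = r]. *)
Definition circ (phi : C -> C) (r : R) : C := CI (fun t => phi (RtoC r * cis t)%C) 0 (2 * PI).

Definition holo_at (f : C -> C) (z : C) : Prop := exists d, cder f z d.

Lemma holo_continuous (f : C -> C) (z : C) : holo_at f z -> continuous f z.
Proof. intros [d H]. exact (cder_continuous f z d H). Qed.

Lemma cont_circle (phi : C -> C) (r : R) : 0 <= r -> (forall z, Cmod z = r -> continuous phi z) ->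
  cont_on (fun t => phi (RtoC r * cis t)%C) 0 (2 * PI).
Proof.
  intros Hr H t _. apply (continuous_comp (fun t => (RtoC r * cis t)%C) phi).
  - apply continuous_Cmult; [apply continuous_const | apply continuous_cis, continuous_id].
  - apply H. apply Cmod_Rcis, Hr.
Qed.

Lemma two_PI_ge_0 : 0 <= 2 * PI.
Proof. pose proof PI_RGT_0. lra. Qed.

Lemma circ_ext (f g : C -> C) (r : R) : 0 <= r -> (forall z, Cmod z = r -> f z = g z) -> circ f r = circ g r.
Proof.
  intros Hr H. apply CI_ext; [apply two_PI_ge_0|]. intros t _. apply H, Cmod_Rcis, Hr.
Qed.

Lemma circ_plus (f g : C -> C) (r : R) : 0 <= r -> (forall z, Cmod z = r -> continuous f z) ->
  (forall z, Cmod z = r -> continuous g z) -> circ (fun z => f z + g z)%C r = (circ f r + circ g r)%C.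
Proof.
  intros Hr Hf Hg. apply (CI_plus (fun t => f (RtoC r * cis t)%C) (fun t => g (RtoC r * cis t)%C));
    [apply two_PI_ge_0 | apply cont_circle; assumption | apply cont_circle; assumption].
Qed.

Lemma circ_minus (f g : C -> C) (r : R) : 0 <= r -> (forall z, Cmod z = r -> continuous f z) ->
  (forall z, Cmod z = r -> continuous g z) -> circ (fun z => f z - g z)%C r = (circ f r - circ g r)%C.
Proof.
  intros Hr Hf Hg. apply (CI_minus (fun t => f (RtoC r * cis t)%C) (fun t => g (RtoC r * cis t)%C));
    [apply two_PI_ge_0 | apply cont_circle; assumption | apply cont_circle; assumption].
Qed.

Lemma circ_scal (c : C) (f : C -> C) (r : R) : 0 <= r -> (forall z, Cmod z = r -> continuous f z) ->
  circ (fun z => c * f z)%C r = (c * circ f r)%C.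
Proof.
  intros Hr Hf. apply (CI_scal c (fun t => f (RtoC r * cis t)%C));
    [apply two_PI_ge_0 | apply cont_circle; assumption].
Qed.

Lemma circ_cst (c : C) (r : R) : circ (fun _ => c) r = (RtoC (2 * PI) * c)%C.
Proof. unfold circ. rewrite CI_const, Rminus_0_r. reflexivity. Qed.

Lemma circ_bound (f : C -> C) (r K : R) : 0 <= r -> (forall z, Cmod z = r -> continuous f z) ->
  (forall z, Cmod z = r -> Cmod (f z) <= K) -> Cmod (circ f r) <= 2 * PI * K.
Proof.
  intros Hr Hf HK. replace (2 * PI * K) with ((2 * PI - 0) * K) by ring.
  apply CI_bound; [apply two_PI_ge_0 | apply cont_circle; assumption |].
  intros t _. apply HK, Cmod_Rcis, Hr.
Qed.

(* Goursat in the coordinate [xi] with [z = exp xi]: the annulus becomes a rectangle whose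
   horizontal sides cancel by periodicity. *)
Lemma circ_invariant (phi : C -> C) (r1 r2 : R) : 0 < r1 -> r1 <= r2 ->
  (forall z, r1 <= Cmod z <= r2 -> holo_at phi z) -> circ phi r1 = circ phi r2.
Proof.
  intros H1 H2 H. pose proof two_PI_ge_0 as HP.
  assert (Hl : ln r1 <= ln r2).
  { destruct (Req_dec r1 r2) as [-> | Hn]; [lra|]. left. apply ln_increasing; lra. }
  assert (G := goursat (fun z => phi (cexp z)) (ln r1) (ln r2) 0 (2 * PI) Hl HP).
  assert (E : rect_int (fun z => phi (cexp z)) (ln r1) (ln r2) 0 (2 * PI) = 0%C).
  { apply G. intros x y Hx Hy. destruct (H (cexp (x, y))) as [d Hd].
    - unfold cexp, Re, Im; simpl fst; simpl snd. rewrite Cmod_Rcis by (left; apply exp_pos).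
      rewrite <- (exp_ln r1), <- (exp_ln r2) by lra.
      split; (destruct (Req_dec x (ln r1)) as [E1|N1]; destruct (Req_dec x (ln r2)) as [E2|N2];
        try (subst x; lra); try (left; apply exp_increasing; lra)); subst; try (rewrite E1; lra);
        try (rewrite E2; lra); try lra.
    - exists (d * cexp (x, y))%C. apply (cder_comp phi cexp); [apply cder_cexp | exact Hd]. }
  unfold rect_int in E.
  rewrite (CI_ext (fun x => phi (cexp (x, 2 * PI))) (fun x => phi (cexp (x, 0)))) in E by
    (try exact Hl; intros t _; unfold cexp, cis, Re, Im; simpl; rewrite sin_2PI, cos_2PI, sin_0, cos_0; reflexivity).
  assert (Ec : forall r, 0 < r -> CI (fun y => phi (cexp (ln r, y))) 0 (2 * PI) = circ phi r).
  { intros r Hr. apply CI_ext; [exact HP|]. intros t _. unfold cexp, Re, Im; simpl fst; simpl snd.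
    rewrite exp_ln by exact Hr. reflexivity. }
  rewrite (Ec r1), (Ec r2) in E by lra.
  set (J := CI (fun x => phi (cexp (x, 0))) (ln r1) (ln r2)) in E.
  assert (HCi : Ci <> 0%C) by (intros Hc; injection Hc; lra).
  assert (E' : (circ phi r2 - circ phi r1 = 0)%C).
  { replace (circ phi r2 - circ phi r1)%C with ((J - J + Ci * (circ phi r2 - circ phi r1)) / Ci)%C
      by (field; exact HCi). rewrite E. field. exact HCi. }
  replace (circ phi r2) with (circ phi r2 - circ phi r1 + circ phi r1)%C by ring. rewrite E'. ring.
Qed.

(** The integrand, read in polar coordinates, varies little with the radius near [s], uniformly over
    the compact range of angles. *)
Lemma circ_continuous (phi : C -> C) (s : R) : 0 < s ->
  (forall z, Cmod z = s -> continuous phi z) ->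
  forall eps, 0 < eps -> exists d, 0 < d /\ forall r, 0 < r -> Rabs (r - s) < d ->
    (forall z, Cmod z = r -> continuous phi z) -> Cmod (circ phi r - circ phi s)%C <= eps.
Proof.
  intros Hs Hc eps He. pose proof PI_RGT_0 as HPI.
  set (e := eps / (2 * (2 * PI))).
  assert (Hep : 0 < e) by (apply Rdiv_lt_0_compat; lra).
  set (pol := fun z : R * R => phi (RtoC (fst z) * cis (snd z))%C).
  assert (Hpol : forall t, continuous pol (s, t)).
  { intros t. unfold pol. apply (continuous_comp (fun z : R * R => (RtoC (fst z) * cis (snd z))%C) phi).
    - apply continuous_Cmult; [apply continuous_RtoC, continuous_fst | apply continuous_cis, continuous_snd].
    - apply Hc, Cmod_Rcis; simpl; lra. }
  destruct (uniform_continuity_2d_1d' (fun r t => Re (pol (r, t))) 0 (2 * PI) s) with (eps := mkposreal e Hep)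
    as [d1 Hd1].
  { intros t _. apply continuity_2d_pt_filterlim. apply (continuous_Re pol (s, t)), Hpol. }
  destruct (uniform_continuity_2d_1d' (fun r t => Im (pol (r, t))) 0 (2 * PI) s) with (eps := mkposreal e Hep)
    as [d2 Hd2].
  { intros t _. apply continuity_2d_pt_filterlim. apply (continuous_Im pol (s, t)), Hpol. }
  exists (Rmin d1 d2). split; [apply Rmin_pos; apply cond_pos|].
  intros r Hr Hrs Hcr.
  assert (R1 : Rabs (r - s) < d1) by (eapply Rlt_le_trans; [exact Hrs | apply Rmin_l]).
  assert (R2 : Rabs (r - s) < d2) by (eapply Rlt_le_trans; [exact Hrs | apply Rmin_r]).
  apply Rabs_def2 in R1. apply Rabs_def2 in R2.
  pose proof (cond_pos d1). pose proof (cond_pos d2).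
  unfold circ. rewrite <- CI_minus; [| lra | apply cont_circle; [lra | assumption] | apply cont_circle; [lra|assumption]].
  replace eps with ((2 * PI - 0) * (2 * e)) by (unfold e; field; lra).
  apply CI_bound; [lra | |].
  { intros t Ht. apply continuous_Cminus; apply (fun A B => cont_circle phi _ A B t Ht); try lra; assumption. }
  intros t Ht. eapply Rle_trans; [apply Cmod_le_sum|].
  assert (Z : Rabs (t - t) = 0) by (replace (t - t) with 0 by ring; apply Rabs_R0).
  specialize (Hd1 t s t r ltac:(lra) ltac:(lra) ltac:(lra) ltac:(lra) ltac:(lra)).
  specialize (Hd2 t s t r ltac:(lra) ltac:(lra) ltac:(lra) ltac:(lra) ltac:(lra)).
  cbv beta delta [pol] in Hd1, Hd2. simpl fst in Hd1, Hd2; simpl snd in Hd1, Hd2.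
  change (pos (mkposreal e Hep)) with e in Hd1, Hd2.
  apply Rlt_le in Hd1. apply Rlt_le in Hd2.
  eapply Rle_trans; [exact (Rplus_le_compat _ _ _ _ Hd1 Hd2)|]. lra.
Qed.

Lemma Cmod_le_eps_0 (z : C) : (forall eps, 0 < eps -> Cmod z <= eps) -> z = 0%C.
Proof.
  intros H. apply Cmod_eq_0. apply Rle_antisym; [|apply Cmod_ge_0].
  apply le_epsilon. intros e He. rewrite Rplus_0_l. apply H, He.
Qed.

Lemma Csub_0_eq (a b : C) : (a - b = 0)%C -> a = b.
Proof. intros H. replace a with (a - b + b)%C by ring. rewrite H. ring. Qed.

(** The circles of radii [s - e] and [s + e] are reached by [circ_invariant], and their integrals
    approach each other as [e] tends to 0. This is meant for difference quotients, of which at this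
    stage only continuity is known at the base point. *)
Lemma circ_invariant_except (phi : C -> C) (r1 s r2 : R) : 0 < r1 -> r1 < s -> s < r2 ->
  (forall z, r1 <= Cmod z <= r2 -> continuous phi z) ->
  (forall z, r1 <= Cmod z <= r2 -> Cmod z <> s -> holo_at phi z) -> circ phi r1 = circ phi r2.
Proof.
  intros H0 H1 H2 Hc Hh. symmetry. apply Csub_0_eq, Cmod_le_eps_0. intros eps He.
  destruct (circ_continuous phi s) with (eps := eps / 2) as [d [Hd H]]; [lra | intros; apply Hc; lra | lra |].
  set (e := Rmin (d / 2) (Rmin ((s - r1) / 2) ((r2 - s) / 2))).
  assert (Hep : 0 < e) by (unfold e; repeat apply Rmin_pos; lra).
  assert (E1 : e <= d / 2) by apply Rmin_l.
  assert (E2 : e <= (s - r1) / 2) by (eapply Rle_trans; [apply Rmin_r | apply Rmin_l]).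
  assert (E3 : e <= (r2 - s) / 2) by (eapply Rle_trans; [apply Rmin_r | apply Rmin_r]).
  assert (A1 : circ phi r1 = circ phi (s - e)).
  { apply circ_invariant; try lra. intros z Hz. apply Hh; lra. }
  assert (A2 : circ phi (s + e) = circ phi r2).
  { apply circ_invariant; try lra. intros z Hz. apply Hh; lra. }
  assert (B1 := H (s - e)). assert (B2 := H (s + e)).
  rewrite A1, <- A2.
  replace (circ phi (s + e) - circ phi (s - e))%C with
    ((circ phi (s + e) - circ phi s) - (circ phi (s - e) - circ phi s))%C by ring.
  eapply Rle_trans; [apply Cmod_triangle'|].
  assert (Rabs (s - e - s) < d) by (apply Rabs_def1; lra).
  assert (Rabs (s + e - s) < d) by (apply Rabs_def1; lra).
  assert (C1 := B1 ltac:(lra) ltac:(assumption) ltac:(intros; apply Hc; lra)).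
  assert (C2 := B2 ltac:(lra) ltac:(assumption) ltac:(intros; apply Hc; lra)). lra.
Qed.

Lemma Cmod_neq_sub (z b : C) : Cmod z <> Cmod b -> (z - b)%C <> 0%C.
Proof. intros H E. apply H. apply Csub_0_eq in E. rewrite E. reflexivity. Qed.

Lemma holo_kernel (c z b : C) : (z - b)%C <> 0%C -> holo_at (fun u => c / (u - b))%C z.
Proof.
  intros Hn. eexists. apply (cder_div (fun _ => c) (fun u => u - b)%C); [apply cder_const | | exact Hn].
  apply cder_minus; [apply cder_id | apply cder_const].
Qed.

Lemma holo_mult (f g : C -> C) (z : C) : holo_at f z -> holo_at g z -> holo_at (fun u => f u * g u)%C z.
Proof. intros [a Ha] [b Hb]. eexists. apply cder_mult; eassumption. Qed.

Lemma holo_plus (f g : C -> C) (z : C) : holo_at f z -> holo_at g z -> holo_at (fun u => f u + g u)%C z.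
Proof. intros [a Ha] [b Hb]. eexists. apply cder_plus; eassumption. Qed.

Lemma holo_minus (f g : C -> C) (z : C) : holo_at f z -> holo_at g z -> holo_at (fun u => f u - g u)%C z.
Proof. intros [a Ha] [b Hb]. eexists. apply cder_minus; eassumption. Qed.

Lemma holo_div (f g : C -> C) (z : C) : holo_at f z -> holo_at g z -> g z <> 0%C -> holo_at (fun u => f u / g u)%C z.
Proof. intros [a Ha] [b Hb] H. eexists. apply cder_div; eassumption. Qed.

Lemma holo_id (z : C) : holo_at (fun u => u) z.
Proof. eexists. apply cder_id. Qed.

Lemma holo_const (c z : C) : holo_at (fun _ => c) z.
Proof. eexists. apply cder_const. Qed.

Lemma holo_pow (f : C -> C) (z : C) (n : nat) : holo_at f z -> holo_at (fun u => f u ^ n)%C z.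
Proof. intros [d H]. apply (cder_pow f z d n H). Qed.

Ltac holo_tac :=
  lazymatch goal with
  | |- holo_at (fun u => (_ + _)%C) _ => apply holo_plus; holo_tac
  | |- holo_at (fun u => (_ - _)%C) _ => apply holo_minus; holo_tac
  | |- holo_at (fun u => (_ / _)%C) _ => first [apply holo_const | apply holo_div; [holo_tac | holo_tac |]]
  | |- holo_at (fun u => (_ * _)%C) _ => apply holo_mult; holo_tac
  | |- holo_at _ _ => first [assumption | apply holo_id | apply holo_const | idtac]
  end.

(** The integral does not change when the circle shrinks to 0, where the factor [z] makes it small.
    This lemma and the next play the part of the residue theorem. *)
Lemma circ_kernel_out (b : C) (r : R) : 0 < r -> r < Cmod b -> circ (fun z => z / (z - b))%C r = 0%C.
Proof.
  intros Hr Hb. apply Cmod_le_eps_0. intros eps He. pose proof PI_RGT_0.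
  assert (Hh : forall z, Cmod z < Cmod b -> holo_at (fun z => z / (z - b))%C z).
  { intros z Hz. holo_tac. apply Cmod_neq_sub. lra. }
  set (t := Rmin r (Rmin (Cmod b / 2) (eps * Cmod b / (2 * (2 * PI))))).
  assert (Ht : 0 < t).
  { unfold t. repeat apply Rmin_pos; try lra. apply Rdiv_lt_0_compat; nra. }
  assert (T1 : t <= r) by apply Rmin_l.
  assert (T2 : t <= Cmod b / 2) by (eapply Rle_trans; [apply Rmin_r | apply Rmin_l]).
  assert (T3 : t <= eps * Cmod b / (2 * (2 * PI))) by (eapply Rle_trans; [apply Rmin_r | apply Rmin_r]).
  rewrite <- (circ_invariant _ t r) by (try lra; intros z Hz; apply Hh; lra).
  eapply Rle_trans.
  - apply (circ_bound _ t (eps / (2 * PI))); [lra | intros z Hz; apply holo_continuous, Hh; lra |].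
    intros z Hz. rewrite Cmod_div by (apply Cmod_neq_sub; lra). rewrite Hz.
    pose proof (Cmod_rev_triangle b z) as L. rewrite (Cmod_sub_sym b z) in L.
    apply Rmult_le_reg_r with (Cmod (z - b)); [lra|].
    replace (t / Cmod (z - b) * Cmod (z - b)) with t by (field; lra).
    apply Rle_trans with (eps / (2 * PI) * (Cmod b / 2)).
    + eapply Rle_trans; [apply T3|]. apply Req_le. field. lra.
    + apply Rmult_le_compat_l; [|lra]. left. apply Rdiv_lt_0_compat; lra.
  - apply Req_le. field. lra.
Qed.

(** Write [z / (z - b) = 1 + b / (z - b)]. The integral of the second term is the same on all larger
    circles and tends to 0 on them. *)
Lemma circ_kernel_in (b : C) (r : R) : Cmod b < r -> circ (fun z => z / (z - b))%C r = RtoC (2 * PI).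
Proof.
  intros Hb. pose proof (Cmod_ge_0 b) as Hb0. pose proof PI_RGT_0.
  assert (Hh : forall z, Cmod b < Cmod z -> holo_at (fun z => b / (z - b))%C z).
  { intros z Hz. apply holo_kernel. apply Cmod_neq_sub. lra. }
  rewrite (circ_ext _ (fun z => 1 + b / (z - b))%C) by
    (try lra; intros z Hz; field; apply Cmod_neq_sub; lra).
  rewrite circ_plus by (try lra; try (intros; apply continuous_const); intros z Hz; apply holo_continuous, Hh; lra).
  rewrite circ_cst.
  assert (E : circ (fun z => b / (z - b))%C r = 0%C).
  { apply Cmod_le_eps_0. intros eps He.
    set (t := r + (Cmod b + 1) * (2 * PI) / eps + Cmod b).
    assert (Ht : 0 < (Cmod b + 1) * (2 * PI) / eps) by (apply Rdiv_lt_0_compat; nra).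
    rewrite (circ_invariant _ r t) by (unfold t; try lra; intros z Hz; apply Hh; lra).
    eapply Rle_trans.
    - apply (circ_bound _ t (eps / (2 * PI))); [unfold t; lra | intros z Hz; apply holo_continuous, Hh; unfold t in Hz; lra |].
      intros z Hz. rewrite Cmod_div by (apply Cmod_neq_sub; unfold t in Hz; lra).
      pose proof (Cmod_rev_triangle z b) as L. rewrite Hz in L. unfold t in L.
      apply Rmult_le_reg_r with (Cmod (z - b)); [lra|].
      replace (Cmod b / Cmod (z - b) * Cmod (z - b)) with (Cmod b) by (field; lra).
      apply Rle_trans with (eps / (2 * PI) * ((Cmod b + 1) * (2 * PI) / eps)).
      + apply Rle_trans with (Cmod b + 1); [lra|]. apply Req_le. field. lra.
      + apply Rmult_le_compat_l; [|lra]. left. apply Rdiv_lt_0_compat; lra.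
    - apply Req_le. field. lra. }
  rewrite E. ring.
Qed.

(** With [d] the derivative at [a], this fills the removable singularity of the difference
    quotient. *)
Definition dquot (f : C -> C) (a d z : C) : C := if Ceq_dec z a then d else ((f z - f a) / (z - a))%C.

Lemma dquot_neq (f : C -> C) (a d z : C) : z <> a -> dquot f a d z = ((f z - f a) / (z - a))%C.
Proof. intros H. unfold dquot. destruct (Ceq_dec z a); [contradiction | reflexivity]. Qed.

Lemma dquot_holo (f : C -> C) (a d z : C) : z <> a -> holo_at f z -> holo_at (dquot f a d) z.
Proof.
  intros Hz Hf. assert (Hza : (z - a)%C <> 0%C) by (intros E; apply Hz, Csub_0_eq, E).
  assert (H : holo_at (fun z => (f z - f a) / (z - a))%C z) by (holo_tac; exact Hza).
  destruct H as [e He]. exists e.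
  apply (cder_ext_loc (fun z => (f z - f a) / (z - a))%C _ z e (Cmod (z - a))); [apply Cmod_gt_0, Hza | | exact He].
  intros h Hh. rewrite dquot_neq; [reflexivity|]. intros E.
  replace (z - a)%C with (- h)%C in Hh by (rewrite <- E; ring). rewrite Cmod_opp in Hh. lra.
Qed.

Lemma dquot_continuous (f : C -> C) (a d : C) : cder f a d -> continuous (dquot f a d) a.
Proof.
  intros H. apply continuous_C_intro. intros eps He. destruct (H (eps / 2)) as [e [Hep Hd]]; [lra|].
  exists e. split; [exact Hep|]. intros h Hlt. unfold dquot.
  destruct (Ceq_dec a a) as [_|]; [|contradiction].
  destruct (Ceq_dec (a + h) a) as [E|N].
  { replace (d - d)%C with (RtoC 0) by ring. rewrite Cmod_0. exact He. }
  assert (Hh0 : h <> 0%C) by (intros ->; apply N; ring).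
  pose proof (proj1 (Cmod_gt_0 h) Hh0). specialize (Hd h Hlt).
  replace ((f (a + h) - f a) / (a + h - a) - d)%C with ((f (a + h) - f a - d * h) / h)%C.
  2:{ replace (a + h - a)%C with h by ring. field. exact Hh0. }
  rewrite Cmod_div by exact Hh0.
  apply Rmult_lt_reg_r with (Cmod h); [lra|]. unfold Rdiv. rewrite Rmult_assoc, Rinv_l by lra. nra.
Qed.

(** The function [z * dquot psi b d z] has equal integrals on the two circles. Splitting off [psi b]
    leaves the kernel [z / (z - b)], whose integral is [2 PI] on the outer circle and 0 on the inner
    one. *)
Theorem cauchy_annulus (psi : C -> C) (b : C) (r0 r2 : R) : 0 < r0 -> r0 < Cmod b -> Cmod b < r2 ->
  (forall z, r0 <= Cmod z <= r2 -> holo_at psi z) ->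
  (circ (fun z => z * psi z / (z - b)) r2 - circ (fun z => z * psi z / (z - b)) r0
    = RtoC (2 * PI) * psi b)%C.
Proof.
  intros H0 H1 H2 Hh.
  destruct (Hh b ltac:(lra)) as [d Hd].
  set (phi := fun z : C => (z * dquot psi b d z)%C).
  assert (Hne : forall z, z <> b -> r0 <= Cmod z <= r2 -> holo_at phi z).
  { intros z Hz Hr. apply (holo_mult (fun z => z)); [apply holo_id | apply dquot_holo; [exact Hz | apply Hh, Hr]]. }
  assert (Hcb : continuous phi b) by (apply continuous_Cmult; [apply continuous_id | apply dquot_continuous, Hd]).
  assert (Hcont : forall z, r0 <= Cmod z <= r2 -> continuous phi z).
  { intros z Hz. destruct (Ceq_dec z b) as [->|Hn]; [exact Hcb | apply holo_continuous, Hne; assumption]. }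
  assert (E : circ phi r0 = circ phi r2).
  { apply (circ_invariant_except phi r0 (Cmod b) r2); try lra; [exact Hcont|].
    intros z Hz Hn. apply Hne; [|exact Hz]. intros ->. apply Hn; reflexivity. }
  assert (Er : forall r, r0 <= r <= r2 -> r <> Cmod b ->
    circ phi r = (circ (fun z => z * psi z / (z - b)) r - psi b * circ (fun z => z / (z - b)) r)%C).
  { intros r Hr Hn. rewrite <- circ_scal, <- circ_minus.
    - apply circ_ext; [lra|]. intros z Hz. unfold phi.
      rewrite dquot_neq by (intros ->; lra). field. apply Cmod_neq_sub. lra.
    - lra.
    - intros z Hz. apply holo_continuous, holo_div; [apply holo_mult; [apply holo_id | apply Hh; lra] |
        apply holo_minus; [apply holo_id | apply holo_const] | apply Cmod_neq_sub; lra].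
    - intros z Hz. apply holo_continuous, holo_mult; [apply holo_const | apply holo_div;
        [apply holo_id | apply holo_minus; [apply holo_id | apply holo_const] | apply Cmod_neq_sub; lra]].
    - lra.
    - intros z Hz. apply holo_continuous, holo_div;
        [apply holo_id | apply holo_minus; [apply holo_id | apply holo_const] | apply Cmod_neq_sub; lra]. }
  rewrite (Er r0), (Er r2), (circ_kernel_in b r2), (circ_kernel_out b r0) in E by lra.
  apply Csub_0_eq.
  set (X := circ _ r2) in *. set (Y := circ _ r0) in *.
  replace (X - Y - RtoC (2 * PI) * psi b)%C with ((X - psi b * RtoC (2 * PI)) - (Y - psi b * 0))%C by ring.
  rewrite E. ring.
Qed.

(* The centre may be a removable singularity. *)
Theorem cauchy_disc (f : C -> C) (b : C) (r : R) : Cmod b < r -> continuous f (RtoC 0) ->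
  (forall z, 0 < Cmod z <= r -> holo_at f z) ->
  circ (fun z => z * f z / (z - b))%C r = (RtoC (2 * PI) * f b)%C.
Proof.
  intros Hb Hc Hh. pose proof PI_RGT_0. pose proof (Cmod_ge_0 b) as Hb0.
  destruct (Ceq_dec b 0) as [-> | Hbn].
  (* At the centre the integrand is [f] itself, and the circle is shrunk to 0. *)
  - rewrite Cmod_0 in Hb.
    rewrite (circ_ext _ f).
    2: lra.
    2:{ intros z Hz. field. intros E. replace (z - 0)%C with z in E by ring.
        rewrite E, Cmod_0 in Hz. lra. }
    apply Csub_0_eq, Cmod_le_eps_0. intros eps He.
    destruct (continuous_C_elim f (RtoC 0) Hc (eps / (2 * PI))) as [d [Hd H1]]; [apply Rdiv_lt_0_compat; lra|].
    set (t := Rmin r (d / 2)). assert (Ht : 0 < t) by (apply Rmin_pos; lra).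
    assert (T1 : t <= r) by apply Rmin_l. assert (T2 : t <= d / 2) by apply Rmin_r.
    rewrite <- (circ_invariant f t r) by (try lra; intros; apply Hh; lra).
    rewrite <- (circ_cst (f (RtoC 0)) t), <- circ_minus;
      [ | lra | intros; apply holo_continuous, Hh; lra | intros; apply continuous_const].
    eapply Rle_trans.
    + apply (circ_bound _ t (eps / (2 * PI))); [lra | |].
      * intros z Hz. apply continuous_Cminus; [apply holo_continuous, Hh; lra | apply continuous_const].
      * intros z Hz. specialize (H1 z ltac:(lra)). rewrite Cplus_0_l in H1. lra.
    + apply Req_le. field. lra.
  (* Away from the centre the annulus formula applies; the inner integral vanishes in the limit
     because [f] is bounded near 0. *)
  - pose proof (proj1 (Cmod_gt_0 b) Hbn) as Hbp.
    apply Csub_0_eq, Cmod_le_eps_0. intros eps He.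
    destruct (continuous_C_elim f (RtoC 0) Hc 1) as [d [Hd H1]]; [lra|].
    set (K := Cmod (f (RtoC 0)) + 1). assert (HK : 0 < K) by (unfold K; pose proof (Cmod_ge_0 (f (RtoC 0))); lra).
    set (t := Rmin (d / 2) (Rmin (Cmod b / 2) (eps * Cmod b / (2 * (2 * PI) * K)))).
    assert (Ht : 0 < t).
    { unfold t. repeat apply Rmin_pos; try lra. apply Rdiv_lt_0_compat; [nra|].
      apply Rmult_lt_0_compat; lra. }
    assert (T1 : t <= d / 2) by apply Rmin_l.
    assert (T2 : t <= Cmod b / 2) by (eapply Rle_trans; [apply Rmin_r | apply Rmin_l]).
    assert (T3 : t <= eps * Cmod b / (2 * (2 * PI) * K)) by (eapply Rle_trans; [apply Rmin_r | apply Rmin_r]).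
    rewrite <- (cauchy_annulus f b t r) by (try lra; intros; apply Hh; lra).
    set (X := circ _ r). set (Y := circ _ t). replace (X - (X - Y))%C with Y by ring. unfold Y.
    eapply Rle_trans.
    + apply (circ_bound _ t (eps / (2 * PI))); [lra | |].
      * intros z Hz. apply holo_continuous, holo_div; [apply holo_mult; [apply holo_id | apply Hh; lra] |
          apply holo_minus; [apply holo_id | apply holo_const] | apply Cmod_neq_sub; lra].
      * intros z Hz. rewrite Cmod_div by (apply Cmod_neq_sub; lra). rewrite Cmod_mult, Hz.
        assert (Hf : Cmod (f z) <= K).
        { specialize (H1 z ltac:(lra)). rewrite Cplus_0_l in H1.
          replace (f z) with (f z - f 0 + f 0)%C by ring. eapply Rle_trans; [apply Cmod_triangle|]. unfold K. lra. }
        pose proof (Cmod_rev_triangle b z) as L. rewrite (Cmod_sub_sym b z) in L.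
        apply Rmult_le_reg_r with (Cmod (z - b)); [lra|].
        unfold Rdiv. rewrite Rmult_assoc, Rinv_l, Rmult_1_r by lra.
        apply Rle_trans with (t * K); [apply Rmult_le_compat_l; lra|].
        apply Rle_trans with (eps * / (2 * PI) * (Cmod b / 2)).
        -- apply Rmult_le_compat_r with (r := K) in T3; [|lra]. eapply Rle_trans; [apply T3|].
           apply Req_le. field. lra.
        -- apply Rmult_le_compat_l; [|lra]. left. apply Rdiv_lt_0_compat; lra.
    + apply Req_le. field. lra.
Qed.

(** * Entire functions *)

Lemma circle_max (phi : C -> C) (c : C) (r : R) : 0 <= r -> (forall z, Cmod (z - c) = r -> continuous phi z) ->
  exists z0, Cmod (z0 - c) = r /\ forall z, Cmod (z - c) = r -> Cmod (phi z) <= Cmod (phi z0).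
Proof.
  intros Hr Hc.
  assert (Hm : forall t, Cmod (c + RtoC r * cis t - c) = r).
  { intros t. replace (c + RtoC r * cis t - c)%C with (RtoC r * cis t)%C by ring. apply Cmod_Rcis, Hr. }
  destruct (continuity_ab_maj (fun t => Cmod (phi (c + RtoC r * cis t)%C)) 0 (2 * PI)) as [t0 [Ht Ht0]].
  - apply two_PI_ge_0.
  - intros t _. apply continuity_pt_filterlim.
    apply (continuous_Cmod (fun t => phi (c + RtoC r * cis t)%C)).
    apply (continuous_comp (fun t => (c + RtoC r * cis t)%C) phi).
    + apply continuous_Cplus; [apply continuous_const|].
      apply continuous_Cmult; [apply continuous_const | apply continuous_cis, continuous_id].
    + apply Hc, Hm.
  - exists (c + RtoC r * cis t0)%C. split; [apply Hm|]. intros z Hz.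
    destruct (polar (z - c)) as [t [Ht1 Ht2]]. rewrite Hz in Ht2.
    replace z with (c + RtoC r * cis t)%C by (rewrite <- Ht2; ring). apply Ht, Ht1.
Qed.

Lemma Cmod_minus_lower (z u h : C) (r : R) : Cmod z = r -> Cmod u < r -> Cmod h <= (r - Cmod u) / 2 ->
  (r - Cmod u) / 2 <= Cmod (z - u - h).
Proof.
  intros Hz Hu Hh. pose proof (Cmod_rev_triangle z u). pose proof (Cmod_rev_triangle (z - u) h). lra.
Qed.

Lemma Cmod_pos_neq_0 (z : C) : 0 < Cmod z -> z <> 0%C.
Proof. intros H. apply Cmod_gt_0, H. Qed.

Lemma cder_quadratic (F : C -> C) (u d : C) (K e : R) : 0 < e -> 0 <= K ->
  (forall h, Cmod h <= e -> Cmod (F (u + h) - F u - d * h)%C <= K * (Cmod h * Cmod h)) -> cder F u d.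
Proof.
  intros He HK H eps Hep. exists (Rmin e (eps / (K + 1))). split.
  { apply Rmin_pos; [exact He | apply Rdiv_lt_0_compat; lra]. }
  intros h Hh. pose proof (Rmin_l e (eps / (K + 1))). pose proof (Rmin_r e (eps / (K + 1))).
  eapply Rle_trans; [apply H; lra|]. pose proof (Cmod_ge_0 h).
  assert (L : Cmod h < eps / (K + 1)) by lra.
  apply Rmult_lt_compat_r with (r := K + 1) in L; [|lra].
  replace (eps / (K + 1) * (K + 1)) with eps in L by (field; lra). nra.
Qed.

Lemma cont_kernel (w : C -> C) (u : C) (r : R) (n : nat) : Cmod u < r ->
  (forall z, Cmod z = r -> continuous w z) ->
  forall z, Cmod z = r -> continuous (fun z => w z / (z - u) ^ n)%C z.
Proof.
  intros Hu Hw z Hz. apply continuous_Cdiv; [apply Hw, Hz | |].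
  - apply holo_continuous, holo_pow, holo_minus; [apply holo_id | apply holo_const].
  - apply Cpow_nz, Cmod_neq_sub. lra.
Qed.

Lemma circ_bounded (w : C -> C) (r : R) : 0 <= r -> (forall z, Cmod z = r -> continuous w z) ->
  exists W, 0 <= W /\ forall z, Cmod z = r -> Cmod (w z) <= W.
Proof.
  intros Hr Hw. destruct (circle_max w 0%C r Hr) as [z0 [_ H]].
  - intros z Hz. apply Hw. rewrite <- Hz. f_equal. ring.
  - exists (Cmod (w z0)). split; [apply Cmod_ge_0|]. intros z Hz. apply H. rewrite <- Hz. f_equal. ring.
Qed.

(** Differentiation under the integral sign, by means of a quadratic remainder that is uniform on
    the circle. *)
Lemma cder_circ (F : C -> C -> C) (D : C -> C) (u : C) (r e K : R) : 0 <= r -> 0 < e -> 0 <= K ->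
  (forall h z, Cmod h <= e -> Cmod z = r -> continuous (F (u + h)%C) z) ->
  (forall z, Cmod z = r -> continuous D z) ->
  (forall h z, Cmod h <= e -> Cmod z = r -> Cmod (F (u + h) z - F u z - h * D z)%C <= K * (Cmod h * Cmod h)) ->
  cder (fun u => circ (F u) r) u (circ D r).
Proof.
  intros Hr He HK HF HD H. pose proof PI_RGT_0.
  apply (cder_quadratic _ _ _ (2 * PI * K) e); [exact He | apply Rmult_le_pos; lra |].
  intros h Hh.
  assert (HFu : forall z, Cmod z = r -> continuous (F u) z).
  { intros z Hz. rewrite <- (Cplus_0_r u). apply HF; [rewrite Cmod_0; lra | exact Hz]. }
  assert (HFd : forall z, Cmod z = r -> continuous (fun z => F (u + h) z - F u z)%C z).
  { intros z Hz. apply continuous_Cminus; [apply HF; assumption | apply HFu, Hz]. }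
  assert (HhD : forall z, Cmod z = r -> continuous (fun z => h * D z)%C z).
  { intros z Hz. apply continuous_Cmult; [apply continuous_const | apply HD, Hz]. }
  replace (circ (F (u + h)%C) r - circ (F u) r - circ D r * h)%C with
    (circ (fun z => F (u + h) z - F u z - h * D z)%C r).
  2:{ rewrite (circ_minus (fun z => F (u + h) z - F u z)%C (fun z => h * D z)%C), (circ_minus (F (u + h)%C) (F u)),
        circ_scal; try assumption; [ring|]. intros z Hz. apply HF; assumption. }
  rewrite Rmult_assoc. apply circ_bound; [exact Hr | |].
  - intros z Hz. apply continuous_Cminus; [apply HFd, Hz | apply HhD, Hz].
  - intros z Hz. apply H; assumption.
Qed.

(** With [x = z - u] the remainder is exact: [1/(x - h) - 1/x - h/x^2 = h^2 / (x^2 (x - h))], and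
    the moduli of [x] and [x - h] are at least [d/2]. Orders 1 and 2 suffice in the sequel: the
    first represents [f'] by an integral, the second differentiates that integral. *)
Lemma cder_kernel1 (w : C -> C) (u : C) (r : R) : Cmod u < r -> (forall z, Cmod z = r -> continuous w z) ->
  cder (fun u => circ (fun z => w z / (z - u) ^ 1)%C r) u (circ (fun z => w z / (z - u) ^ 2)%C r).
Proof.
  intros Hu Hw. pose proof (Cmod_ge_0 u). pose proof PI_RGT_0.
  destruct (circ_bounded w r ltac:(lra) Hw) as [W [HW0 HW]].
  set (d := r - Cmod u). assert (Hd : 0 < d) by (unfold d; lra).
  assert (L : forall h z, Cmod h <= d / 2 -> Cmod z = r -> d / 2 <= Cmod (z - u) /\ d / 2 <= Cmod (z - u - h)).
  { intros h z Hh Hz. split; [pose proof (Cmod_rev_triangle z u); unfold d; lra | apply Cmod_minus_lower; assumption]. }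
  apply (cder_circ (fun u z => w z / (z - u) ^ 1)%C (fun z => w z / (z - u) ^ 2)%C u r (d / 2) (W / ((d / 2) ^ 2 * (d / 2)))).
  1, 2: lra.
  { apply Rdiv_le_0_compat; [exact HW0|]. apply Rmult_lt_0_compat; [apply pow_lt; lra | lra]. }
  { intros h z Hh. apply (cont_kernel w (u + h) r 1); [pose proof (Cmod_triangle u h); unfold d in *; lra | exact Hw]. }
  { apply (cont_kernel w u r 2); assumption. }
  intros h z Hh Hz. destruct (L h z Hh Hz) as [L1 L2].
  replace (W / ((d / 2) ^ 2 * (d / 2)) * (Cmod h * Cmod h)) with
    (W * (Cmod h * Cmod h) / ((d / 2) ^ 2 * (d / 2))) by (field; lra).
  assert (N1 : (z - u)%C <> 0%C) by (apply Cmod_pos_neq_0; lra).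
  assert (N2 : (z - u - h)%C <> 0%C) by (apply Cmod_pos_neq_0; lra).
  replace (w z / (z - (u + h)) ^ 1 - w z / (z - u) ^ 1 - h * (w z / (z - u) ^ 2))%C with
    (w z * (h * h) / ((z - u) ^ 2 * (z - u - h)))%C.
  2:{ replace (z - (u + h))%C with (z - u - h)%C by ring. field. split; assumption. }
  rewrite Cmod_div by (apply Cmult_neq_0; [apply Cpow_nz, N1 | exact N2]).
  rewrite !Cmod_mult, Cmod_pow.
  assert (P1 : (d / 2) ^ 2 <= Cmod (z - u) ^ 2) by (apply pow_incr; lra).
  assert (P0 : 0 < (d / 2) ^ 2) by (apply pow_lt; lra).
  unfold Rdiv. apply Rmult_le_compat.
  - apply Rmult_le_pos; [apply Cmod_ge_0|]. pose proof (Cmod_ge_0 h); nra.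
  - left. apply Rinv_0_lt_compat. apply Rmult_lt_0_compat; lra.
  - apply Rmult_le_compat_r; [pose proof (Cmod_ge_0 h); nra | apply HW, Hz].
  - apply Rinv_le_contravar; [apply Rmult_lt_0_compat; lra|]. apply Rmult_le_compat; lra.
Qed.

Lemma cder_kernel2 (w : C -> C) (u : C) (r : R) : Cmod u < r -> (forall z, Cmod z = r -> continuous w z) ->
  cder (fun u => circ (fun z => w z / (z - u) ^ 2)%C r) u (circ (fun z => 2 * (w z / (z - u) ^ 3))%C r).
Proof.
  intros Hu Hw. pose proof (Cmod_ge_0 u). pose proof PI_RGT_0.
  destruct (circ_bounded w r ltac:(lra) Hw) as [W [HW0 HW]].
  set (d := r - Cmod u). assert (Hd : 0 < d) by (unfold d; lra).
  set (B := 3 * (r + r) + d).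
  assert (L : forall h z, Cmod h <= d / 2 -> Cmod z = r -> d / 2 <= Cmod (z - u) /\ d / 2 <= Cmod (z - u - h)).
  { intros h z Hh Hz. split; [pose proof (Cmod_rev_triangle z u); unfold d; lra | apply Cmod_minus_lower; assumption]. }
  apply (cder_circ (fun u z => w z / (z - u) ^ 2)%C (fun z => 2 * (w z / (z - u) ^ 3))%C u r (d / 2)
    (W * B / ((d / 2) ^ 3 * (d / 2) ^ 2))).
  1, 2: lra.
  { apply Rdiv_le_0_compat; [unfold B; apply Rmult_le_pos; lra|]. apply Rmult_lt_0_compat; apply pow_lt; lra. }
  { intros h z Hh. apply (cont_kernel w (u + h) r 2); [pose proof (Cmod_triangle u h); unfold d in *; lra | exact Hw]. }
  { intros z Hz. apply continuous_Cmult; [apply continuous_const | apply (cont_kernel w u r 3); assumption]. }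
  intros h z Hh Hz. destruct (L h z Hh Hz) as [L1 L2].
  replace (W * B / ((d / 2) ^ 3 * (d / 2) ^ 2) * (Cmod h * Cmod h)) with
    (W * B * (Cmod h * Cmod h) / ((d / 2) ^ 3 * (d / 2) ^ 2)) by (field; lra).
  assert (N1 : (z - u)%C <> 0%C) by (apply Cmod_pos_neq_0; lra).
  assert (N2 : (z - u - h)%C <> 0%C) by (apply Cmod_pos_neq_0; lra).
  replace (w z / (z - (u + h)) ^ 2 - w z / (z - u) ^ 2 - h * (2 * (w z / (z - u) ^ 3)))%C with
    (w z * (3 * (z - u) - 2 * h) * (h * h) / ((z - u) ^ 3 * (z - u - h) ^ 2))%C.
  2:{ replace (z - (u + h))%C with (z - u - h)%C by ring. field. split; assumption. }
  rewrite Cmod_div by (apply Cmult_neq_0; apply Cpow_nz; assumption).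
  rewrite !Cmod_mult, !Cmod_pow.
  assert (HB : Cmod (3 * (z - u) - 2 * h) <= B).
  { eapply Rle_trans; [apply Cmod_triangle'|]. rewrite !Cmod_mult, !Cmod_R, !Rabs_pos_eq by lra.
    pose proof (Cmod_triangle' z u). unfold B. unfold d in *. lra. }
  assert (P1 : (d / 2) ^ 3 <= Cmod (z - u) ^ 3) by (apply pow_incr; lra).
  assert (P2 : (d / 2) ^ 2 <= Cmod (z - u - h) ^ 2) by (apply pow_incr; lra).
  assert (P0 : 0 < (d / 2) ^ 2) by (apply pow_lt; lra).
  assert (P3 : 0 < (d / 2) ^ 3) by (apply pow_lt; lra).
  pose proof (Cmod_ge_0 h). pose proof (Cmod_ge_0 (w z)). pose proof (Cmod_ge_0 (3 * (z - u) - 2 * h)%C).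
  unfold Rdiv. apply Rmult_le_compat.
  - repeat apply Rmult_le_pos; try assumption.
  - left. apply Rinv_0_lt_compat. apply Rmult_lt_0_compat; lra.
  - apply Rmult_le_compat_r; [nra|]. apply Rmult_le_compat; try assumption. apply HW, Hz.
  - apply Rinv_le_contravar; [apply Rmult_lt_0_compat; lra|]. apply Rmult_le_compat; lra.
Qed.

Lemma RtoC_2PI_neq_0 : RtoC (2 * PI) <> 0%C.
Proof. intros E. apply RtoC_inj in E. pose proof PI_RGT_0. lra. Qed.

Lemma cauchy_disc_kernel (f : C -> C) (r : R) : 0 < r -> continuous f (RtoC 0) ->
  (forall z, 0 < Cmod z <= r -> holo_at f z) ->
  forall u, Cmod u < r ->
    f u = (/ RtoC (2 * PI) * circ (fun z => (z * f z) / (z - u) ^ 1)%C r)%C.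
Proof.
  intros Hr Hc Hh u Hu. pose proof RtoC_2PI_neq_0.
  rewrite (circ_ext _ (fun z => z * f z / (z - u))%C).
  - rewrite cauchy_disc by assumption. field. assumption.
  - lra.
  - intros z Hz. rewrite Cpow_1_r. reflexivity.
Qed.

Lemma cont_zf (f : C -> C) (r : R) : 0 < r -> (forall z, 0 < Cmod z <= r -> holo_at f z) ->
  forall z, Cmod z = r -> continuous (fun z => z * f z)%C z.
Proof.
  intros Hr Hh z Hz. apply continuous_Cmult; [apply continuous_id | apply holo_continuous, Hh; lra].
Qed.

(** Only continuity is asked at 0, so the same formula also removes isolated singularities. *)
Lemma cauchy_derivative (f : C -> C) (r : R) : 0 < r -> continuous f (RtoC 0) ->
  (forall z, 0 < Cmod z <= r -> holo_at f z) ->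
  forall u, Cmod u < r ->
    cder f u (/ RtoC (2 * PI) * circ (fun z => (z * f z) / (z - u) ^ 2)%C r)%C.
Proof.
  intros Hr Hc Hh u Hu.
  apply (cder_ext_loc (fun u => / RtoC (2 * PI) * circ (fun z => (z * f z) / (z - u) ^ 1)%C r)%C f u _ (r - Cmod u)).
  - lra.
  - intros h Hh'. symmetry. apply cauchy_disc_kernel; try assumption.
    pose proof (Cmod_triangle u h). lra.
  - apply cder_scal. apply (cder_kernel1 (fun z => z * f z)%C); [exact Hu | apply cont_zf; assumption].
Qed.

Definition entire (f f' : C -> C) : Prop := forall z, cder f z (f' z).

Lemma entire_holo (f f' : C -> C) (z : C) : entire f f' -> holo_at f z.
Proof. intros H. exists (f' z). apply H. Qed.

(** Near [b], [f'] coincides with the Cauchy integral of order 2, which [cder_kernel2]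
    differentiates. *)
Lemma entire_deriv (f f' : C -> C) : entire f f' -> exists f'', entire f' f''.
Proof.
  intros H.
  assert (Hh : forall z, holo_at f' z).
  { intros b. set (r := Cmod b + 1). pose proof (Cmod_ge_0 b).
    assert (Hr : 0 < r) by (unfold r; lra).
    assert (Hf : forall z, 0 < Cmod z <= r -> holo_at f z) by (intros; apply (entire_holo f f'), H).
    assert (Hc : continuous f (RtoC 0)) by (apply (cder_continuous f _ (f' 0%C)), H).
    eexists. apply (cder_ext_loc (fun u => / RtoC (2 * PI) * circ (fun z => (z * f z) / (z - u) ^ 2)%C r)%C f' b _ 1).
    - lra.
    - intros h Hh. apply (cder_unique f (b + h)%C); [|apply H].
      apply cauchy_derivative; try assumption. pose proof (Cmod_triangle b h). unfold r. lra.
    - apply cder_scal. apply (cder_kernel2 (fun z => z * f z)%C); [unfold r; lra | apply cont_zf; assumption]. }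
  exists (fun z => epsilon (inhabits (RtoC 0)) (fun d => cder f' z d)).
  intros z. apply epsilon_spec. apply Hh.
Qed.

Lemma entire_shift (f f' : C -> C) (a : C) : entire f f' -> entire (fun z => f (a + z)%C) (fun z => f' (a + z)%C).
Proof. intros H z. apply cder_shift, H. Qed.

Lemma entire_choice (f : C -> C) : (forall z, holo_at f z) -> exists f', entire f f'.
Proof.
  intros H. exists (fun z => epsilon (inhabits (RtoC 0)) (fun d => cder f z d)).
  intros z. apply epsilon_spec. apply H.
Qed.

(** The quotient is [dquot], differentiable off [a] and continuous at [a]; Cauchy's integral around
    [a] makes it differentiable there too. *)
Lemma entire_divide (f f' : C -> C) (a : C) : entire f f' -> f a = 0%C ->
  exists g g', entire g g' /\ forall z, f z = ((z - a) * g z)%C.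
Proof.
  intros H Ha.
  set (g := dquot f a (f' a)).
  assert (Hne : forall z, z <> a -> holo_at g z) by (intros z Hz; apply dquot_holo; [exact Hz | apply (entire_holo f f'), H]).
  assert (Hc : continuous g a) by apply dquot_continuous, H.
  assert (Hga : holo_at g a).
  { assert (D := cauchy_derivative (fun u => g (a + u)%C) 1 Rlt_0_1).
    assert (Hs : forall z, 0 < Cmod z <= 1 -> holo_at (fun u => g (a + u)%C) z).
    { intros z Hz. destruct (Hne (a + z)%C) as [e He].
      - intros E. assert (z = 0%C) by (replace z with (a + z - a)%C by ring; rewrite E; ring).
        subst z. rewrite Cmod_0 in Hz. lra.
      - exists e. apply cder_shift, He. }
    assert (Hcs : continuous (fun u => g (a + u)%C) (RtoC 0)).
    { apply (continuous_comp (fun u => (a + u)%C) g).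
      - apply continuous_Cplus; [apply continuous_const | apply continuous_id].
      - rewrite Cplus_0_r. exact Hc. }
    specialize (D Hcs Hs 0%C). rewrite Cmod_0 in D. specialize (D Rlt_0_1).
    eexists. apply (cder_ext (fun u => (fun v => g (a + v)%C) (- a + u)%C)).
    - intros u. simpl. f_equal. ring.
    - apply (cder_shift (fun v => g (a + v)%C)). replace (- a + a)%C with (RtoC 0) by ring. exact D. }
  destruct (entire_choice g) as [g' Hg].
  { intros z. destruct (Ceq_dec z a) as [->|N]; [exact Hga | apply Hne, N]. }
  exists g, g'. split; [exact Hg|]. intros z. unfold g.
  destruct (Ceq_dec z a) as [->|N]; [rewrite Ha; ring|].
  rewrite dquot_neq, Ha by exact N. field. intros E. apply N, Csub_0_eq, E.
Qed.

Lemma cauchy_bound (f : C -> C) (r K : R) (b : C) : Cmod b < r -> (forall z, holo_at f z) ->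
  (forall z, Cmod z = r -> Cmod (f z) <= K) -> Cmod (f b) <= K * (r / (r - Cmod b)).
Proof.
  intros Hb Hh HK. pose proof PI_RGT_0. pose proof (Cmod_ge_0 b).
  assert (E := cauchy_disc f b r Hb ltac:(apply holo_continuous, Hh) ltac:(intros; apply Hh)).
  assert (B : Cmod (circ (fun z => z * f z / (z - b))%C r) <= 2 * PI * (K * (r / (r - Cmod b)))).
  { apply circ_bound; [lra | |].
    - intros z Hz. apply holo_continuous, holo_div; [apply holo_mult; [apply holo_id | apply Hh] |
        holo_tac | apply Cmod_neq_sub; lra].
    - intros z Hz. rewrite Cmod_div by (apply Cmod_neq_sub; lra). rewrite Cmod_mult, Hz.
      pose proof (Cmod_rev_triangle z b) as L. rewrite Hz in L. specialize (HK z Hz).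
      pose proof (Cmod_ge_0 (f z)).
      replace (K * (r / (r - Cmod b))) with (r * K * / (r - Cmod b)) by (field; lra).
      unfold Rdiv. apply Rmult_le_compat.
      + apply Rmult_le_pos; lra.
      + left. apply Rinv_0_lt_compat. lra.
      + apply Rmult_le_compat_l; lra.
      + apply Rinv_le_contravar; lra. }
  rewrite E, Cmod_mult, Cmod_R, Rabs_pos_eq in B by lra.
  apply Rmult_le_reg_l with (2 * PI); lra.
Qed.

(* Applying the crude Cauchy bound to [f^n] and taking n-th roots removes the constant. *)
Lemma max_modulus_0 (f : C -> C) (r K : R) (b : C) : Cmod b <= r -> (forall z, holo_at f z) ->
  (forall z, Cmod z = r -> Cmod (f z) <= K) -> Cmod (f b) <= K.
Proof.
  intros Hb Hh HK. destruct (Rle_lt_or_eq_dec _ _ Hb) as [Hlt | Heq]; [|apply HK, Heq].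
  apply Rnot_lt_le. intros Hc.
  pose proof (Cmod_ge_0 b). set (q := r / (r - Cmod b)).
  assert (Hq : 1 <= q).
  { unfold q. apply Rmult_le_reg_r with (r - Cmod b); [lra|]. unfold Rdiv. rewrite Rmult_assoc, Rinv_l by lra. lra. }
  assert (HK0 : 0 <= K).
  { eapply Rle_trans; [apply (Cmod_ge_0 (f (RtoC r))) | apply HK]. rewrite Cmod_R. apply Rabs_pos_eq. lra. }
  destruct (Rle_lt_or_eq_dec _ _ HK0) as [HKp | HKz].
  - assert (Hpow : forall n, Cmod (f b) ^ n <= K ^ n * q).
    { intros n. rewrite <- Cmod_pow. apply (cauchy_bound (fun z => f z ^ n)%C); [exact Hlt | |].
      - intros z. apply holo_pow, Hh.
      - intros z Hz. rewrite Cmod_pow. apply pow_incr. split; [apply Cmod_ge_0 | apply HK, Hz]. }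
    set (x := Cmod (f b) / K - 1).
    assert (Hx : 0 < x).
    { unfold x. apply Rlt_0_minus. apply Rmult_lt_reg_r with K; [lra|].
      unfold Rdiv. rewrite Rmult_assoc, Rinv_l by lra. lra. }
    destruct (INR_unbounded (q / x)) as [n Hn].
    (* Bernoulli's inequality: [(1 + x)^n] exceeds the fixed bound [q] for large [n]. *)
    assert (B := poly n x Hx).
    assert (B2 : (1 + x) ^ n <= q).
    { replace (1 + x) with (Cmod (f b) / K) by (unfold x; ring).
      unfold Rdiv. rewrite Rpow_mult_distr, pow_inv.
      pose proof (pow_lt K n HKp). apply Rmult_le_reg_r with (K ^ n); [assumption|].
      rewrite Rmult_assoc, Rinv_l by lra. rewrite Rmult_1_r. rewrite (Rmult_comm q). apply Hpow. }
    apply Rmult_gt_compat_r with (r := x) in Hn; [|lra].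
    replace (q / x * x) with q in Hn by (field; lra). lra.
  - assert (B := cauchy_bound f r K b Hlt Hh HK). rewrite <- HKz in B. lra.
Qed.

Lemma max_modulus (f : C -> C) (c : C) (r K : R) (b : C) : Cmod (b - c) <= r -> (forall z, holo_at f z) ->
  (forall z, Cmod (z - c) = r -> Cmod (f z) <= K) -> Cmod (f b) <= K.
Proof.
  intros Hb Hh HK. replace b with (c + (b - c))%C by ring.
  apply (max_modulus_0 (fun u => f (c + u)%C) r); [exact Hb | |].
  - intros z. destruct (Hh (c + z)%C) as [d Hd]. exists d. apply cder_shift, Hd.
  - intros z Hz. apply HK. rewrite <- Hz. f_equal. ring.
Qed.

Lemma cauchy_estimate (f f' : C -> C) (b : C) (r K : R) : 0 < r -> entire f f' ->
  (forall z, Cmod (z - b) = r -> Cmod (f z) <= K) -> Cmod (f' b) <= K / r.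
Proof.
  intros Hr H HK. pose proof PI_RGT_0.
  set (g := fun u => f (b + u)%C).
  assert (Hg : entire g (fun u => f' (b + u)%C)) by (apply entire_shift, H).
  assert (D := cauchy_derivative g r Hr ltac:(apply holo_continuous, (entire_holo _ _ _ Hg))
    ltac:(intros; apply (entire_holo _ _ _ Hg)) 0%C).
  rewrite Cmod_0 in D. specialize (D Hr).
  assert (E := cder_unique _ _ _ _ D (Hg 0%C)). rewrite Cplus_0_r in E. rewrite <- E.
  rewrite Cmod_mult, Cmod_inv by apply RtoC_2PI_neq_0. rewrite Cmod_R, Rabs_pos_eq by lra.
  apply Rmult_le_reg_l with (2 * PI); [lra|]. rewrite <- Rmult_assoc, Rinv_r, Rmult_1_l by lra.
  apply circ_bound; [lra | |].
  - intros z Hz. apply (cont_kernel (fun z => z * g z)%C 0%C r 2); [rewrite Cmod_0; lra | | exact Hz].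
    intros u Hu. apply continuous_Cmult; [apply continuous_id | apply holo_continuous, (entire_holo _ _ _ Hg)].
  - intros z Hz. rewrite Cmod_div.
    2:{ apply Cpow_nz, Cmod_neq_sub. rewrite Cmod_0. lra. }
    rewrite Cmod_pow, Cmod_mult. replace (z - 0)%C with z by ring. rewrite Hz.
    specialize (HK (b + z)%C). replace (b + z - b)%C with z in HK by ring. specialize (HK Hz).
    fold (g z) in HK. replace (r * Cmod (g z) / r ^ 2) with (Cmod (g z) * / r) by (field; lra).
    apply Rmult_le_compat_r; [|exact HK]. left. apply Rinv_0_lt_compat, Hr.
Qed.

(** * Logarithmic derivative of a zero-free function *)

Lemma is_derive_ln_norm (u v : R -> R) (t du dv : R) : is_derive u t du -> is_derive v t dv ->
  0 < u t * u t + v t * v t ->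
  is_derive (fun s => ln (sqrt (u s * u s + v s * v s))) t ((du * u t + dv * v t) / (u t * u t + v t * v t)).
Proof.
  intros Hu Hv Hp. evar_last.
  - auto_derive; [|reflexivity].
    repeat split; try exact Hp; try (apply sqrt_lt_R0, Hp); try (exists du; exact Hu); exists dv; exact Hv.
  - replace (Derive (fun x : R => u x) t) with du by (symmetry; apply is_derive_unique; exact Hu).
    replace (Derive (fun x : R => v x) t) with dv by (symmetry; apply is_derive_unique; exact Hv).
    pose proof (sqrt_lt_R0 _ Hp) as Hs. pose proof (sqrt_sqrt (u t * u t + v t * v t) (Rlt_le _ _ Hp)) as Hss.
    set (q := sqrt (u t * u t + v t * v t)) in *. rewrite <- Hss. field. lra.
Qed.

Lemma is_derive_ln_Cmod (f : C -> C) (a b d : C) (t : R) : cder f (a + RtoC t * b)%C d ->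
  f (a + RtoC t * b)%C <> 0%C ->
  is_derive (fun s : R => ln (Cmod (f (a + RtoC s * b)%C))) t (Re (d * b / f (a + RtoC t * b)))%C.
Proof.
  intros H Hn. destruct (cder_line f a b d t H) as [Hu Hv].
  pose proof (C_norm2_neq_0 _ Hn) as Hnz.
  assert (Hp : 0 < Re (f (a + RtoC t * b)%C) * Re (f (a + RtoC t * b)%C)
     + Im (f (a + RtoC t * b)%C) * Im (f (a + RtoC t * b)%C)).
  { set (p := Re (f (a + RtoC t * b)%C)) in *. set (q := Im (f (a + RtoC t * b)%C)) in *.
    destruct (Req_dec p 0) as [Ep|Np]; [|nra]. destruct (Req_dec q 0) as [Eq|Nq]; [|nra].
    exfalso. apply Hnz. rewrite Ep, Eq. ring. }
  assert (L := is_derive_ln_norm _ _ t _ _ Hu Hv Hp).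
  replace (Re (d * b / f (a + RtoC t * b))%C) with
    ((Re (d * b) * Re (f (a + RtoC t * b)%C) + Im (d * b) * Im (f (a + RtoC t * b)%C)) /
     (Re (f (a + RtoC t * b)%C) * Re (f (a + RtoC t * b)%C)
     + Im (f (a + RtoC t * b)%C) * Im (f (a + RtoC t * b)%C))).
  2:{ destruct (f (a + RtoC t * b)%C) as [p r], (d * b)%C as [x y].
      unfold Re, Im in *; simpl in *. field. repeat split; intros E; nra. }
  revert L. apply is_derive_ext. intros s. unfold Cmod, Re, Im. do 2 f_equal. simpl. ring.
Qed.

(** From [2 Re a Re b = Re (a b + a conj b)] and [c conj c = 1]. The right-hand side is free of the
    conjugate of [c], so on a circle it is the real part of a holomorphic function. *)
Lemma Re_unit_product (k e c : C) : Re c * Re c + Im c * Im c = 1 ->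
  (- Re (k * c)%C) * (1 - Re (Cconj e * c)%C) =
  Re (RtoC (/ 2) * (Cconj e * k * c * c) - k * c + RtoC (/ 2) * (e * k))%C.
Proof.
  destruct k as [k1 k2], e as [e1 e2], c as [c1 c2]. unfold Re, Im; simpl. intros H.
  apply Rminus_diag_uniq.
  transitivity (/ 2 * (e1 * k1 - e2 * k2) * (c1 * c1 + c2 * c2 - 1)); [field | rewrite H; ring].
Qed.

(** The gradient estimate for the positive harmonic function [A - ln |g|], obtained without a
    holomorphic logarithm. Its integrals [Y r] over circles, against the weight [wt >= 0], have the
    constant derivative [- PI |k 0|] in [r], where [k = g'/g]. Since [Y s >= 0] and
    [Y 0 = 2 PI (A - ln |g 0|)], this slope cannot be too steep. *)
Lemma log_deriv_bound_0 (g g' : C -> C) (A s t : R) : 0 < s < t -> entire g g' ->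
  (forall z, Cmod z < t -> g z <> 0%C) -> (forall z, Cmod z < t -> ln (Cmod (g z)) <= A) ->
  s * Cmod (g' 0%C / g 0%C) <= 2 * (A - ln (Cmod (g 0%C))).
Proof.
  intros Hst Hg Hnz HA. pose proof PI_RGT_0 as HPI.
  destruct (entire_deriv g g' Hg) as [g'' Hg'].
  set (k := fun z => (g' z / g z)%C).
  assert (Hk : forall z, Cmod z < t -> holo_at k z).
  { intros z Hz. apply holo_div; [apply (entire_holo g' g''), Hg' | apply (entire_holo g g'), Hg | apply Hnz, Hz]. }
  change (g' 0%C / g 0%C)%C with (k 0%C).
  assert (H00 : Cmod 0%C < t) by (rewrite Cmod_0; lra).
  destruct (Ceq_dec (k 0%C) 0) as [E0 | N0].
  { rewrite E0, Cmod_0. specialize (HA 0%C H00). lra. }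
  pose proof (proj1 (Cmod_gt_0 _) N0) as Hkp.
  (* The unit vector along which [ln |g|] decreases fastest at 0, so that [eta * k 0] is [- |k 0|];
     [wt] is then one minus the cosine of the angle between [cis th] and [eta]. *)
  set (eta := (- Cconj (k 0%C) / RtoC (Cmod (k 0%C)))%C).
  assert (Hk0c : RtoC (Cmod (k 0%C)) <> 0%C) by (intros E; apply RtoC_inj in E; lra).
  assert (Heta : Cmod eta = 1).
  { unfold eta. rewrite Cmod_div, Cmod_opp, Cmod_conj, Cmod_R, Rabs_pos_eq by (lra || assumption). field. lra. }
  assert (Hek : (eta * k 0%C)%C = RtoC (- Cmod (k 0%C))).
  { unfold eta. replace (- Cconj (k 0%C) / RtoC (Cmod (k 0%C)) * k 0%C)%C with
      (- (k 0%C * Cconj (k 0%C)) / RtoC (Cmod (k 0%C)))%C by (field; assumption).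
    rewrite <- Cmod2_conj. rewrite RtoC_opp. rewrite RtoC_pow. field. assumption. }
  set (wt := fun th : R => 1 - Re (Cconj eta * cis th)%C).
  assert (Hwt : forall th, 0 <= wt th).
  { intros th. unfold wt. pose proof (re_le_Cmod (Cconj eta * cis th)%C) as B.
    rewrite Cmod_mult, Cmod_conj, Heta, Cmod_cis in B. pose proof (Rle_abs (Re (Cconj eta * cis th)%C)). lra. }
  set (F := fun r th : R => (A - ln (Cmod (g (0 + RtoC r * cis th)%C))) * wt th).
  set (D := fun r th : R => (- Re (k (0 + RtoC r * cis th) * cis th)%C) * wt th).
  assert (Hm : forall r th, Cmod (0 + RtoC r * cis th)%C = Rabs r).
  { intros r th. rewrite Cplus_0_l, Cmod_mult, Cmod_cis, Cmod_R. ring. }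
  assert (HD : forall r th, Rabs r < t -> is_derive (fun u => F u th) r (D r th)).
  { intros r th Hr. unfold F, D.
    assert (L := is_derive_ln_Cmod g 0%C (cis th) (g' (0 + RtoC r * cis th)%C) r (Hg _)
      (Hnz _ (eq_ind_r (fun x => x < t) Hr (Hm r th)))).
    evar_last.
    - apply (is_derive_scal_l (V := R_NormedModule) (fun u => A - ln (Cmod (g (0 + RtoC u * cis th)%C)))).
      apply (is_derive_minus (V := R_NormedModule) (fun _ => A)); [apply is_derive_const | exact L].
    - unfold k, scal, minus, plus, opp, zero; simpl. unfold mult; simpl.
      replace (g' (0 + RtoC r * cis th) / g (0 + RtoC r * cis th) * cis th)%C with
        (g' (0 + RtoC r * cis th) * cis th / g (0 + RtoC r * cis th))%C by (unfold Cdiv; ring).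
      ring. }
  assert (Hwc : forall (U : UniformSpace) (f : U -> R) x, continuous f x -> continuous (fun u => wt (f u)) x).
  { intros U f x Hf. unfold wt. apply continuous_Rminus; [apply continuous_const|].
    apply continuous_Re, continuous_Cmult; [apply continuous_const | apply continuous_cis, Hf]. }
  assert (Hzc : forall r th, continuous (fun z : R * R => (0 + RtoC (fst z) * cis (snd z))%C) (r, th)).
  { intros r th. apply continuous_Cplus; [apply continuous_const|].
    apply continuous_Cmult; [apply continuous_RtoC, continuous_fst | apply continuous_cis, continuous_snd]. }
  assert (HDc : forall r th, Rabs r < t -> continuous (fun z : R * R => D (fst z) (snd z)) (r, th)).
  { intros r th Hr. unfold D. apply continuous_Rmult; [|apply Hwc, continuous_snd].
    apply continuous_Ropp, continuous_Re, continuous_Cmult; [|apply continuous_cis, continuous_snd].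
    apply (continuous_comp (fun z : R * R => (0 + RtoC (fst z) * cis (snd z))%C) k); [apply Hzc|].
    apply holo_continuous, Hk. simpl. rewrite Hm. exact Hr. }
  assert (HFc : forall r th, Rabs r < t -> continuous (fun th => F r th) th).
  { intros r th Hr. unfold F. apply continuous_Rmult; [|apply Hwc, continuous_id].
    apply continuous_Rminus; [apply continuous_const|].
    assert (Hgp : g (0 + RtoC r * cis th)%C <> 0%C) by (apply Hnz; rewrite Hm; exact Hr).
    apply (continuous_Rcomp (fun th => Cmod (g (0 + RtoC r * cis th)%C)) ln).
    - apply continuous_Cmod. apply (continuous_comp (fun th => (0 + RtoC r * cis th)%C) g).
      + apply continuous_Cplus; [apply continuous_const|].
        apply continuous_Cmult; [apply continuous_const | apply continuous_cis, continuous_id].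
      + apply holo_continuous, (entire_holo g g'), Hg.
    - apply continuity_pt_filterlim, continuous_ln, Cmod_gt_0, Hgp. }
  set (Y := fun r => RInt (fun th => F r th) 0 (2 * PI)).
  assert (Hloc : forall r, Rabs r < t -> locally r (fun u : R => Rabs u < t)).
  { intros r Hr. assert (He : 0 < t - Rabs r) by lra. exists (mkposreal _ He). intros u Hu.
    unfold ball in Hu; simpl in Hu; unfold AbsRing_ball, abs, minus, plus, opp in Hu; simpl in Hu.
    replace u with (u + - r + r) by ring. pose proof (Rabs_triang (u + - r) r). lra. }
  assert (HY : forall r, Rabs r < t -> is_derive Y r (RInt (fun th => D r th) 0 (2 * PI))).
  { intros r Hr. unfold Y.
    replace (RInt (fun th => D r th) 0 (2 * PI)) with
      (RInt (fun th => Derive (fun u => F u th) r) 0 (2 * PI)).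
    2:{ apply RInt_ext. intros th _. apply is_derive_unique, HD, Hr. }
    apply is_derive_RInt_param.
    - generalize (Hloc r Hr). apply filter_imp. intros u Hu th _. exists (D u th). apply HD, Hu.
    - intros th _. apply continuity_2d_pt_ext_loc with (f := D).
      + assert (He : 0 < t - Rabs r) by lra. exists (mkposreal _ He). intros u v Hu _. simpl in Hu.
        symmetry. apply is_derive_unique, HD.
        replace u with (u - r + r) by ring. pose proof (Rabs_triang (u - r) r). lra.
      + apply continuity_2d_pt_filterlim. apply HDc, Hr.
    - generalize (Hloc r Hr). apply filter_imp. intros u Hu.
      apply (ex_RInt_continuous (V := R_CompleteNormedModule)). intros th _. apply HFc, Hu. }
  assert (Hc : forall r, 0 < r < t -> RInt (fun th => D r th) 0 (2 * PI) = - (PI * Cmod (k 0%C))).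
  { intros r Hr.
    (* on |z| = r, [D] is the real part of a holomorphic function, by [z * conj z = r^2] *)
    set (Phi := fun z => (z * ((/ RtoC 2 * Cconj eta / (RtoC r * RtoC r)) * (k z * z) - / RtoC r * k z)
       + / RtoC 2 * eta * k z)%C).
    assert (HPh : forall z, Cmod z < t -> holo_at Phi z).
    { intros z Hz. assert (Hkz := Hk z Hz). unfold Phi. holo_tac. }
    assert (Hcirc : circ Phi r = (RtoC (2 * PI) * Phi 0%C)%C).
    { rewrite <- (cauchy_disc Phi 0%C r).
      - apply circ_ext; [lra|]. intros z Hz. field. intros E. replace (z - 0)%C with z in E by ring.
        rewrite E, Cmod_0 in Hz. lra.
      - rewrite Cmod_0. lra.
      - apply holo_continuous, HPh, H00.
      - intros z Hz. apply HPh. lra. }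
    assert (Hr0 : RtoC r <> 0%C) by (intros E; apply RtoC_inj in E; lra).
    assert (HP0 : Phi 0%C = RtoC (- (Cmod (k 0%C) / 2))).
    { unfold Phi. replace (0 * ((/ RtoC 2 * Cconj eta / (RtoC r * RtoC r)) * (k 0%C * 0) - / RtoC r * k 0%C)
       + / RtoC 2 * eta * k 0%C)%C with (/ RtoC 2 * (eta * k 0%C))%C by (field; assumption).
      rewrite Hek. rewrite <- RtoC_inv, <- RtoC_mult by lra. f_equal. field. }
    rewrite HP0, <- RtoC_mult in Hcirc.
    apply (f_equal Re) in Hcirc. rewrite re_RtoC in Hcirc.
    replace (- (PI * Cmod (k 0%C))) with (2 * PI * - (Cmod (k 0%C) / 2)) by field.
    rewrite <- Hcirc.
    change (Re (circ Phi r)) with (RInt (fun t => Re (Phi (RtoC r * cis t)%C)) 0 (2 * PI)).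
    apply RInt_ext. intros th _. unfold D, wt, Phi. rewrite Cplus_0_l.
    set (z := (RtoC r * cis th)%C). set (c := cis th).
    replace (z * ((/ RtoC 2 * Cconj eta / (RtoC r * RtoC r)) * (k z * z) - / RtoC r * k z)
       + / RtoC 2 * eta * k z)%C with
      (/ RtoC 2 * (Cconj eta * k z * c * c) - k z * c + / RtoC 2 * (eta * k z))%C.
    2:{ unfold z. fold c. field. exact Hr0. }
    assert (Hcc : Re c * Re c + Im c * Im c = 1).
    { rewrite <- Cmod_sqr. unfold c. rewrite Cmod_cis. ring. }
    rewrite <- RtoC_inv by lra.
    apply Re_unit_product, Hcc. }
  assert (HY0 : Y 0 = 2 * PI * (A - ln (Cmod (g 0%C)))).
  { unfold Y, F.
    assert (Hid : CI (fun th => cis th) 0 (2 * PI) = 0%C).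
    { rewrite (CI_ext _ (fun t => (fun z => z) (RtoC 1 * cis t)%C)) by (apply two_PI_ge_0 || (intros; ring)).
      change (circ (fun z => z) 1 = 0%C).
      rewrite (circ_ext _ (fun z => z * z / (z - 0))%C).
      - rewrite (cauchy_disc (fun z => z) 0%C 1); [ring | rewrite Cmod_0; lra | apply continuous_id | intros; apply holo_id].
      - lra.
      - intros z Hz. field. intros E. replace (z - 0)%C with z in E by ring. rewrite E, Cmod_0 in Hz. lra. }
    rewrite (RInt_ext _ (fun th => Re (RtoC (A - ln (Cmod (g 0%C))) * (1 - Cconj eta * cis th))%C)).
    2:{ intros th _. rewrite re_scal_l. unfold wt. rewrite Cmult_0_l, Cplus_0_r. f_equal. }
    change (Re (CI (fun th => RtoC (A - ln (Cmod (g 0%C))) * (1 - Cconj eta * cis th))%C 0 (2 * PI)) = 2 * PI * (A - ln (Cmod (g 0%C)))).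
    assert (Cc : cont_on (fun th => cis th) 0 (2 * PI)) by (intros u _; apply continuous_cis, continuous_id).
    assert (Cc2 : cont_on (fun th => Cconj eta * cis th)%C 0 (2 * PI)).
    { intros u Hu. apply continuous_Cmult; [apply continuous_const | apply Cc, Hu]. }
    assert (C1 : cont_on (fun _ => RtoC 1) 0 (2 * PI)) by (intros u _; apply continuous_const).
    rewrite (CI_scal _ (fun th => 1 - Cconj eta * cis th)%C), (CI_minus (fun _ => RtoC 1) (fun th => Cconj eta * cis th)%C),
      (CI_scal (Cconj eta) (fun th => cis th)), Hid, CI_const;
      try apply two_PI_ge_0; try assumption.
    - rewrite re_scal_l. unfold Re; simpl. ring.
    - intros u Hu. apply continuous_Cminus; [apply C1, Hu | apply Cc2, Hu]. }
  assert (HYs : 0 <= Y s).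
  { unfold Y.
    assert (Hs : Rabs s < t) by (rewrite Rabs_pos_eq; lra).
    apply RInt_ge_0; [apply two_PI_ge_0 | |].
    - apply (ex_RInt_continuous (V := R_CompleteNormedModule)). intros th _. apply HFc, Hs.
    - intros th _. unfold F. apply Rmult_le_pos; [|apply Hwt].
      specialize (HA (0 + RtoC s * cis th)%C). rewrite Hm in HA. specialize (HA Hs). lra. }
  destruct (MVT_gen Y 0 s (fun _ => - (PI * Cmod (k 0%C)))) as [c [_ Ec]].
  - rewrite Rmin_left, Rmax_right by lra. intros x Hx. rewrite <- (Hc x) by lra.
    apply HY. rewrite Rabs_pos_eq; lra.
  - rewrite Rmin_left, Rmax_right by lra. intros x Hx.
    apply continuity_pt_filterlim, (ex_derive_continuous Y). eexists. apply HY. rewrite Rabs_pos_eq; lra.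
  - apply Rmult_le_reg_l with PI; [lra|]. lra.
Qed.

(* Borel-Caratheodory for the logarithm of a zero-free function. *)
Lemma log_deriv_bound (g g' : C -> C) (c : C) (A t : R) : 0 < t -> entire g g' ->
  (forall z, Cmod (z - c) < t -> g z <> 0%C) -> (forall z, Cmod (z - c) < t -> ln (Cmod (g z)) <= A) ->
  t * Cmod (g' c / g c) <= 2 * (A - ln (Cmod (g c))).
Proof.
  intros Ht Hg Hnz HA.
  assert (S : forall s, 0 < s < t -> s * Cmod (g' c / g c) <= 2 * (A - ln (Cmod (g c)))).
  { intros s Hs.
    assert (B := log_deriv_bound_0 (fun u => g (c + u)%C) (fun u => g' (c + u)%C) A s t Hs (entire_shift g g' c Hg)).
    simpl in B. rewrite Cplus_0_r in B. apply B.
    - intros z Hz. apply Hnz. replace (c + z - c)%C with z by ring. exact Hz.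
    - intros z Hz. apply HA. replace (c + z - c)%C with z by ring. exact Hz. }
  apply Rnot_lt_le. intros Hlt. set (m := Cmod (g' c / g c)) in *. set (Q := 2 * (A - ln (Cmod (g c)))) in *.
  assert (HQ : 0 <= Q).
  { specialize (HA c). replace (c - c)%C with (RtoC 0) in HA by ring. rewrite Cmod_0 in HA.
    specialize (HA Ht). unfold Q. lra. }
  assert (Hm : 0 < m) by (assert (0 <= m) by apply Cmod_ge_0; nra).
  assert (Q / m < t) by (apply Rmult_lt_reg_r with m; [lra|]; unfold Rdiv; rewrite Rmult_assoc, Rinv_l by lra; lra).
  assert (0 <= Q / m) by (apply Rdiv_le_0_compat; lra).
  specialize (S ((Q / m + t) / 2) ltac:(lra)).
  assert (E : Q / m * m = Q) by (field; lra). nra.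
Qed.

(** At every point the gradient of [A - ln |g|] is at most [4 / rad] times its value. Over a segment
    of length at most [rad / 2] the value therefore grows at most by the factor [exp 2], a Harnack
    inequality, and the bound at [z] can be stated with the value at [w]. *)
Lemma log_deriv_bound_disc (g g' : C -> C) (w : C) (A rad : R) : 0 < rad -> entire g g' ->
  (forall z, Cmod (z - w) < rad -> g z <> 0%C) -> (forall z, Cmod (z - w) < rad -> ln (Cmod (g z)) <= A) ->
  forall z, Cmod (z - w) <= rad / 2 -> Cmod (g' z / g z) <= 4 * exp 2 / rad * (A - ln (Cmod (g w))).
Proof.
  intros Hrad Hg Hnz HA z Hz.
  assert (Hloc : forall u, Cmod (u - w) <= rad / 2 -> rad / 2 * Cmod (g' u / g u) <= 2 * (A - ln (Cmod (g u)))).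
  { intros u Hu. apply log_deriv_bound; [lra | exact Hg | |].
    - intros v Hv. apply Hnz. replace (v - w)%C with ((v - u) + (u - w))%C by ring.
      eapply Rle_lt_trans; [apply Cmod_triangle|]. lra.
    - intros v Hv. apply HA. replace (v - w)%C with ((v - u) + (u - w))%C by ring.
      eapply Rle_lt_trans; [apply Cmod_triangle|]. lra. }
  (* Gronwall along the segment from [w] to [z] *)
  set (V := fun s : R => A - ln (Cmod (g (w + RtoC s * (z - w))%C))).
  assert (Hseg : forall s, 0 <= s <= 1 -> Cmod (w + RtoC s * (z - w) - w) <= rad / 2).
  { intros s Hs. replace (w + RtoC s * (z - w) - w)%C with (RtoC s * (z - w))%C by ring.
    rewrite Cmod_mult, Cmod_R, Rabs_pos_eq by lra. pose proof (Cmod_ge_0 (z - w)). nra. }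
  set (dV := fun s : R => - Re (g' (w + RtoC s * (z - w)) * (z - w) / g (w + RtoC s * (z - w)))%C).
  assert (HdV : forall s, 0 <= s <= 1 -> is_derive V s (dV s)).
  { intros s Hs. unfold V, dV. evar_last.
    - apply (is_derive_minus (V := R_NormedModule) (fun _ => A)); [apply is_derive_const|].
      apply is_derive_ln_Cmod; [apply Hg|]. apply Hnz. specialize (Hseg s Hs). lra.
    - unfold minus, plus, opp, zero; simpl. ring. }
  assert (HV : V 1 <= exp 2 * V 0).
  { destruct (MVT_gen (fun s => exp (- (2 * s)) * V s) 0 1 (fun s => exp (- (2 * s)) * (dV s - 2 * V s))) as [c [Hc Ec]].
    - rewrite Rmin_left, Rmax_right by lra. intros s Hs. evar_last.
      + apply (is_derive_mult (K := R_AbsRing) (fun s => exp (- (2 * s))) V).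
        * auto_derive; [exact I | reflexivity].
        * apply HdV; lra.
        * intros; apply Rmult_comm.
      + unfold plus, mult; simpl. ring.
    - rewrite Rmin_left, Rmax_right by lra. intros s Hs. apply continuity_pt_filterlim.
      apply (continuous_mult (K := R_AbsRing) (fun s => exp (- (2 * s))) V).
      + apply (ex_derive_continuous (fun s => exp (- (2 * s)))). auto_derive. exact I.
      + apply (ex_derive_continuous V). exists (dV s). apply HdV; lra.
    - rewrite Rmin_left, Rmax_right in Hc by lra.
      assert (Hd : dV c <= 2 * V c).
      { unfold dV. set (u := (w + RtoC c * (z - w))%C) in *.
        assert (Hu := Hloc u (Hseg c Hc)).
        replace (g' u * (z - w) / g u)%C with (g' u / g u * (z - w))%C by (unfold Cdiv; ring).
        eapply Rle_trans; [apply Rle_abs|]. rewrite Rabs_Ropp. eapply Rle_trans; [apply re_le_Cmod|].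
        rewrite Cmod_mult. unfold V. fold u. pose proof (Cmod_ge_0 (g' u / g u)).
        eapply Rle_trans; [apply Rmult_le_compat_l; [assumption | exact Hz]|]. lra. }
      pose proof (exp_pos (- (2 * c))) as Hpos.
      replace (- (2 * 0)) with 0 in Ec by ring. rewrite exp_0 in Ec.
      assert (L : exp (- (2 * 1)) * V 1 <= V 0) by nra.
      apply Rmult_le_compat_l with (r := exp 2) in L; [|left; apply exp_pos].
      rewrite <- Rmult_assoc, <- exp_plus in L. replace (2 + - (2 * 1)) with 0 in L by ring.
      rewrite exp_0 in L. lra. }
  assert (B := Hloc z Hz).
  unfold V in HV. replace (w + RtoC 1 * (z - w))%C with z in HV by ring.
  replace (w + RtoC 0 * (z - w))%C with w in HV by ring.
  apply Rmult_le_reg_l with (rad / 2); [lra|].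
  replace (rad / 2 * (4 * exp 2 / rad * (A - ln (Cmod (g w))))) with (2 * (exp 2 * (A - ln (Cmod (g w))))) by (field; lra).
  lra.
Qed.

(** * Growth of the maximum modulus *)

Lemma Defs_Cmod (z : C) : Defs.Cmod z = Cmod z.
Proof. unfold Defs.Cmod, Cmod. f_equal. simpl. ring. Qed.

Lemma Defs_Cdiv (z w : C) : Defs.Cdiv z w = (z / w)%C.
Proof.
  unfold Defs.Cdiv, Cdiv, Defs.Cinv, Cinv, Defs.Cmul, Cmult. simpl.
  rewrite !Rmult_1_r. reflexivity.
Qed.

Lemma Defs_entire (f f' : C -> C) : entire_with_deriv f f' -> entire f f'.
Proof.
  intros H z eps He. destruct (H z eps He) as [d [Hd H1]]. exists d. split; [exact Hd|].
  intros h Hh. destruct (Ceq_dec h 0) as [-> | Hn].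
  { rewrite Cplus_0_r. replace (f z - f z - f' z * 0)%C with (RtoC 0) by ring. rewrite Cmod_0. lra. }
  specialize (H1 h Hn). rewrite !Defs_Cmod in H1. specialize (H1 Hh). rewrite Defs_Cdiv in H1.
  change (Cmod ((f (z + h) - f z) / h - f' z)%C < eps) in H1.
  replace (f (z + h) - f z - f' z * h)%C with (((f (z + h) - f z) / h - f' z) * h)%C by (field; exact Hn).
  rewrite Cmod_mult. apply Rmult_le_compat_r; [apply Cmod_ge_0 | lra].
Qed.

(** The choice operator in [M] returns a least upper bound. One exists because the circle is
    compact, and it is unique, so [M] is an attained maximum. *)
Lemma M_spec (f f' : C -> C) (r : R) : entire f f' -> 0 <= r ->
  exists z0, Cmod z0 = r /\ M f r = Cmod (f z0) /\ forall z, Cmod z = r -> Cmod (f z) <= M f r.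
Proof.
  intros Hf Hr.
  destruct (circle_max f 0%C r Hr) as [z0 [H0 Hm]].
  { intros z _. apply holo_continuous, (entire_holo f f'), Hf. }
  replace (z0 - 0)%C with z0 in H0 by ring.
  assert (Hlub : is_lub (fun y => exists z : Cplx, Defs.Cmod z = r /\ y = Defs.Cmod (f z)) (Cmod (f z0))).
  { split.
    - intros y [z [Hz ->]]. rewrite Defs_Cmod in *. apply Hm. rewrite <- Hz. f_equal. ring.
    - intros y Hy. apply Hy. exists z0. rewrite !Defs_Cmod. split; [exact H0 | reflexivity]. }
  assert (E : M f r = Cmod (f z0)).
  { apply (is_lub_u (fun y => exists z : Cplx, Defs.Cmod z = r /\ y = Defs.Cmod (f z))); [|exact Hlub].
    unfold M. apply epsilon_spec. exists (Cmod (f z0)). exact Hlub. }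
  exists z0. split; [exact H0|]. split; [exact E|]. intros z Hz. rewrite E. apply Hm.
  rewrite <- Hz. f_equal. ring.
Qed.

Lemma M_disc (f f' : C -> C) (r : R) (z : C) : entire f f' -> Cmod z <= r -> Cmod (f z) <= M f r.
Proof.
  intros Hf Hz. pose proof (Cmod_ge_0 z).
  destruct (M_spec f f' r Hf) as [z0 [_ [_ Hm]]]; [lra|].
  apply (max_modulus_0 f r); [exact Hz | intros; apply (entire_holo f f'), Hf | exact Hm].
Qed.

Lemma M_mono (f f' : C -> C) (r s : R) : entire f f' -> 0 <= r -> r <= s -> M f r <= M f s.
Proof.
  intros Hf Hr Hs. destruct (M_spec f f' r Hf Hr) as [z0 [H0 [-> _]]].
  apply (M_disc f f'); [exact Hf | lra].
Qed.

(** The entire quotient [(f z - f a) / (z - a)] is at most [2 K / r] on circles of radius [r] about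
    [a], hence zero by the maximum principle. *)
Lemma liouville (f f' : C -> C) (K : R) : entire f f' -> (forall z, Cmod (f z) <= K) -> forall a b, f a = f b.
Proof.
  intros Hf HK a b.
  assert (HK0 : 0 <= K) by (eapply Rle_trans; [apply (Cmod_ge_0 (f a)) | apply HK]).
  assert (Hfa : entire (fun z => f z - f a)%C (fun z => f' z - 0)%C).
  { intros z. apply cder_minus; [apply Hf | apply cder_const]. }
  destruct (entire_divide _ _ a Hfa) as [g [g' [Hg E]]]; [ring|]. simpl in E.
  assert (Hb : g b = 0%C).
  { apply Cmod_le_eps_0. intros eps He.
    set (r := Cmod (b - a) + 2 * K / eps + 1).
    assert (0 <= 2 * K / eps) by (apply Rdiv_le_0_compat; lra).
    pose proof (Cmod_ge_0 (b - a)).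
    apply (max_modulus g a r); [unfold r; lra | intros; apply (entire_holo g g'), Hg |].
    intros z Hz. apply Rmult_le_reg_l with r; [unfold r; lra|].
    rewrite <- Hz at 1. rewrite <- Cmod_mult, <- E.
    eapply Rle_trans; [apply Cmod_triangle'|]. pose proof (HK z). pose proof (HK a).
    assert (2 * K <= r * eps).
    { replace (2 * K) with (2 * K / eps * eps) by (field; lra). apply Rmult_le_compat_r; [lra|]. unfold r. lra. }
    lra. }
  specialize (E b). rewrite Hb, Cmult_0_r in E. symmetry. apply Csub_0_eq, E.
Qed.

Definition growth (f : C -> C) (A B Cc r0 : R) : Prop := forall r, r0 <= r ->
  A * ln (M f r) <= ln (M f (Cc * r)) /\ ln (M f (Cc * r)) <= B * ln (M f r).

Lemma growth_iter (f : C -> C) (A B Cc r0 : R) (n : nat) : 0 < A -> 0 < B -> 1 <= Cc -> 0 < r0 -> growth f A B Cc r0 ->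
  growth f (A ^ n) (B ^ n) (Cc ^ n) r0.
Proof.
  intros HA HB HC Hr0 H. induction n as [|n IH]; intros r Hr.
  - simpl. rewrite !Rmult_1_l. lra.
  - destruct (IH r Hr) as [I1 I2].
    assert (Hp : 1 <= Cc ^ n) by (apply pow_R1_Rle; exact HC).
    destruct (H (Cc ^ n * r)) as [J1 J2]; [nra|].
    simpl. replace (Cc * Cc ^ n * r) with (Cc * (Cc ^ n * r)) by ring. rewrite !Rmult_assoc. split.
    + eapply Rle_trans; [|exact J1]. apply Rmult_le_compat_l; lra.
    + eapply Rle_trans; [exact J2|]. apply Rmult_le_compat_l; lra.
Qed.

Lemma pow_ge_exists (x b : R) : 1 < x -> exists n : nat, b <= x ^ n.
Proof.
  intros Hx. destruct (Pow_x_infinity x) with (b := b) as [n Hn].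
  - rewrite Rabs_pos_eq; lra.
  - exists n. specialize (Hn n (le_n n)). rewrite Rabs_pos_eq in Hn by (apply pow_le; lra). lra.
Qed.

Lemma ln_mono (x y : R) : 0 < x -> x <= y -> ln x <= ln y.
Proof.
  intros Hx Hy. destruct (Rle_lt_or_eq_dec _ _ Hy) as [H | ->]; [left; apply ln_increasing; assumption | lra].
Qed.

(** Beyond [r1] all logarithms of [M] are positive, as the growth estimates below need
    throughout. *)
Lemma M_gt_1 (f f' : C -> C) (r0 : R) : entire f f' -> (exists z1 z2, f z1 <> f z2) -> 
  exists r1, 0 < r1 /\ r0 <= r1 /\ forall r, r1 <= r -> 1 < M f r.
Proof.
  intros Hf [z1 [z2 Hn]].
  assert (He : exists r1, 0 < r1 /\ r0 <= r1 /\ 1 < M f r1).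
  { apply NNPP. intros Hc. apply Hn. apply (liouville f f' 1 Hf). intros z.
    set (r := Rmax (Rmax 1 r0) (Cmod z)).
    pose proof (Rmax_l (Rmax 1 r0) (Cmod z)). pose proof (Rmax_r (Rmax 1 r0) (Cmod z)).
    pose proof (Rmax_l 1 r0). pose proof (Rmax_r 1 r0).
    apply Rle_trans with (M f r); [apply (M_disc f f'); [exact Hf | exact H0]|].
    apply Rnot_lt_le. intros Hlt. apply Hc. exists r. unfold r in *. repeat split; lra. }
  destruct He as [r1 [H1 [H2 H3]]]. exists r1. split; [exact H1|]. split; [exact H2|]. intros r Hr.
  eapply Rlt_le_trans; [exact H3 | apply (M_mono f f'); [exact Hf | lra | exact Hr]].
Qed.

Lemma lnM_mono (f f' : C -> C) (r s : R) : entire f f' -> 0 <= r -> r <= s -> 1 < M f r -> ln (M f r) <= ln (M f s).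
Proof. intros Hf Hr Hs H1. apply ln_mono; [lra | apply (M_mono f f'); assumption]. Qed.

Lemma geometric_bracket (c a r : R) : 1 < c -> 0 < a -> a <= r -> exists k : nat, c ^ k * a <= r < c ^ S k * a.
Proof.
  intros Hc Ha Hr. destruct (pow_ge_exists c (r / a + 1) Hc) as [n Hn].
  assert (H : r < c ^ n * a).
  { apply Rlt_le_trans with ((r / a + 1) * a); [|apply Rmult_le_compat_r; lra].
    replace ((r / a + 1) * a) with (r + a) by (field; lra). lra. }
  clear Hn. induction n as [|n IH]; [simpl in H; lra|].
  destruct (Rle_dec (c ^ n * a) r) as [L|L]; [exists n; split; assumption | apply IH; lra].
Qed.

(** After [k] steps of ratio [Cc] the logarithm of [M] has gained the factor [A^k], while [ln r] has
    grown only linearly in [k]. So [M] exceeds every power of [r]; the condition [|f z| >= |z|^q]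
    rests on this. *)
Lemma growth_beats_log (f f' : C -> C) (A B Cc r0 : R) : entire f f' -> (exists z1 z2, f z1 <> f z2) ->
  1 < A -> 1 < B -> 1 < Cc -> 1 < r0 -> growth f A B Cc r0 ->
  forall Q, 0 <= Q -> exists R0, 1 < R0 /\ forall r, R0 <= r -> Q * ln r <= ln (M f r).
Proof.
  intros Hf Hnc HA HB HC Hr0 Hg Q HQ.
  destruct (M_gt_1 f f' r0 Hf Hnc) as [r1 [H1 [H01 HM]]].
  set (l1 := ln (M f r1)).
  assert (Hl1 : 0 < l1) by (unfold l1; rewrite <- ln_1; apply ln_increasing; [lra | apply HM; lra]).
  (* Bernoulli's inequality for [sqrt A], then squared, gives [A^k >= (k s)^2]: quadratic in [k],
     enough against a linear term. *)
  set (s := sqrt A - 1).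
  assert (Hs : 0 < s) by (unfold s; rewrite <- sqrt_1; apply Rlt_0_minus, sqrt_lt_1; lra).
  set (c1 := ln Cc). assert (Hc1 : 0 < c1) by (unfold c1; rewrite <- ln_1; apply ln_increasing; lra).
  set (c2 := ln r1). assert (Hc2 : 0 < c2) by (unfold c2; rewrite <- ln_1; apply ln_increasing; lra).
  destruct (INR_unbounded (Q * (2 * c1 + c2) / (s * s * l1))) as [k0 Hk0].
  exists (Cc ^ S k0 * r1). split.
  { pose proof (pow_R1_Rle Cc (S k0) ltac:(lra)). nra. }
  intros r Hr. assert (Hp : 1 <= Cc ^ S k0) by (apply pow_R1_Rle; lra).
  assert (Hrr : r1 <= r) by nra.
  destruct (geometric_bracket Cc r1 r HC H1 Hrr) as [k [Hk1 Hk2]].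
  assert (Hkk : (S k0 <= k)%nat).
  { apply Nat.nlt_ge. intros Hlt. assert (Hle : (S k <= S k0)%nat) by lia.
    pose proof (Rle_pow Cc (S k) (S k0) ltac:(lra) Hle). nra. }
  assert (HkR : INR k0 <= INR k) by (apply le_INR; lia).
  assert (Hk1R : 1 <= INR k) by (replace 1 with (INR 1) by reflexivity; apply le_INR; lia).
  destruct (growth_iter f A B Cc r0 k ltac:(lra) ltac:(lra) ltac:(lra) ltac:(lra) Hg r1 H01) as [L1 _].
  assert (L2 : ln (M f (Cc ^ k * r1)) <= ln (M f r)).
  { assert (1 <= Cc ^ k) by (apply pow_R1_Rle; lra).
    apply (lnM_mono f f'); [exact Hf | nra | exact Hk1 | apply HM; nra]. }
  assert (L3 : INR k * INR k * (s * s) <= A ^ k).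
  { replace (A ^ k) with (sqrt A ^ k * sqrt A ^ k) by (rewrite <- Rpow_mult_distr, sqrt_sqrt by lra; reflexivity).
    replace (sqrt A) with (1 + s) by (unfold s; ring).
    pose proof (poly k s Hs). pose proof (pos_INR k).
    assert (0 <= INR k * s) by (apply Rmult_le_pos; lra). nra. }
  assert (L4 : ln r <= INR (S k) * c1 + c2).
  { unfold c1, c2. rewrite <- ln_pow, <- ln_mult by (try apply pow_lt; lra). apply ln_mono; lra. }
  rewrite S_INR in L4.
  assert (L5 : ln r <= INR k * (2 * c1 + c2)) by nra.
  assert (L6 : Q * (2 * c1 + c2) <= INR k * (s * s * l1)).
  { apply Rlt_le in Hk0. apply Rmult_le_compat_r with (r := s * s * l1) in Hk0; [|left; repeat apply Rmult_lt_0_compat; assumption].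
    replace (Q * (2 * c1 + c2) / (s * s * l1) * (s * s * l1)) with (Q * (2 * c1 + c2)) in Hk0 by (field; lra).
    eapply Rle_trans; [exact Hk0|]. apply Rmult_le_compat_r; [left; repeat apply Rmult_lt_0_compat; assumption | exact HkR]. }
  apply Rle_trans with (Q * (INR k * (2 * c1 + c2))); [apply Rmult_le_compat_l; assumption|].
  apply Rle_trans with (INR k * (INR k * (s * s * l1))).
  { replace (Q * (INR k * (2 * c1 + c2))) with (INR k * (Q * (2 * c1 + c2))) by ring.
    apply Rmult_le_compat_l; lra. }
  apply Rle_trans with (A ^ k * l1); [|unfold l1 in *; lra].
  replace (INR k * (INR k * (s * s * l1))) with (INR k * INR k * (s * s) * l1) by ring.
  apply Rmult_le_compat_r; lra.
Qed.

Lemma growth_unbounded (f f' : C -> C) (A B Cc r0 : R) : entire f f' -> (exists z1 z2, f z1 <> f z2) ->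
  1 < A -> 1 < B -> 1 < Cc -> 1 < r0 -> growth f A B Cc r0 ->
  forall Q, exists R0, 1 < R0 /\ forall r, R0 <= r -> Q <= ln (M f r).
Proof.
  intros Hf Hnc HA HB HC Hr0 Hg Q.
  destruct (growth_beats_log f f' A B Cc r0 Hf Hnc HA HB HC Hr0 Hg (Rmax Q 0) (Rmax_r _ _)) as [R0 [H0 H]].
  exists (Rmax R0 (exp 1)). pose proof (Rmax_l R0 (exp 1)). pose proof (Rmax_r R0 (exp 1)). split; [lra|].
  intros r Hr. specialize (H r ltac:(lra)).
  assert (1 <= ln r) by (rewrite <- (ln_exp 1); apply ln_mono; [apply exp_pos | lra]).
  pose proof (Rmax_l Q 0). pose proof (Rmax_r Q 0). nra.
Qed.

Lemma growth_doubling (f f' : C -> C) (A B Cc r0 q : R) : entire f f' -> (exists z1 z2, f z1 <> f z2) ->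
  1 < A -> 1 < B -> 1 < Cc -> 1 < r0 -> growth f A B Cc r0 -> 0 < q ->
  exists B1 R0, 1 <= B1 /\ 1 < R0 /\ forall r, R0 <= r -> ln (M f (q * r)) <= B1 * ln (M f r).
Proof.
  intros Hf Hnc HA HB HC Hr0 Hg Hq.
  destruct (M_gt_1 f f' r0 Hf Hnc) as [r1 [H1 [H01 HM]]].
  destruct (pow_ge_exists Cc q HC) as [n Hn].
  exists (B ^ n), (Rmax r1 (r1 / q)). split; [apply pow_R1_Rle; lra|].
  pose proof (Rmax_l r1 (r1 / q)) as X1. pose proof (Rmax_r r1 (r1 / q)) as X2.
  split; [lra|]. intros r Hr.
  destruct (growth_iter f A B Cc r0 n ltac:(lra) ltac:(lra) ltac:(lra) ltac:(lra) Hg r ltac:(lra)) as [_ L].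
  eapply Rle_trans; [|exact L].
  assert (Hqr : r1 <= q * r).
  { replace r1 with (q * (r1 / q)) by (field; lra). apply Rmult_le_compat_l; lra. }
  apply (lnM_mono f f'); [exact Hf | lra | apply Rmult_le_compat_r; lra | apply HM, Hqr].
Qed.

Lemma growth_half (f f' : C -> C) (A B Cc r0 : R) : entire f f' -> (exists z1 z2, f z1 <> f z2) ->
  1 < A -> 1 < B -> 1 < Cc -> 1 < r0 -> growth f A B Cc r0 ->
  exists K R0, 2 <= K /\ 1 < R0 /\ forall r, R0 <= r -> 1 < M f (r / K) /\ ln (M f (r / K)) <= ln (M f r) / 2.
Proof.
  intros Hf Hnc HA HB HC Hr0 Hg.
  destruct (M_gt_1 f f' r0 Hf Hnc) as [r1 [H1 [H01 HM]]].
  destruct (pow_ge_exists Cc 2 HC) as [n1 Hn1]. destruct (pow_ge_exists A 2 HA) as [n2 Hn2].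
  assert (K2 : 2 <= Cc ^ (n1 + n2)).
  { rewrite pow_add. pose proof (pow_R1_Rle Cc n2 ltac:(lra)). nra. }
  assert (A2 : 2 <= A ^ (n1 + n2)).
  { rewrite pow_add. pose proof (pow_R1_Rle A n1 ltac:(lra)). nra. }
  exists (Cc ^ (n1 + n2)), (Cc ^ (n1 + n2) * r1). split; [exact K2|]. split; [nra|].
  intros r Hr. set (K := Cc ^ (n1 + n2)) in *.
  assert (Hrk : r1 <= r / K).
  { apply Rmult_le_reg_l with K; [lra|]. replace (K * (r / K)) with r by (field; lra). exact Hr. }
  destruct (growth_iter f A B Cc r0 (n1 + n2) ltac:(lra) ltac:(lra) ltac:(lra) ltac:(lra) Hg (r / K) ltac:(lra)) as [L _].
  fold K in L. replace (K * (r / K)) with r in L by (field; lra).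
  split; [apply HM, Hrk|].
  assert (0 < ln (M f (r / K))) by (rewrite <- ln_1; apply ln_increasing; [lra | apply HM, Hrk]). nra.
Qed.

(** Cauchy's formula on the annulus between [r / K] and [sg r] for [f z / z^m], evaluated at a
    maximum point on [|z| = r]. With [m] free, it takes the place of the three circles theorem. *)
Lemma annulus_estimate (f f' : C -> C) (r K sg : R) (m : nat) : entire f f' -> 0 < r -> 1 < K -> 1 < sg ->
  M f r <= sg / (sg - 1) * M f (sg * r) / sg ^ m + M f (r / K) * K ^ m / (K - 1).
Proof.
  intros Hf Hr HK Hsg. pose proof PI_RGT_0.
  destruct (M_spec f f' r Hf ltac:(lra)) as [b [Hb [Eb _]]].
  set (psi := fun z => (f z / z ^ m)%C).
  assert (Hz0 : forall z, 0 < Cmod z -> (z ^ m)%C <> 0%C) by (intros z Hz; apply Cpow_nz, Cmod_pos_neq_0, Hz).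
  assert (Hpsi : forall z, 0 < Cmod z -> holo_at psi z).
  { intros z Hz. apply holo_div; [apply (entire_holo f f'), Hf | apply (holo_pow (fun z => z)), holo_id | apply Hz0, Hz]. }
  assert (Hk1 : r / K < r) by (apply Rmult_lt_reg_r with K; [lra|]; field_simplify; [nra|lra]).
  assert (Hk0 : 0 < r / K) by (apply Rdiv_lt_0_compat; lra).
  assert (Hs1 : r < sg * r) by nra.
  assert (E := cauchy_annulus psi b (r / K) (sg * r) Hk0 ltac:(lra) ltac:(lra) ltac:(intros; apply Hpsi; lra)).
  assert (Bd : forall rho D, 0 < rho -> 0 < D -> (forall z, Cmod z = rho -> D <= Cmod (z - b)) ->
     Cmod (circ (fun z => z * psi z / (z - b))%C rho) <= 2 * PI * (rho * (M f rho / rho ^ m) / D)).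
  { intros rho D Hrho HD Hz.
    assert (N : forall z, Cmod z = rho -> (z - b)%C <> 0%C).
    { intros z Hzr. apply Cmod_pos_neq_0. specialize (Hz z Hzr). lra. }
    assert (HMr : 0 <= M f rho).
    { destruct (M_spec f f' rho Hf ltac:(lra)) as [z0 [_ [-> _]]]. apply Cmod_ge_0. }
    assert (Hpm : 0 < rho ^ m) by (apply pow_lt; exact Hrho).
    apply circ_bound; [lra | |].
    - intros z Hzr. apply holo_continuous, holo_div; [apply holo_mult; [apply holo_id | apply Hpsi; lra] |
        holo_tac | apply N, Hzr].
    - intros z Hzr. rewrite Cmod_div by (apply N, Hzr). unfold psi.
      rewrite Cmod_mult, Cmod_div by (apply Hz0; lra). rewrite Cmod_pow, Hzr.
      unfold Rdiv. apply Rmult_le_compat.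
      + apply Rmult_le_pos; [lra|]. apply Rmult_le_pos; [apply Cmod_ge_0|]. left. apply Rinv_0_lt_compat, Hpm.
      + left. apply Rinv_0_lt_compat. specialize (Hz z Hzr). lra.
      + apply Rmult_le_compat_l; [lra|]. apply Rmult_le_compat_r; [left; apply Rinv_0_lt_compat, Hpm|].
        apply (M_disc f f'); [exact Hf | lra].
      + apply Rinv_le_contravar; [exact HD | apply Hz, Hzr]. }
  assert (B2 := Bd (sg * r) (sg * r - r) ltac:(lra) ltac:(lra) ltac:(intros z Hz; pose proof (Cmod_rev_triangle z b); lra)).
  assert (B0 := Bd (r / K) (r - r / K) Hk0 ltac:(lra)
     ltac:(intros z Hz; rewrite Cmod_sub_sym; pose proof (Cmod_rev_triangle b z); lra)).
  assert (E2 : 2 * PI * (M f r / r ^ m) <= 2 * PI * (sg * r * (M f (sg * r) / (sg * r) ^ m) / (sg * r - r))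
     + 2 * PI * (r / K * (M f (r / K) / (r / K) ^ m) / (r - r / K))).
  { apply Rle_trans with (Cmod (RtoC (2 * PI) * psi b)%C).
    - rewrite Cmod_mult, Cmod_R, Rabs_pos_eq by lra. unfold psi.
      rewrite Cmod_div by (apply Hz0; lra). rewrite Cmod_pow, Hb, Eb. lra.
    - rewrite <- E. eapply Rle_trans; [apply Cmod_triangle'|]. lra. }
  rewrite <- Rmult_plus_distr_l in E2. apply Rmult_le_reg_l in E2; [|lra].
  assert (Hpm : 0 < r ^ m) by (apply pow_lt; exact Hr).
  assert (Hpk : 0 < K ^ m) by (apply pow_lt; lra).
  assert (Hps : 0 < sg ^ m) by (apply pow_lt; lra).
  apply Rmult_le_reg_r with (/ r ^ m); [apply Rinv_0_lt_compat, Hpm|].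
  eapply Rle_trans; [exact E2|]. apply Req_le.
  assert (Hrk : r * K - r > 0) by nra. assert (Hsr : sg * r - r > 0) by lra.
  unfold Rdiv. rewrite !Rpow_mult_distr, pow_inv. field.
  repeat split; nra.
Qed.

(* Local version of the growth condition: convexity of [log M] in [log r] in disguise. *)
Lemma growth_local (f f' : C -> C) (A B Cc r0 sg : R) : entire f f' -> (exists z1 z2, f z1 <> f z2) ->
  1 < A -> 1 < B -> 1 < Cc -> 1 < r0 -> growth f A B Cc r0 -> 1 < sg ->
  exists c R0, 0 < c /\ 1 < R0 /\ forall r, R0 <= r -> (1 + c) * ln (M f r) <= ln (M f (sg * r)).
Proof.
  intros Hf Hnc HA HB HC Hr0 Hg Hsg.
  destruct (growth_half f f' A B Cc r0 Hf Hnc HA HB HC Hr0 Hg) as [K [R1 [HK [HR1 Hhalf]]]].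
  destruct (M_gt_1 f f' r0 Hf Hnc) as [r1 [H1 [H01 HM]]].
  set (lK := ln K). assert (HlK : 0 < lK) by (unfold lK; rewrite <- ln_1; apply ln_increasing; lra).
  set (ls := ln sg). assert (Hls : 0 < ls) by (unfold ls; rewrite <- ln_1; apply ln_increasing; lra).
  set (q := sg / (sg - 1)). assert (Hq : 0 < q) by (apply Rdiv_lt_0_compat; lra).
  set (c := ls / (8 * lK)). assert (Hc : 0 < c) by (apply Rdiv_lt_0_compat; lra).
  set (e := ls + ln 2 + ln q).
  destruct (growth_unbounded f f' A B Cc r0 Hf Hnc HA HB HC Hr0 Hg (Rmax (4 * ln 2) (e / c))) as [R2 [HR2 Hbig]].
  exists c, (Rmax r1 (Rmax R1 R2)).
  pose proof (Rmax_l r1 (Rmax R1 R2)). pose proof (Rmax_r r1 (Rmax R1 R2)).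
  pose proof (Rmax_l R1 R2). pose proof (Rmax_r R1 R2).
  split; [exact Hc|]. split; [lra|]. intros r Hr.
  specialize (Hbig r ltac:(lra)). destruct (Hhalf r ltac:(lra)) as [HMk Hh]. assert (HMr := HM r ltac:(lra)).
  set (L := ln (M f r)) in *.
  pose proof (Rmax_l (4 * ln 2) (e / c)). pose proof (Rmax_r (4 * ln 2) (e / c)).
  assert (Hln2 : 0 < ln 2) by (rewrite <- ln_1; apply ln_increasing; lra).
  assert (HL : 0 < L) by lra.
  (* This [m] balances the two terms. As [ln (M f (r / K)) <= L/2] and [K^m <= exp (L/4)], the inner
     term is at most [M f r / 2]; the outer one gains [sg^m], which is at least [exp (2 c L - ls)].
     Half of the gain [2 c L] absorbs the constants collected in [e]. *)
  destruct (nfloor_ex (L / (4 * lK))) as [m [Hm1 Hm2]]; [apply Rdiv_le_0_compat; lra|].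
  assert (E := annulus_estimate f f' r K sg m Hf ltac:(lra) ltac:(lra) Hsg). fold q in E.
  assert (Hsm : sg * r >= r) by nra.
  assert (HMs : 1 < M f (sg * r)) by (apply HM; lra).
  assert (T : M f (r / K) * K ^ m / (K - 1) <= M f r / 2).
  { apply Rle_trans with (M f (r / K) * K ^ m).
    - unfold Rdiv. rewrite <- (Rmult_1_r (M f (r / K) * K ^ m)) at 2.
      apply Rmult_le_compat_l; [apply Rmult_le_pos; [lra | apply pow_le; lra]|].
      rewrite <- Rinv_1. apply Rinv_le_contravar; lra.
    - assert (P : 0 < K ^ m) by (apply pow_lt; lra).
      rewrite <- (exp_ln (M f (r / K) * K ^ m)) by (apply Rmult_lt_0_compat; lra).
      rewrite <- (exp_ln (M f r / 2)) by lra.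
      assert (Hle : ln (M f (r / K) * K ^ m) <= ln (M f r / 2)).
      { rewrite ln_mult by lra. rewrite ln_div by lra. rewrite ln_pow by lra. fold lK. fold L.
        assert (INR m * lK <= L / 4).
        { apply Rmult_le_compat_r with (r := lK) in Hm1; [|lra].
          replace (L / (4 * lK) * lK) with (L / 4) in Hm1 by (field; lra). exact Hm1. }
        lra. }
      destruct Hle as [Hlt | ->]; [left; apply exp_increasing, Hlt | lra]. }
  assert (E2 : M f r / 2 <= q * M f (sg * r) / sg ^ m) by lra.
  apply ln_mono in E2; [|lra].
  assert (Psm : 0 < sg ^ m) by (apply pow_lt; lra).
  rewrite !ln_div in E2 by (try apply Rmult_lt_0_compat; lra).
  rewrite ln_mult, ln_pow in E2 by lra. fold L in E2. fold ls in E2.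
  assert (Hm3 : (L / (4 * lK) - 1) * ls <= INR m * ls) by (apply Rmult_le_compat_r; lra).
  assert (Hce : e <= c * L).
  { apply Rmult_le_reg_l with (/ c); [apply Rinv_0_lt_compat, Hc|].
    rewrite <- Rmult_assoc, Rinv_l, Rmult_1_l by lra. unfold Rdiv in *. lra. }
  assert (Ec : L / (4 * lK) * ls = 2 * (c * L)) by (unfold c; field; lra).
  unfold e in Hce. lra.
Qed.

(** * Sums over a square lattice *)

Definition lsum {X : Type} (phi : X -> R) (l : list X) : R := fold_right (fun x s => phi x + s) 0 l.

Lemma lsum_le {X : Type} (phi psi : X -> R) (l : list X) :
  (forall x, In x l -> phi x <= psi x) -> lsum phi l <= lsum psi l.
Proof.
  induction l as [|x l IH]; intros H; simpl; [lra|].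
  apply Rplus_le_compat; [apply H; left; reflexivity | apply IH; intros; apply H; right; assumption].
Qed.

Lemma lsum_ext {X : Type} (phi psi : X -> R) (l : list X) :
  (forall x, In x l -> phi x = psi x) -> lsum phi l = lsum psi l.
Proof. intros H. apply Rle_antisym; apply lsum_le; intros x Hx; rewrite (H x Hx); lra. Qed.

Lemma lsum_plus {X : Type} (phi psi : X -> R) (l : list X) :
  lsum (fun x => phi x + psi x) l = lsum phi l + lsum psi l.
Proof. induction l as [|x l IH]; simpl; [ring | rewrite IH; ring]. Qed.

Lemma lsum_scal {X : Type} (c : R) (phi : X -> R) (l : list X) : lsum (fun x => c * phi x) l = c * lsum phi l.
Proof. induction l as [|x l IH]; simpl; [ring | rewrite IH; ring]. Qed.

Lemma lsum_const {X : Type} (c : R) (l : list X) : lsum (fun _ => c) l = INR (length l) * c.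
Proof.
  induction l as [|x l IH]; [simpl; ring|].
  change (lsum (fun _ => c) (x :: l)) with (c + lsum (fun _ => c) l). rewrite IH.
  change (length (x :: l)) with (S (length l)). rewrite S_INR. ring.
Qed.

Lemma lsum_nonneg {X : Type} (phi : X -> R) (l : list X) : (forall x, In x l -> 0 <= phi x) -> 0 <= lsum phi l.
Proof.
  intros H. replace 0 with (lsum (fun _ : X => 0) l) by (rewrite lsum_const; ring). apply lsum_le, H.
Qed.

Lemma lsum_bound {X : Type} (phi : X -> R) (l : list X) (K : R) :
  (forall x, In x l -> phi x <= K) -> lsum phi l <= INR (length l) * K.
Proof. intros H. rewrite <- lsum_const. apply lsum_le, H. Qed.

Lemma lsum_app {X : Type} (phi : X -> R) (l m : list X) : lsum phi (l ++ m) = lsum phi l + lsum phi m.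
Proof. induction l as [|x l IH]; simpl; [ring | rewrite IH; ring]. Qed.

Lemma lsum_map {X Y : Type} (phi : Y -> R) (g : X -> Y) (l : list X) :
  lsum phi (map g l) = lsum (fun x => phi (g x)) l.
Proof. induction l as [|x l IH]; simpl; [ring | rewrite IH; ring]. Qed.

Lemma lsum_swap {X Y : Type} (phi : X -> Y -> R) (l : list X) (m : list Y) :
  lsum (fun x => lsum (fun y => phi x y) m) l = lsum (fun y => lsum (fun x => phi x y) l) m.
Proof.
  induction l as [|x l IH]; simpl.
  - rewrite lsum_const. ring.
  - rewrite IH, <- lsum_plus. reflexivity.
Qed.

Lemma lsum_prod {X Y : Type} (phi : X * Y -> R) (l : list X) (m : list Y) :
  lsum phi (list_prod l m) = lsum (fun x => lsum (fun y => phi (x, y)) m) l.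
Proof.
  induction l as [|x l IH]; simpl; [ring|]. rewrite lsum_app, IH, lsum_map. reflexivity.
Qed.

Lemma lsum_ge_term {X : Type} (phi : X -> R) (l : list X) (x : X) :
  (forall y, In y l -> 0 <= phi y) -> In x l -> phi x <= lsum phi l.
Proof.
  induction l as [|y l IH]; intros H Hx; [destruct Hx|]. simpl.
  assert (0 <= lsum phi l) by (apply lsum_nonneg; intros; apply H; right; assumption).
  assert (0 <= phi y) by (apply H; left; reflexivity).
  destruct Hx as [-> | Hx]; [lra|].
  assert (phi x <= lsum phi l) by (apply IH; [intros; apply H; right; assumption | exact Hx]). lra.
Qed.

Lemma lsum_telescope (u : nat -> R) (s n : nat) :
  lsum (fun j => u (S j) - u j) (seq s n) = u (s + n)%nat - u s.
Proof.
  revert s. induction n as [|n IH]; intros s; simpl.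
  - rewrite Nat.add_0_r. ring.
  - rewrite IH. replace (S s + n)%nat with (s + S n)%nat by lia. ring.
Qed.

Definition indic (P : Prop) : R := if excluded_middle_informative P then 1 else 0.

Lemma indic_true (P : Prop) : P -> indic P = 1.
Proof. intros H. unfold indic. destruct (excluded_middle_informative P); [reflexivity | contradiction]. Qed.

Lemma indic_false (P : Prop) : ~ P -> indic P = 0.
Proof. intros H. unfold indic. destruct (excluded_middle_informative P); [contradiction | reflexivity]. Qed.

Lemma indic_bounds (P : Prop) : 0 <= indic P <= 1.
Proof. unfold indic. destruct (excluded_middle_informative P); lra. Qed.

Lemma count_diameter (P : nat -> Prop) (d : R) (s n : nat) : 0 <= d ->
  (forall j k, In j (seq s n) -> In k (seq s n) -> P j -> P k -> INR k - INR j <= d) ->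
  lsum (fun j => indic (P j)) (seq s n) <= d + 1.
Proof.
  intros Hd. revert s. induction n as [|n IH]; intros s H; [simpl; lra|].
  destruct (classic (P s)) as [Ps | Ns].
  - (* [s] is the least element, so all others lie in [s, s + d] *)
    assert (G : forall m t, (forall k, In k (seq t m) -> P k -> INR k - INR s <= d) ->
              lsum (fun j => indic (P j)) (seq t m) <= Rmax 0 (d + INR s - INR t + 1)).
    { induction m as [|m IHm]; intros t Ht; [simpl; apply Rmax_l|]. simpl.
      assert (B := IHm (S t) (fun k Hk => Ht k (or_intror Hk))). rewrite S_INR in B.
      destruct (classic (P t)) as [Pt | Nt].
      - rewrite (indic_true _ Pt). assert (L := Ht t (or_introl eq_refl) Pt).
        rewrite Rmax_right in B by lra. rewrite Rmax_right by lra. lra.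
      - rewrite (indic_false _ Nt). eapply Rle_trans; [|eapply Rle_trans; [exact B|]]; [lra|].
        apply Rle_max_compat_l. lra. }
    specialize (G (S n) s). rewrite Rmax_right in G by lra.
    eapply Rle_trans; [apply G | lra]. intros k Hk Pk. apply H; try assumption. left; reflexivity.
  - simpl. rewrite (indic_false _ Ns), Rplus_0_l. apply IH. intros j k Hj Hk. apply H; right; assumption.
Qed.

(** * Lattice points in boxes and in rotated rectangles *)

Definition lattice (N : nat) : list (nat * nat) := list_prod (seq 0 N) (seq 0 N).

Definition lpt (h : R) (jl : nat * nat) : C := (h * INR (fst jl), h * INR (snd jl)).

Lemma lattice_length (N : nat) : INR (length (lattice N)) = INR N * INR N.
Proof. unfold lattice. rewrite length_prod, length_seq, mult_INR. reflexivity. Qed.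

Lemma lpt_bound (h : R) (N : nat) (jl : nat * nat) : 0 <= h -> In jl (lattice N) -> Cmod (lpt h jl) <= 2 * (h * INR N).
Proof.
  intros Hh H. destruct jl as [j l]. apply in_prod_iff in H. destruct H as [H1 H2].
  apply in_seq in H1. apply in_seq in H2.
  assert (INR j <= INR N) by (apply le_INR; lia). assert (INR l <= INR N) by (apply le_INR; lia).
  pose proof (pos_INR j). pose proof (pos_INR l).
  eapply Rle_trans; [apply Cmod_le_sum|]. unfold lpt, Re, Im; simpl.
  rewrite !Rabs_pos_eq by (apply Rmult_le_pos; lra). nra.
Qed.

(** [d1] bounds the spread of the occupied columns, [d2] the spread within one column;
    [count_diameter] is applied to each. *)
Lemma box_count (P : nat -> nat -> Prop) (d1 d2 : R) (N : nat) : 0 <= d1 -> 0 <= d2 ->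
  (forall j k l m, P j k -> P l m -> INR l - INR j <= d1) ->
  (forall j k m, P j k -> P j m -> INR m - INR k <= d2) ->
  lsum (fun jl => indic (P (fst jl) (snd jl))) (lattice N) <= (d1 + 1) * (d2 + 1).
Proof.
  intros H1 H2 Hc Hr. unfold lattice. rewrite lsum_prod. simpl.
  apply Rle_trans with (lsum (fun j => (d2 + 1) * indic (exists k, P j k)) (seq 0 N)).
  - apply lsum_le. intros j _. destruct (classic (exists k, P j k)) as [E | E].
    + rewrite (indic_true _ E), Rmult_1_r. apply count_diameter; [exact H2|].
      intros k m _ _ Hk Hm. exact (Hr j k m Hk Hm).
    + rewrite (indic_false _ E). rewrite (lsum_ext _ (fun _ => 0)).
      * rewrite lsum_const. lra.
      * intros k _. apply indic_false. intros Hk. apply E. exists k. exact Hk.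
  - rewrite lsum_scal, Rmult_comm. apply Rmult_le_compat_r; [lra|].
    apply count_diameter; [exact H1|]. intros j l _ _ [k Hk] [m Hm]. exact (Hc j k l m Hk Hm).
Qed.

(** The lattice point in whose open cell of side [h] the point [a] lies. It is set apart because
    [1 / |z - a|] has no bound there; at most one point is lost for each zero. *)
Definition near (h : R) (a : C) (jl : nat * nat) : Prop :=
  Rabs (INR (fst jl) - Re a / h) < / 2 /\ Rabs (INR (snd jl) - Im a / h) < / 2.

Lemma near_count (h : R) (a : C) (N : nat) : lsum (fun jl => indic (near h a jl)) (lattice N) <= 1.
Proof.
  replace 1 with ((0 + 1) * (0 + 1)) by ring.
  assert (K : forall (a : R) (j k : nat), Rabs (INR j - a) < / 2 -> Rabs (INR k - a) < / 2 -> INR k - INR j <= 0).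
  { intros b j k Hj Hk. apply Rabs_def2 in Hj. apply Rabs_def2 in Hk.
    assert (Hlt : INR k < INR (S j)) by (rewrite S_INR; lra). apply INR_lt in Hlt.
    assert (INR k <= INR j) by (apply le_INR; lia). lra. }
  apply (box_count (fun j l => Rabs (INR j - Re a / h) < / 2 /\ Rabs (INR l - Im a / h) < / 2)); try lra.
  - intros j k l m [A1 _] [A2 _]. exact (K (Re a / h) j l A1 A2).
  - intros j k m [_ A1] [_ A2]. exact (K (Im a / h) k m A1 A2).
Qed.

(** [D] is the greatest length of a segment of direction [(u, v)] that fits into a box of sides [a]
    and [b]: the minimum of [a / |u|] and [b / |v|], with the degenerate directions treated apart.
    [D <= a + b] since [|u| + |v| >= 1]. *)
Lemma max_chord (u v a b : R) : 0 <= a -> 0 <= b -> u * u + v * v = 1 ->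
  exists D, 0 <= D /\ Rabs u * D <= a /\ Rabs v * D <= b /\ D <= a + b /\
    forall x, 0 <= x -> Rabs u * x <= a -> Rabs v * x <= b -> x <= D.
Proof.
  intros Ha Hb Huv. pose proof (Rabs_pos u) as Pu. pose proof (Rabs_pos v) as Pv.
  assert (H1 : 1 <= Rabs u + Rabs v).
  { assert (Rabs u * Rabs u + Rabs v * Rabs v = 1) by (rewrite <- !Rabs_mult, !Rabs_pos_eq; nra). nra. }
  assert (Hsum : forall x, 0 <= x -> Rabs u * x <= a -> Rabs v * x <= b -> x <= a + b) by (intros; nra).
  destruct (Req_dec (Rabs u) 0) as [Eu | Nu].
  - exists (b / Rabs v). assert (E : Rabs v * (b / Rabs v) = b) by (field; lra).
    assert (P : 0 <= b / Rabs v) by (apply Rdiv_le_0_compat; lra).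
    rewrite E, Eu. repeat split; try lra.
    + apply Hsum; try lra. rewrite Eu; lra.
    + intros x Hx _ Hv. apply Rmult_le_reg_l with (Rabs v); lra.
  - destruct (Req_dec (Rabs v) 0) as [Ev | Nv].
    + exists (a / Rabs u). assert (E : Rabs u * (a / Rabs u) = a) by (field; lra).
      assert (P : 0 <= a / Rabs u) by (apply Rdiv_le_0_compat; lra).
      rewrite E, Ev. repeat split; try lra.
      * apply Hsum; try lra. rewrite Ev; lra.
      * intros x Hx Hu _. apply Rmult_le_reg_l with (Rabs u); lra.
    + assert (E1 : Rabs u * (a / Rabs u) = a) by (field; lra).
      assert (E2 : Rabs v * (b / Rabs v) = b) by (field; lra).
      assert (P1 : 0 <= a / Rabs u) by (apply Rdiv_le_0_compat; lra).
      assert (P2 : 0 <= b / Rabs v) by (apply Rdiv_le_0_compat; lra).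
      set (D := Rmin (a / Rabs u) (b / Rabs v)).
      assert (D1 : D <= a / Rabs u) by apply Rmin_l. assert (D2 : D <= b / Rabs v) by apply Rmin_r.
      assert (D0 : 0 <= D) by (apply Rmin_glb; assumption).
      exists D.
      assert (F1 : Rabs u * D <= a) by (rewrite <- E1; apply Rmult_le_compat_l; lra).
      assert (F2 : Rabs v * D <= b) by (rewrite <- E2; apply Rmult_le_compat_l; lra).
      repeat split; try assumption; [apply Hsum; assumption|].
      intros x Hx Hu Hv. apply Rmin_glb.
      * apply Rmult_le_reg_l with (Rabs u); lra.
      * apply Rmult_le_reg_l with (Rabs v); lra.
Qed.

(** The lattice is rotated against the rectangle. Its occupied columns spread over a projection of
    length at most [E], but within one column only a chord of length at most [D] counts. As
    [E * D <= 2 a b], the leading term stays within twice the area even for thin rectangles, which a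
    bounding box along the lattice would not achieve. *)
Lemma rect_count (Q : rect) (p ze : C) (h : R) (N : nat) : 0 < h -> Cmod ze = 1 ->
  lsum (fun jl => indic (in_rect Q (p + ze * lpt h jl)%C)) (lattice N) <=
    2 * rect_area Q / (h * h) + 2 * (Rmax 0 (rx2 Q - rx1 Q) + Rmax 0 (ry2 Q - ry1 Q)) / h + 1.
Proof.
  intros Hh Hze. destruct Q as [x1 x2 y1 y2]. unfold rect_area, in_rect; simpl.
  set (a := Rmax 0 (x2 - x1)). set (b := Rmax 0 (y2 - y1)).
  assert (Ha : 0 <= a) by apply Rmax_l. assert (Hb : 0 <= b) by apply Rmax_l.
  assert (Ha2 : x2 - x1 <= a) by apply Rmax_r. assert (Hb2 : y2 - y1 <= b) by apply Rmax_r.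
  pose proof (Cmod_sqr ze) as Hz. rewrite Hze in Hz.
  destruct ze as [c s], p as [p1 p2]. unfold Re, Im in Hz; simpl in Hz.
  destruct (max_chord s c a b Ha Hb) as [D [D0 [D1 [D2 [D3 D4]]]]]; [lra|].
  set (E := Rabs c * a + Rabs s * b).
  pose proof (Rabs_pos c). pose proof (Rabs_pos s).
  assert (E0 : 0 <= E) by (unfold E; nra).
  apply Rle_trans with ((E / h + 1) * (D / h + 1)).
  - apply (box_count (fun j l =>
      (x1 <= fst ((p1, p2) + (c, s) * lpt h (j, l))%C <= x2) /\ (y1 <= snd ((p1, p2) + (c, s) * lpt h (j, l))%C <= y2))).
    + apply Rdiv_le_0_compat; lra.
    + apply Rdiv_le_0_compat; lra.
    + intros j k l m [A1 A2] [B1 B2]. unfold lpt in *. simpl in *.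
      apply Rmult_le_reg_l with h; [exact Hh|]. replace (h * (E / h)) with E by (field; lra).
      set (U := p1 + (c * (h * INR l) - s * (h * INR m)) - (p1 + (c * (h * INR j) - s * (h * INR k)))).
      set (V := p2 + (c * (h * INR m) + s * (h * INR l)) - (p2 + (c * (h * INR k) + s * (h * INR j)))).
      replace (h * (INR l - INR j)) with (c * U + s * V).
      2:{ unfold U, V. transitivity ((c * c + s * s) * (h * (INR l - INR j))); [ring | rewrite <- Hz; ring]. }
      assert (HU : Rabs U <= a) by (apply Rabs_le; unfold U; lra).
      assert (HV : Rabs V <= b) by (apply Rabs_le; unfold V; lra).
      eapply Rle_trans; [apply Rle_abs|]. eapply Rle_trans; [apply Rabs_triang|]. rewrite !Rabs_mult.
      unfold E. apply Rplus_le_compat; apply Rmult_le_compat_l; assumption.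
    + intros j k m [A1 A2] [B1 B2]. unfold lpt in *. simpl in *.
      destruct (Rle_dec (INR m - INR k) 0) as [L|L].
      { apply Rle_trans with 0; [exact L | apply Rdiv_le_0_compat; lra]. }
      apply Rmult_le_reg_l with h; [exact Hh|]. replace (h * (D / h)) with D by (field; lra).
      apply D4; [apply Rmult_le_pos; lra | |].
      * rewrite <- (Rabs_pos_eq (h * (INR m - INR k))) by (apply Rmult_le_pos; lra).
        rewrite <- Rabs_mult. apply Rabs_le. split; lra.
      * rewrite <- (Rabs_pos_eq (h * (INR m - INR k))) by (apply Rmult_le_pos; lra).
        rewrite <- Rabs_mult. apply Rabs_le. split; lra.
  - assert (P1 : E * D <= 2 * (a * b)) by (unfold E; nra).
    assert (Hc1 : Rabs c <= 1) by (apply Rabs_le; nra). assert (Hs1 : Rabs s <= 1) by (apply Rabs_le; nra).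
    assert (P2 : E + D <= 2 * (a + b)) by (unfold E; nra).
    replace ((E / h + 1) * (D / h + 1)) with (E * D / (h * h) + (E + D) / h + 1) by (field; lra).
    assert (0 < / (h * h)) by (apply Rinv_0_lt_compat; nra). assert (0 < / h) by (apply Rinv_0_lt_compat; lra).
    unfold Rdiv. apply Rplus_le_compat_r, Rplus_le_compat; apply Rmult_le_compat_r; lra.
Qed.

(** * Lattice sums of the kernel 1/|z - a| *)

Definition ssqrt (x : R) : R := if Rle_dec 0 x then sqrt x else - sqrt (- x).

Lemma ssqrt_mono (x y : R) : x <= y -> ssqrt x <= ssqrt y.
Proof.
  intros H. unfold ssqrt. destruct (Rle_dec 0 x), (Rle_dec 0 y); try lra.
  - apply sqrt_le_1_alt, H.
  - pose proof (sqrt_pos (- x)). pose proof (sqrt_pos y). lra.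
  - apply Ropp_le_contravar, sqrt_le_1_alt. lra.
Qed.

Lemma ssqrt_opp (x : R) : ssqrt (- x) = - ssqrt x.
Proof.
  unfold ssqrt. destruct (Rle_dec 0 (- x)), (Rle_dec 0 x); rewrite ?Ropp_involutive; try reflexivity; try lra.
  replace x with 0 by lra. rewrite Ropp_0, sqrt_0. lra.
Qed.

Lemma ssqrt_pos (x : R) : 0 <= x -> ssqrt x = sqrt x.
Proof. intros H. unfold ssqrt. destruct (Rle_dec 0 x); [reflexivity | lra]. Qed.

Definition clamp (K x : R) : R := Rmax (- K) (Rmin K x).

Lemma clamp_mono (K x y : R) : x <= y -> clamp K x <= clamp K y.
Proof. intros H. unfold clamp. apply Rle_max_compat_l, Rle_min_compat_l, H. Qed.

Lemma clamp_id (K x : R) : - K <= x <= K -> clamp K x = x.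
Proof. intros H. unfold clamp. rewrite Rmin_right, Rmax_right by lra. reflexivity. Qed.

Lemma clamp_bound (K x : R) : 0 <= K -> - K <= clamp K x <= K.
Proof. intros H. unfold clamp. split; [apply Rmax_l | apply Rmax_lub; [lra | apply Rmin_l]]. Qed.

(* Kernel of the one-dimensional sums: [|x|^(-1/2)], truncated near [0] and beyond [m]. *)
Definition isq (m x : R) : R := if Rle_dec (Rabs x) m then / sqrt (Rmax (Rabs x) (/ 4)) else 0.

Lemma isq_nonneg (m x : R) : 0 <= isq m x.
Proof.
  unfold isq. destruct (Rle_dec (Rabs x) m); [|lra]. left. apply Rinv_0_lt_compat, sqrt_lt_R0.
  eapply Rlt_le_trans; [|apply Rmax_r]. lra.
Qed.

(** The difference of the roots [p] and [q] is [1 / (p + q)], and [p + q <= 2 s] by concavity. *)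
Lemma sqrt_diff (x : R) : / 2 <= x -> / sqrt x <= 3 * (sqrt (x + / 2) - sqrt (x - / 2)).
Proof.
  intros Hx. set (s := sqrt x). set (p := sqrt (x + / 2)). set (q := sqrt (x - / 2)).
  assert (Hs : 0 < s) by (apply sqrt_lt_R0; lra). assert (Hp : 0 < p) by (apply sqrt_lt_R0; lra).
  assert (Hq : 0 <= q) by apply sqrt_pos.
  assert (Es : s * s = x) by (apply sqrt_sqrt; lra).
  assert (Ep : p * p = x + / 2) by (apply sqrt_sqrt; lra).
  assert (Eq : q * q = x - / 2) by (apply sqrt_sqrt; lra).
  assert (Hpq : p + q <= 2 * s).
  { apply Rnot_lt_le. intros L. pose proof (Rle_0_sqr (p - q)) as S. unfold Rsqr in S.
    assert (2 * s * (2 * s) < (p + q) * (p + q)) by (apply Rmult_le_0_lt_compat; lra). nra. }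
  apply Rmult_le_reg_l with s; [exact Hs|]. rewrite Rinv_r by lra. nra.
Qed.

(* A telescoping majorant: an odd primitive-like function, kept bounded by clamping. *)
Lemma isq_step (m x : R) : 1 <= m ->
  isq m x <= 3 * ssqrt (clamp (m + / 2) (x + / 2)) - 3 * ssqrt (clamp (m + / 2) (x - / 2)).
Proof.
  intros Hm. unfold isq. destruct (Rle_dec (Rabs x) m) as [H|H].
  2:{ assert (ssqrt (clamp (m + / 2) (x - / 2)) <= ssqrt (clamp (m + / 2) (x + / 2)))
        by (apply ssqrt_mono, clamp_mono; lra). lra. }
  assert (Hx : - m <= x <= m) by (apply Rabs_le_between; exact H).
  rewrite !clamp_id by lra.
  destruct (Rle_dec (/ 2) x) as [H1|H1]; [|destruct (Rle_dec x (- / 2)) as [H2|H2]].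
  - rewrite Rabs_pos_eq, Rmax_left, !ssqrt_pos by lra. pose proof (sqrt_diff x H1). lra.
  - rewrite Rabs_left, Rmax_left by lra.
    replace (x + / 2) with (- (- x - / 2)) by ring. replace (x - / 2) with (- (- x + / 2)) by ring.
    rewrite !ssqrt_opp, !ssqrt_pos by lra. pose proof (sqrt_diff (- x) ltac:(lra)). lra.
  - replace (x - / 2) with (- (/ 2 - x)) by ring. rewrite ssqrt_opp, !ssqrt_pos by lra.
    set (p := sqrt (x + / 2)). set (q := sqrt (/ 2 - x)).
    assert (Hp : 0 <= p) by apply sqrt_pos. assert (Hq : 0 <= q) by apply sqrt_pos.
    assert (Ep : p * p = x + / 2) by (apply sqrt_sqrt; lra).
    assert (Eq : q * q = / 2 - x) by (apply sqrt_sqrt; lra).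
    assert (Hpq : 1 <= p + q) by nra.
    assert (Hi : / sqrt (Rmax (Rabs x) (/ 4)) <= 2).
    { replace 2 with (/ / 2) by field. apply Rinv_le_contravar; [lra|].
      rewrite <- (sqrt_square (/ 2)) by lra. apply sqrt_le_1_alt. eapply Rle_trans; [|apply Rmax_r]. lra. }
    lra.
Qed.

Lemma isq_sum (m al : R) (N : nat) : 1 <= m ->
  lsum (fun j => isq m (INR j - al)) (seq 0 N) <= 6 * sqrt (m + / 2).
Proof.
  intros Hm. set (u := fun j : nat => 3 * ssqrt (clamp (m + / 2) (INR j - al - / 2))).
  apply Rle_trans with (lsum (fun j => u (S j) - u j) (seq 0 N)).
  - apply lsum_le. intros j _. unfold u. rewrite S_INR.
    replace (INR j + 1 - al - / 2) with (INR j - al + / 2) by lra. apply isq_step, Hm.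
  - rewrite lsum_telescope. unfold u.
    destruct (clamp_bound (m + / 2) (INR (0 + N) - al - / 2) ltac:(lra)) as [_ A1].
    destruct (clamp_bound (m + / 2) (INR 0 - al - / 2) ltac:(lra)) as [A2 _].
    apply ssqrt_mono in A1. apply ssqrt_mono in A2. rewrite ssqrt_opp in A2.
    rewrite (ssqrt_pos (m + / 2)) in A1, A2 by lra. lra.
Qed.

(** [|x + i y|^2 >= |x| |y|] separates the variables, so that a double sum becomes a product.
    Truncation at 1/4 does no harm because one of the coordinates is at least 1/2 in absolute
    value. *)
Lemma inv_Cmod_le_isq (m x y : R) : Cmod (x, y) <= m -> ~ (Rabs x < / 2 /\ Rabs y < / 2) ->
  / Cmod (x, y) <= isq m x * isq m y.
Proof.
  intros Hm Hn. pose proof (re_le_Cmod (x, y)) as Rx. pose proof (im_le_Cmod (x, y)) as Ry.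
  unfold Re, Im in Rx, Ry; simpl in Rx, Ry.
  unfold isq. destruct (Rle_dec (Rabs x) m); [|lra]. destruct (Rle_dec (Rabs y) m); [|lra].
  pose proof (Rabs_pos x) as Px. pose proof (Rabs_pos y) as Py.
  assert (HX : / 4 <= Rmax (Rabs x) (/ 4)) by apply Rmax_r.
  assert (HY : / 4 <= Rmax (Rabs y) (/ 4)) by apply Rmax_r.
  rewrite <- Rinv_mult, <- sqrt_mult by lra.
  apply Rinv_le_contravar; [apply sqrt_lt_R0; nra|].
  unfold Cmod; simpl fst; simpl snd. apply sqrt_le_1_alt.
  rewrite <- (pow2_abs x), <- (pow2_abs y).
  assert (Hor : / 2 <= Rabs x \/ / 2 <= Rabs y).
  { destruct (Rlt_dec (Rabs x) (/ 2)); [|left; lra]. right. apply Rnot_lt_le. intros L. apply Hn. split; assumption. }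
  unfold Rmax. destruct (Rle_dec (Rabs x) (/ 4)), (Rle_dec (Rabs y) (/ 4)); nra.
Qed.

Definition sing (h de : R) (a : C) (jl : nat * nat) : R :=
  if excluded_middle_informative (Cmod (lpt h jl - a) <= de /\ ~ near h a jl)
  then / Cmod (lpt h jl - a) else 0.

Lemma sing_nonneg (h de : R) (a : C) (jl : nat * nat) : 0 <= sing h de a jl.
Proof.
  unfold sing. destruct (excluded_middle_informative _) as [_ | _]; [|lra].
  destruct (Req_dec (Cmod (lpt h jl - a)) 0) as [E | N]; [rewrite E, Rinv_0; lra|].
  left. apply Rinv_0_lt_compat. pose proof (Cmod_ge_0 (lpt h jl - a)). lra.
Qed.

(** The discrete form of the integral of [1 / |z - a|] over a disc of radius [de], which is
    [2 PI de]. The two one-dimensional sums give [36 (m + 1/2) / h <= 54 m / h] with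
    [m = de / h]. *)
Lemma singular_sum (a : C) (h de : R) (N : nat) : 0 < h -> h <= de ->
  lsum (sing h de a) (lattice N) <= 54 * de / (h * h).
Proof.
  intros Hh Hde. set (m := de / h).
  assert (Hm : 1 <= m) by (unfold m; apply Rmult_le_reg_r with h; [lra|]; field_simplify; lra).
  set (al := Re a / h). set (be := Im a / h).
  apply Rle_trans with (lsum (fun jl => / h * (isq m (INR (fst jl) - al) * isq m (INR (snd jl) - be))) (lattice N)).
  - apply lsum_le. intros [j l] _. unfold sing, near. simpl. fold al be.
    destruct (excluded_middle_informative _) as [[H1 H2] | H].
    + assert (E : (lpt h (j, l) - a)%C = (RtoC h * ((INR j - al)%R, (INR l - be)%R))%C).
      { unfold lpt, al, be. destruct a as [a1 a2]. unfold Re, Im, Cminus, Cplus, Copp, Cmult, RtoC; simpl.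
        f_equal; field; lra. }
      rewrite E in *. rewrite Cmod_mult, Cmod_R, Rabs_pos_eq in * by lra.
      rewrite Rinv_mult. apply Rmult_le_compat_l; [left; apply Rinv_0_lt_compat, Hh|].
      apply inv_Cmod_le_isq; [|exact H2].
      unfold m. apply Rmult_le_reg_l with h; [lra|]. replace (h * (de / h)) with de by (field; lra). exact H1.
    + apply Rmult_le_pos; [left; apply Rinv_0_lt_compat, Hh|]. apply Rmult_le_pos; apply isq_nonneg.
  - rewrite lsum_scal. unfold lattice. rewrite lsum_prod. simpl.
    rewrite (lsum_ext _ (fun j => lsum (fun l => isq m (INR l - be)) (seq 0 N) * isq m (INR j - al))).
    2:{ intros j _. rewrite <- (Rmult_comm (isq m (INR j - al))), <- lsum_scal. reflexivity. }
    rewrite lsum_scal.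
    pose proof (isq_sum m al N Hm) as S1. pose proof (isq_sum m be N Hm) as S2.
    assert (N1 : 0 <= lsum (fun j => isq m (INR j - al)) (seq 0 N)) by (apply lsum_nonneg; intros; apply isq_nonneg).
    assert (N2 : 0 <= lsum (fun j => isq m (INR j - be)) (seq 0 N)) by (apply lsum_nonneg; intros; apply isq_nonneg).
    assert (Ss : sqrt (m + / 2) * sqrt (m + / 2) = m + / 2) by (apply sqrt_sqrt; lra).
    pose proof (sqrt_pos (m + / 2)).
    apply Rle_trans with (/ h * (54 * m)).
    + apply Rmult_le_compat_l; [left; apply Rinv_0_lt_compat, Hh|].
      apply Rle_trans with ((6 * sqrt (m + / 2)) * (6 * sqrt (m + / 2))).
      * apply Rmult_le_compat; assumption.
      * nra.
    + apply Req_le. unfold m. field. lra.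
Qed.

(** * Zeros and average gradient *)

Definition cprod (l : list C) (z : C) : C := fold_right (fun a acc => (z - a) * acc)%C 1%C l.

Lemma holo_fold (phi : C -> C -> C) (l : list C) (z : C) : (forall a, holo_at (phi a) z) ->
  holo_at (fun z => fold_right (fun a acc => phi a z * acc)%C 1%C l) z.
Proof.
  intros H. induction l as [|a l IH]; simpl; [apply holo_const|].
  apply (holo_mult (phi a)); [apply H | exact IH].
Qed.

Lemma cprod_upper (l : list C) (w : C) (r : R) : (forall a, In a l -> Cmod (a - w) <= r) ->
  Cmod (cprod l w) <= r ^ length l.
Proof.
  induction l as [|a l IH]; intros H; simpl; [rewrite Cmod_1; lra|].
  rewrite Cmod_mult. apply Rmult_le_compat; try apply Cmod_ge_0.
  - rewrite Cmod_sub_sym. apply H. left; reflexivity.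
  - apply IH. intros b Hb. apply H. right; exact Hb.
Qed.

Lemma cprod_lower (l : list C) (z : C) (r : R) : 0 <= r -> (forall a, In a l -> r <= Cmod (z - a)) ->
  r ^ length l <= Cmod (cprod l z).
Proof.
  intros Hr. induction l as [|a l IH]; intros H; simpl; [rewrite Cmod_1; lra|].
  rewrite Cmod_mult. apply Rmult_le_compat; [exact Hr | apply pow_le, Hr | |].
  - apply H. left; reflexivity.
  - apply IH. intros b Hb. apply H. right; exact Hb.
Qed.

(** On the circle [rho^2 = u conj u]: a Blaschke factor has modulus 1 there. *)
Lemma blaschke_modulus (u b : C) (rho : R) : 0 < rho -> Cmod u = rho ->
  Cmod ((RtoC (rho * rho) - Cconj b * u) / RtoC rho) = Cmod (u - b).
Proof.
  intros Hr Hu.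
  assert (Hrc : RtoC rho <> 0%C) by (intros E; apply RtoC_inj in E; lra).
  assert (E : RtoC (rho * rho) = (Cconj u * u)%C).
  { rewrite Cmult_comm, <- Cmod2_conj, Hu. f_equal. ring. }
  rewrite E. replace (Cconj u * u - Cconj b * u)%C with (Cconj (u - b) * u)%C by (rewrite Cminus_conj; ring).
  rewrite Cmod_div by exact Hrc. rewrite Cmod_mult, Cmod_conj, Hu, Cmod_R, Rabs_pos_eq by lra. field. lra.
Qed.

(** Each factor [z - a] is replaced by its Blaschke partner, which has the same modulus on
    [|z - w| = 2 r] but the value [2 r] at [w], where [|w - a| <= r]. So every zero gains a factor
    of 2 in the maximum principle. *)
Lemma jensen_bound (g g' : C -> C) (l : list C) (w : C) (r K : R) : 0 < r -> entire g g' ->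
  (forall a, In a l -> Cmod (a - w) <= r) ->
  (forall z, Cmod (z - w) = 2 * r -> Cmod (cprod l z * g z) <= K) ->
  2 ^ length l * Cmod (cprod l w * g w) <= K.
Proof.
  intros Hr Hg Hl HK. set (rho := 2 * r).
  set (bl := fun z : C => fold_right (fun a acc =>
    ((RtoC (rho * rho) - Cconj (a - w) * (z - w)) / RtoC rho) * acc)%C 1%C l).
  assert (Hrc : RtoC rho <> 0%C) by (intros E; apply RtoC_inj in E; unfold rho in E; lra).
  assert (Hbl : forall z, holo_at bl z).
  { intros z. unfold bl.
    apply (holo_fold (fun a z => (RtoC (rho * rho) - Cconj (a - w) * (z - w)) / RtoC rho)%C).
    intros a. apply holo_div; [|apply holo_const | exact Hrc].
    apply holo_minus; [apply holo_const|]. apply holo_mult; [apply holo_const|].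
    holo_tac. }
  assert (Hmod : forall z, Cmod (z - w) = rho -> Cmod (bl z) = Cmod (cprod l z)).
  { intros z Hz. unfold bl, cprod. clear -Hz Hr. induction l as [|a l IH]; simpl; [reflexivity|].
    rewrite !Cmod_mult, IH, blaschke_modulus by (unfold rho in *; lra). f_equal. f_equal. ring. }
  assert (Hw : Cmod (bl w) = rho ^ length l).
  { unfold bl. clear -Hr Hrc. induction l as [|a l IH]; simpl; [apply Cmod_1|].
    rewrite Cmod_mult, IH. f_equal.
    replace ((RtoC (rho * rho) - Cconj (a - w) * (w - w)) / RtoC rho)%C with (RtoC rho).
    2:{ rewrite RtoC_mult. field. exact Hrc. }
    rewrite Cmod_R. apply Rabs_pos_eq. unfold rho. lra. }
  assert (B : Cmod (bl w * g w) <= K).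
  { apply (max_modulus (fun z => bl z * g z)%C w rho K w).
    - replace (w - w)%C with (RtoC 0) by ring. rewrite Cmod_0. unfold rho. lra.
    - intros z. apply holo_mult; [apply Hbl | apply (entire_holo g g'), Hg].
    - intros z Hz. rewrite Cmod_mult, (Hmod z Hz), <- Cmod_mult. apply HK, Hz. }
  rewrite Cmod_mult, Hw in B. rewrite Cmod_mult.
  pose proof (cprod_upper l w r Hl) as U.
  eapply Rle_trans; [|exact B]. unfold rho. rewrite Rpow_mult_distr, Rmult_assoc.
  apply Rmult_le_compat_l; [apply pow_le; lra|]. apply Rmult_le_compat_r; [apply Cmod_ge_0 | exact U].
Qed.

(** Zeros are divided out one at a time, at most [n] of them. The alternative in the conclusion
    avoids proving beforehand that they are finite in number: for large [n], [jensen_bound] rules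
    out the first case. *)
Lemma zero_extraction (f f' : C -> C) (w : C) (r : R) (n : nat) : entire f f' ->
  exists l g g', entire g g' /\ (forall z, f z = (cprod l z * g z)%C) /\
    (forall a, In a l -> Cmod (a - w) <= r) /\
    (length l = n \/ forall z, Cmod (z - w) <= r -> g z <> 0%C).
Proof.
  intros Hf. induction n as [|n [l [g [g' [Hg [E [Hl Hor]]]]]]].
  - exists [], f, f'. repeat split; try assumption.
    + intros z. unfold cprod; simpl. ring.
    + intros a [].
    + left; reflexivity.
  - destruct Hor as [Hn | Hz]; [|exists l, g, g'; repeat split; try assumption; right; exact Hz].
    destruct (classic (exists a, Cmod (a - w) <= r /\ g a = 0%C)) as [[a [Ha Ea]] | Hno].
    + destruct (entire_divide g g' a Hg Ea) as [k [k' [Hk Ek]]].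
      exists (a :: l), k, k'. repeat split.
      * exact Hk.
      * intros z. rewrite E, Ek. unfold cprod; simpl. ring.
      * intros b [<- | Hb]; [exact Ha | apply Hl, Hb].
      * left. simpl. rewrite Hn. reflexivity.
    + exists l, g, g'. repeat split; try assumption. right. intros z Hz Eg. apply Hno. exists z. split; assumption.
Qed.

Lemma cder_cprod (l : list C) (g g' : C -> C) (z : C) : entire g g' -> (forall a, In a l -> (z - a)%C <> 0%C) -> g z <> 0%C ->
  cder (fun z => cprod l z * g z)%C z
    (cprod l z * g z * (fold_right (fun a acc => / (z - a) + acc)%C 0%C l + g' z / g z))%C.
Proof.
  intros Hg Hl Hgz. induction l as [|a l IH].
  - unfold cprod; simpl. apply (cder_ext g); [intros u; ring|].
    replace (1 * g z * (0 + g' z / g z))%C with (g' z) by (field; exact Hgz). apply Hg.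
  - apply (cder_ext (fun u => (u - a) * (cprod l u * g u))%C).
    { intros u. unfold cprod; simpl. ring. }
    assert (Hza : (z - a)%C <> 0%C) by (apply Hl; left; reflexivity).
    set (S := fold_right (fun a acc => / (z - a) + acc)%C 0%C l) in *.
    assert (I := IH (fun b Hb => Hl b (or_intror Hb))).
    assert (J := cder_mult (fun u => u - a)%C (fun u => cprod l u * g u)%C z _ _
      (cder_minus _ _ z _ _ (cder_id z) (cder_const a z)) I).
    change (cprod (a :: l) z) with ((z - a) * cprod l z)%C.
    change (fold_right (fun b acc => / (z - b) + acc)%C 0%C (a :: l)) with (/ (z - a) + S)%C.
    simpl in J.
    replace ((z - a) * cprod l z * g z * (/ (z - a) + S + g' z / g z))%C with
      ((1 - 0) * (cprod l z * g z) + (z - a) * (cprod l z * g z * (S + g' z / g z)))%C; [exact J|].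
    field. split; assumption.
Qed.

Definition inv_dist (l : list C) (z : C) : R := lsum (fun a => / Cmod (z - a)) l.

Lemma cprod_neq_0 (l : list C) (z : C) : (forall a, In a l -> (z - a)%C <> 0%C) -> cprod l z <> 0%C.
Proof.
  induction l as [|a l IH]; intros H; unfold cprod; simpl; [exact C1_nz|].
  apply Cmult_neq_0; [apply H; left; reflexivity | apply IH; intros b Hb; apply H; right; exact Hb].
Qed.

Lemma cprod_root (l : list C) (a : C) : In a l -> cprod l a = 0%C.
Proof.
  induction l as [|b l IH]; intros H; [destruct H|]. unfold cprod; simpl.
  destruct H as [-> | H]; [ring|]. fold (cprod l a). rewrite (IH H). ring.
Qed.

(** For [n] beyond the bound of [jensen_bound], all zeros in the disc are collected in [l]. The
    cofactor [g] then has none there, and [log_deriv_bound_disc] applies to it. *)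
Lemma local_log_derivative (f f' : C -> C) (w : C) (r K : R) : 0 < r -> entire f f' -> f w <> 0%C ->
  (forall z, Cmod (z - w) = 2 * r -> Cmod (f z) <= K) ->
  exists l : list C,
    INR (length l) * ln 2 <= ln K - ln (Cmod (f w)) /\
    (forall z, Cmod (z - w) <= r / 2 -> ~ In z l -> f z <> 0%C) /\
    (forall a, In a l -> f a = 0%C /\ Cmod (a - w) <= r) /\
    (forall z, Cmod (z - w) <= r / 2 -> f z <> 0%C ->
       Cmod (f' z / f z) <= inv_dist l z + 4 * exp 2 / r * (ln K - ln (Cmod (f w)))).
Proof.
  intros Hr Hf Hw HK.
  pose proof (proj1 (Cmod_gt_0 _) Hw) as Hwp.
  assert (HKw : Cmod (f w) <= K).
  { apply (max_modulus f w (2 * r) K w); [|intros; apply (entire_holo f f'), Hf | exact HK].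
    replace (w - w)%C with (RtoC 0) by ring. rewrite Cmod_0. lra. }
  destruct (pow_ge_exists 2 (K / Cmod (f w) + 1)) as [n Hn]; [lra|].
  destruct (zero_extraction f f' w r n Hf) as [l [g [g' [Hg [E [Hl Hor]]]]]].
  assert (J : 2 ^ length l * Cmod (f w) <= K).
  { rewrite E. apply (jensen_bound g g' l w r K Hr Hg Hl). intros z Hz. rewrite <- E. apply HK, Hz. }
  assert (Hgz : forall z, Cmod (z - w) <= r -> g z <> 0%C).
  { destruct Hor as [Hlen | H]; [|exact H]. exfalso. rewrite Hlen in J.
    apply Rmult_le_compat_r with (r := Cmod (f w)) in Hn; [|lra].
    replace ((K / Cmod (f w) + 1) * Cmod (f w)) with (K + Cmod (f w)) in Hn by (field; lra). lra. }
  assert (Hne : forall z, f z <> 0%C -> forall a, In a l -> (z - a)%C <> 0%C).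
  { intros z Hz a Ha Ez. apply Hz. apply Csub_0_eq in Ez. subst z. rewrite E, cprod_root by exact Ha. ring. }
  exists l. split; [|split; [|split]].
  - rewrite <- ln_pow by lra. apply ln_mono in J; [|apply Rmult_lt_0_compat; [apply pow_lt; lra | exact Hwp]].
    rewrite ln_mult in J by (try apply pow_lt; lra). lra.
  - intros z Hz Hin. rewrite E. apply Cmult_neq_0; [|apply Hgz; lra].
    apply cprod_neq_0. intros a Ha Ez. apply Hin. apply Csub_0_eq in Ez. subst z. exact Ha.
  - intros a Ha. split; [rewrite E, cprod_root by exact Ha; ring | apply Hl, Ha].
  - intros z Hz Hfz.
    assert (D := cder_cprod l g g' z Hg (Hne z Hfz) (Hgz z ltac:(lra))).
    assert (Ed : f' z = (f z * (fold_right (fun a acc => / (z - a) + acc)%C 0%C l + g' z / g z))%C).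
    { rewrite E. apply (cder_unique f z); [apply Hf|]. apply (cder_ext (fun z => cprod l z * g z)%C); [|exact D].
      intros u. symmetry. apply E. }
    rewrite Ed. set (S := fold_right (fun a acc => / (z - a) + acc)%C 0%C l).
    replace (f z * (S + g' z / g z) / f z)%C with (S + g' z / g z)%C.
    2:{ field. split; [apply Hgz; lra | exact Hfz]. }
    eapply Rle_trans; [apply Cmod_triangle|]. apply Rplus_le_compat.
    + unfold S, inv_dist. assert (Hn2 := Hne z Hfz). clear -Hn2. induction l as [|a l IH]; simpl; [rewrite Cmod_0; lra|].
      eapply Rle_trans; [apply Cmod_triangle|]. apply Rplus_le_compat.
      * rewrite Cmod_inv by (apply Hn2; left; reflexivity). lra.
      * apply IH. intros b Hb. apply Hn2. right; exact Hb.
    (* On the outer circle [|cprod l|] is at least [r ^ length l], at [w] it is at most that. The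
       powers of [r] cancel, so the oscillation of [ln |g|] obeys the same bound [ln K - ln |f w|]
       as that of [ln |f|]. *)
    + assert (Hrn : 0 < r ^ length l) by (apply pow_lt, Hr).
      assert (HKp : 0 < K) by lra.
      assert (Hgb : forall u, Cmod (u - w) <= 2 * r -> Cmod (g u) <= K / r ^ length l).
      { intros u Hu. apply (max_modulus g w (2 * r)); [exact Hu | intros; apply (entire_holo g g'), Hg |].
        intros v Hv. apply Rmult_le_reg_l with (r ^ length l); [exact Hrn|].
        replace (r ^ length l * (K / r ^ length l)) with K by (field; lra).
        eapply Rle_trans; [|apply (HK v Hv)]. rewrite E, Cmod_mult.
        apply Rmult_le_compat_r; [apply Cmod_ge_0|]. apply cprod_lower; [lra|]. intros a Ha.
        pose proof (Cmod_rev_triangle (v - w) (a - w)) as T. specialize (Hl a Ha).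
        replace (v - w - (a - w))%C with (v - a)%C in T by ring. lra. }
      assert (Hgw : Cmod (f w) / r ^ length l <= Cmod (g w)).
      { apply Rmult_le_reg_l with (r ^ length l); [exact Hrn|].
        replace (r ^ length l * (Cmod (f w) / r ^ length l)) with (Cmod (f w)) by (field; lra).
        rewrite E, Cmod_mult. apply Rmult_le_compat_r; [apply Cmod_ge_0 | apply cprod_upper, Hl]. }
      eapply Rle_trans; [apply (log_deriv_bound_disc g g' w (ln (K / r ^ length l)) r Hr Hg)|].
      * intros u Hu. apply Hgz. lra.
      * intros u Hu. apply ln_mono; [apply Cmod_gt_0, Hgz; lra | apply Hgb; lra].
      * exact Hz.
      * apply Rmult_le_compat_l.
        -- apply Rdiv_le_0_compat; [|exact Hr]. pose proof (exp_pos 2). lra.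
        -- apply ln_mono in Hgw; [|apply Rdiv_lt_0_compat; assumption].
           rewrite ln_div in Hgw by assumption. rewrite ln_div by assumption. lra.
Qed.

(* Length of the gradient of [1/2 log(|f|^2 + ka^2)]. *)
Definition grad (f f' : C -> C) (ka : R) (z : C) : R :=
  Cmod (f z) * Cmod (f' z) / (Cmod (f z) * Cmod (f z) + ka * ka).

Lemma grad_line (f f' : C -> C) (ka : R) (a b : C) (t : R) : 0 < ka -> entire f f' ->
  exists D, is_derive (fun s : R => / 2 * ln (Cmod (f (a + RtoC s * b)%C) * Cmod (f (a + RtoC s * b)%C) + ka * ka)) t D /\
    Rabs D <= Cmod b * grad f f' ka (a + RtoC t * b)%C.
Proof.
  intros Hka Hf. set (z := (a + RtoC t * b)%C).
  destruct (cder_line f a b (f' z) t (Hf z)) as [Hu Hv].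
  exists ((Re (f z) * Re (f' z * b)%C + Im (f z) * Im (f' z * b)%C) / (Cmod (f z) * Cmod (f z) + ka * ka)).
  assert (Hp : 0 < Cmod (f z) * Cmod (f z) + ka * ka) by (pose proof (Cmod_ge_0 (f z)); nra).
  split.
  - apply (is_derive_ext (fun s : R => / 2 * ln (Re (f (a + RtoC s * b)%C) * Re (f (a + RtoC s * b)%C)
      + Im (f (a + RtoC s * b)%C) * Im (f (a + RtoC s * b)%C) + ka * ka))).
    { intros s. rewrite Cmod_sqr. reflexivity. }
    rewrite Cmod_sqr. rewrite Cmod_sqr in Hp. unfold z in *.
    set (u := fun s : R => Re (f (a + RtoC s * b)%C)) in *. set (v := fun s : R => Im (f (a + RtoC s * b)%C)) in *.
    change (Re (f (a + RtoC t * b)%C)) with (u t) in *. change (Im (f (a + RtoC t * b)%C)) with (v t) in *.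
    change (is_derive (fun s => / 2 * ln (u s * u s + v s * v s + ka * ka)) t
      ((u t * Re (f' (a + RtoC t * b)%C * b)%C + v t * Im (f' (a + RtoC t * b)%C * b)%C) / (u t * u t + v t * v t + ka * ka))).
    revert Hu Hv. generalize (Re (f' (a + RtoC t * b)%C * b)%C) (Im (f' (a + RtoC t * b)%C * b)%C).
    intros du dv Hu Hv. revert Hp. clearbody u v. intros Hp. evar_last.
    + auto_derive; [|reflexivity].
      repeat split; try exact Hp; try (exists du; exact Hu); exists dv; exact Hv.
    + replace (Derive (fun x : R => u x) t) with du by (symmetry; apply is_derive_unique; exact Hu).
      replace (Derive (fun x : R => v x) t) with dv by (symmetry; apply is_derive_unique; exact Hv).
      field. lra.
  - unfold Rdiv at 1. rewrite Rabs_mult, Rabs_inv, (Rabs_pos_eq (Cmod (f z) * Cmod (f z) + ka * ka)) by lra.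
    unfold grad. apply Rmult_le_reg_r with (Cmod (f z) * Cmod (f z) + ka * ka); [exact Hp|].
    rewrite Rmult_assoc, Rinv_l, Rmult_1_r by lra.
    replace (Cmod b * (Cmod (f z) * Cmod (f' z) / (Cmod (f z) * Cmod (f z) + ka * ka)) * (Cmod (f z) * Cmod (f z) + ka * ka))
      with (Cmod (f z) * (Cmod (f' z) * Cmod b)) by (field; lra).
    replace (Re (f z) * Re (f' z * b)%C + Im (f z) * Im (f' z * b)%C) with (Re (Cconj (f z) * (f' z * b))%C).
    2:{ destruct (f z), (f' z * b)%C. unfold Re, Im; simpl. ring. }
    eapply Rle_trans; [apply re_le_Cmod|]. rewrite !Cmod_mult, Cmod_conj. lra.
Qed.

Lemma lsum_derive {X : Type} (phi : X -> R -> R) (G : X -> R) (l : list X) (t : R) :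
  (forall x, In x l -> exists D, is_derive (phi x) t D /\ Rabs D <= G x) ->
  exists D, is_derive (fun s => lsum (fun x => phi x s) l) t D /\ Rabs D <= lsum G l.
Proof.
  induction l as [|x l IH]; intros H; simpl.
  - exists 0. split; [apply (is_derive_const (V := R_NormedModule) 0) | rewrite Rabs_R0; lra].
  - destruct (H x (or_introl eq_refl)) as [D1 [H1 B1]].
    destruct IH as [D2 [H2 B2]]; [intros y Hy; apply H; right; exact Hy|].
    exists (D1 + D2). split.
    + apply (is_derive_plus (V := R_NormedModule) (phi x)); assumption.
    + eapply Rle_trans; [apply Rabs_triang|]. lra.
Qed.

(** The product is one entire function of the rotation parameter [u], and its value at [u = 0] is
    [f w] to the power [length cs]. In this way no integral of [log |f|] across zeros is ever
    formed. *)
Lemma product_rotation (f f' : C -> C) (w : C) (cs : list C) : entire f f' -> f w <> 0%C ->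
  exists ze, Cmod ze = 1 /\ (forall c, In c cs -> f (w + ze * c)%C <> 0%C) /\
    INR (length cs) * ln (Cmod (f w)) <= lsum (fun c => ln (Cmod (f (w + ze * c)%C))) cs.
Proof.
  intros Hf Hw.
  set (P := fun u : C => fold_right (fun c acc => f (w + u * c) * acc)%C 1%C cs).
  assert (HP : forall u, holo_at P u).
  { intros u. apply (holo_fold (fun c u => f (w + u * c)%C)). intros c.
    exists (f' (w + u * c)%C * (0 + (1 * c + u * 0)))%C.
    apply (cder_comp f (fun u => w + u * c)%C); [|apply Hf].
    apply (cder_plus (fun _ => w)); [apply cder_const|]. apply (cder_mult (fun u => u) (fun _ => c)); [apply cder_id | apply cder_const]. }
  destruct (circle_max P 0%C 1) as [ze [H1 H2]]; [lra | intros; apply holo_continuous, HP |].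
  replace (ze - 0)%C with ze in H1 by ring.
  exists ze. split; [exact H1|].
  assert (H0 : Cmod (P 0%C) <= Cmod (P ze)).
  { apply (max_modulus P 0%C 1); [|exact HP | exact H2].
    replace (0 - 0)%C with (RtoC 0) by ring. rewrite Cmod_0. lra. }
  pose proof (proj1 (Cmod_gt_0 _) Hw) as Hwp.
  assert (E0 : Cmod (P 0%C) = Cmod (f w) ^ length cs).
  { unfold P. clear. induction cs as [|c cs IH]; simpl; [apply Cmod_1|].
    rewrite Cmod_mult, IH. replace (w + 0 * c)%C with w by ring. reflexivity. }
  assert (Hpos : 0 < Cmod (P ze)) by (eapply Rlt_le_trans; [|exact H0]; rewrite E0; apply pow_lt, Hwp).
  assert (Hnz : forall c, In c cs -> f (w + ze * c)%C <> 0%C).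
  { intros c Hc Ec. assert (Z : P ze = 0%C); [|rewrite Z, Cmod_0 in Hpos; lra].
    unfold P. clear -Hc Ec. induction cs as [|d cs IH]; [destruct Hc|]. simpl.
    destruct Hc as [-> | Hc]; [rewrite Ec; ring | rewrite (IH Hc); ring]. }
  split; [exact Hnz|].
  rewrite <- ln_pow by exact Hwp. rewrite <- E0.
  eapply Rle_trans; [apply ln_mono; [rewrite E0; apply pow_lt, Hwp | exact H0]|]. apply Req_le.
  unfold P. clear -Hnz. induction cs as [|c cs IH]; simpl; [rewrite Cmod_1; apply ln_1|].
  rewrite Cmod_mult, ln_mult, IH.
  - reflexivity.
  - intros d Hd. apply Hnz. right; exact Hd.
  - apply Cmod_gt_0, Hnz. left; reflexivity.
  - apply Cmod_gt_0. clear IH. assert (Hnz' : forall d, In d cs -> f (w + ze * d)%C <> 0%C) by (intros d Hd; apply Hnz; right; exact Hd).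
    clear Hnz. induction cs as [|d cs IH]; simpl; [exact C1_nz|].
    apply Cmult_neq_0; [apply Hnz'; left; reflexivity | apply IH; intros e He; apply Hnz'; right; exact He].
Qed.

(* The maximum principle for the product of rotated copies of [f] gives, for some rotation [ze],
   a sub-mean value inequality for [log |f|] over any finite configuration [cs]; transporting the
   configuration from [w] to [w'] then forces a large average gradient at an intermediate position. *)
Lemma average_gradient (f f' : C -> C) (w w' : C) (ka : R) (cs : list C) : entire f f' -> f w <> 0%C -> 0 < ka ->
  (forall c ze, In c cs -> Cmod ze = 1 -> Cmod (f (w' + ze * c)%C) <= ka) ->
  exists ze t, Cmod ze = 1 /\ 0 <= t <= 1 /\
    INR (length cs) * (ln (Cmod (f w)) - ln ka - ln 2) <=
      Cmod (w' - w) * lsum (fun c => grad f f' ka (w + RtoC t * (w' - w) + ze * c)%C) cs.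
Proof.
  intros Hf Hw Hka Hsm.
  destruct (product_rotation f f' w cs Hf Hw) as [ze [Hze [Hnz Hsum]]].
  set (phi := fun s : R => lsum (fun c => / 2 * ln (Cmod (f ((w + ze * c) + RtoC s * (w' - w))%C) *
    Cmod (f ((w + ze * c) + RtoC s * (w' - w))%C) + ka * ka)) cs).
  set (G := fun t : R => Cmod (w' - w) * lsum (fun c => grad f f' ka (w + RtoC t * (w' - w) + ze * c)%C) cs).
  assert (HD : forall t, exists D, is_derive phi t D /\ Rabs D <= G t).
  { intros t. unfold phi, G. rewrite <- lsum_scal. apply lsum_derive. intros c _.
    destruct (grad_line f f' ka (w + ze * c)%C (w' - w)%C t Hka Hf) as [D [H1 H2]].
    exists D. split; [exact H1|].
    replace (w + RtoC t * (w' - w) + ze * c)%C with (w + ze * c + RtoC t * (w' - w))%C by ring. exact H2. }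
  set (dphi := fun t => epsilon (inhabits 0) (fun D => is_derive phi t D /\ Rabs D <= G t)).
  assert (Hd : forall t, is_derive phi t (dphi t) /\ Rabs (dphi t) <= G t) by (intros t; apply epsilon_spec, HD).
  destruct (MVT_gen phi 0 1 dphi) as [t [Ht Et]].
  - intros x _. apply Hd.
  - intros x _. apply continuity_pt_filterlim, (ex_derive_continuous phi). exists (dphi x). apply Hd.
  - rewrite Rmin_left, Rmax_right in Ht by lra. exists ze, t. split; [exact Hze|]. split; [exact Ht|].
    fold (G t). destruct (Hd t) as [_ Hb].
    (* At [t = 0] the summands are at least [ln |f|]; at [t = 1] they are at most
       [ln ka + (ln 2) / 2], because [|f| <= ka] there. *)
    assert (L0 : INR (length cs) * ln (Cmod (f w)) <= phi 0).
    { eapply Rle_trans; [exact Hsum|]. unfold phi. apply lsum_le. intros c Hc.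
      replace (w + ze * c + RtoC 0 * (w' - w))%C with (w + ze * c)%C by ring.
      set (m := Cmod (f (w + ze * c)%C)).
      assert (Hm : 0 < m) by (apply Cmod_gt_0, Hnz, Hc).
      assert (ln (m * m) <= ln (m * m + ka * ka)) by (apply ln_mono; nra).
      rewrite ln_mult in H by exact Hm. lra. }
    assert (L1 : phi 1 <= INR (length cs) * (ln ka + ln 2)).
    { unfold phi. apply lsum_bound. intros c Hc.
      replace (w + ze * c + RtoC 1 * (w' - w))%C with (w' + ze * c)%C by ring.
      specialize (Hsm c ze Hc Hze). set (m := Cmod (f (w' + ze * c)%C)) in *.
      assert (Hm : 0 <= m) by apply Cmod_ge_0.
      assert (Hle : ln (m * m + ka * ka) <= ln ((ka * ka) * 2)) by (apply ln_mono; nra).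
      rewrite !ln_mult in Hle by nra.
      assert (0 < ln 2) by (rewrite <- ln_1; apply ln_increasing; lra). lra. }
    assert (Hab : - dphi t <= G t).
    { eapply Rle_trans; [|exact Hb]. rewrite <- Rabs_Ropp. apply Rle_abs. }
    lra.
Qed.

(** * Coverings *)

Lemma rect_area_nonneg (Q : rect) : 0 <= rect_area Q.
Proof. unfold rect_area. apply Rmult_le_pos; apply Rmax_l. Qed.

Lemma cover_sums_nonneg (X : C -> Prop) (s : R) : cover_sums X s -> 0 <= s.
Proof.
  intros [Q [_ HQ]]. eapply Rle_trans; [|apply (sum_incr (fun n => rect_area (Q n)) 0 s HQ)].
  - simpl. apply rect_area_nonneg.
  - intros n. apply rect_area_nonneg.
Qed.

(** Coverings are infinite sequences, hence the padding by degenerate rectangles. *)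
Lemma cover_sums_rect (X : C -> Prop) (Q : rect) : (forall z, X z -> in_rect Q z) -> cover_sums X (rect_area Q).
Proof.
  intros H. exists (fun n => match n with O => Q | _ => mkRect 0 0 0 0 end). split.
  - intros z Hz. exists 0%nat. apply H, Hz.
  - assert (E : forall n, sum_f_R0 (fun n => rect_area (match n with O => Q | _ => mkRect 0 0 0 0 end)) n = rect_area Q).
    { induction n as [|n IH]; [reflexivity|]. rewrite tech5, IH. unfold rect_area at 2; simpl.
      rewrite Rminus_0_r, Rmax_left by lra. ring. }
    intros eps He. exists 0%nat. intros n _. rewrite E. unfold Rdist. rewrite Rminus_diag, Rabs_R0. exact He.
Qed.

(** A bounded set has a covering of finite total area, and all such sums are nonnegative; so the
    infimum exists and the choice operator in [area] returns it. *)
Lemma area_glb (X : C -> Prop) (Q : rect) : (forall z, X z -> in_rect Q z) ->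
  Defs.is_glb (cover_sums X) (area X).
Proof.
  intros H. unfold area. apply epsilon_spec.
  destruct (completeness (fun x => cover_sums X (- x))) as [m [Hm1 Hm2]].
  - exists 0. intros x Hx. apply cover_sums_nonneg in Hx. lra.
  - exists (- rect_area Q). rewrite Ropp_involutive. apply cover_sums_rect, H.
  - exists (- m). split.
    + intros x Hx. assert (H1 : - x <= m) by (apply Hm1; rewrite Ropp_involutive; exact Hx). lra.
    + intros b Hb. assert (H1 : m <= - b) by (apply Hm2; intros x Hx; specialize (Hb _ Hx); lra). lra.
Qed.

Lemma cover_sums_subset (X Y : C -> Prop) (s : R) : (forall z, X z -> Y z) -> cover_sums Y s -> cover_sums X s.
Proof. intros H [Q [H1 H2]]. exists Q. split; [intros z Hz; apply H1, H, Hz | exact H2]. Qed.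

Definition enlarge (e : R) (Q : rect) : rect := mkRect (rx1 Q - e) (rx2 Q + e) (ry1 Q - e) (ry2 Q + e).

Lemma enlarge_area (Q : rect) (eps : R) : 0 < eps -> exists e, 0 < e /\ rect_area (enlarge e Q) <= rect_area Q + eps.
Proof.
  intros He. unfold rect_area, enlarge; simpl.
  set (a := Rmax 0 (rx2 Q - rx1 Q)). set (b := Rmax 0 (ry2 Q - ry1 Q)).
  assert (Ha : 0 <= a) by apply Rmax_l. assert (Hb : 0 <= b) by apply Rmax_l.
  assert (Ha2 : rx2 Q - rx1 Q <= a) by apply Rmax_r. assert (Hb2 : ry2 Q - ry1 Q <= b) by apply Rmax_r.
  set (k := 2 * (a + b) + 4). set (e := Rmin 1 (eps / k)).
  assert (Hk : 0 < k) by (unfold k; lra).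
  assert (He0 : 0 < e) by (apply Rmin_pos; [lra | apply Rdiv_lt_0_compat; lra]).
  assert (He1 : e <= 1) by apply Rmin_l.
  assert (He2 : e * k <= eps).
  { assert (L : e <= eps / k) by apply Rmin_r. apply Rmult_le_compat_r with (r := k) in L; [|lra].
    replace (eps / k * k) with eps in L by (field; lra). exact L. }
  exists e. split; [exact He0|].
  apply Rle_trans with ((a + 2 * e) * (b + 2 * e)).
  - apply Rmult_le_compat; try apply Rmax_l; apply Rmax_lub; lra.
  - unfold k in He2. nra.
Qed.

Lemma in_rect_enlarge (Q : rect) (e : R) (z : C) : 0 < e -> in_rect Q z ->
  forall u, Cmod (u - z) <= e -> in_rect (enlarge e Q) u.
Proof.
  intros He [H1 H2] u Hu. pose proof (re_le_Cmod (u - z)) as R1. pose proof (im_le_Cmod (u - z)) as R2.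
  assert (B1 : Rabs (fst u - fst z) <= e) by (eapply Rle_trans; [exact R1 | exact Hu]).
  assert (B2 : Rabs (snd u - snd z) <= e) by (eapply Rle_trans; [exact R2 | exact Hu]).
  apply Rabs_le_between in B1. apply Rabs_le_between in B2. unfold in_rect, enlarge; simpl. lra.
Qed.

(** The Heine-Borel theorem by bisection. The closed rectangles are enlarged so that they contain a
    neighbourhood of each point they cover; points outside [G] have a neighbourhood free of [G]. *)
Lemma finite_cover (G : C -> Prop) (Q : nat -> rect) (e : nat -> R) (X : R) : 0 <= X ->
  (forall n, 0 < e n) -> (forall z, ~ G z -> locally z (fun u => ~ G u)) ->
  (forall z, G z -> exists n, in_rect (Q n) z) ->
  exists m, forall z, Rabs (Re z) <= X -> Rabs (Im z) <= X -> G z ->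
    exists n, (n < m)%nat /\ in_rect (enlarge (e n) (Q n)) z.
Proof.
  intros HX He Hop Hcov.
  destruct (bisection (fun x1 x2 y1 y2 => exists m, forall z : C, x1 <= Re z <= x2 -> y1 <= Im z <= y2 -> G z ->
    exists n, (n < m)%nat /\ in_rect (enlarge (e n) (Q n)) z) (- X) X (- X) X) as [m Hm]; try lra.
  - intros x1 x2 y1 y2 _ _ _ _ _ _ [m1 H1] [m2 H2] [m3 H3] [m4 H4].
    exists (m1 + m2 + m3 + m4)%nat. intros z Hx Hy Gz.
    destruct (Rle_dec (Re z) ((x1 + x2) / 2)), (Rle_dec (Im z) ((y1 + y2) / 2)).
    + destruct (H1 z) as [k [Hk Hi]]; try lra; try assumption. exists k. split; [lia | exact Hi].
    + destruct (H3 z) as [k [Hk Hi]]; try lra; try assumption. exists k. split; [lia | exact Hi].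
    + destruct (H2 z) as [k [Hk Hi]]; try lra; try assumption. exists k. split; [lia | exact Hi].
    + destruct (H4 z) as [k [Hk Hi]]; try lra; try assumption. exists k. split; [lia | exact Hi].
  - intros x y _ _.
    assert (Hd : exists d, 0 < d /\ exists m, forall u, Cmod (u - (x, y))%C < d -> G u ->
       exists n, (n < m)%nat /\ in_rect (enlarge (e n) (Q n)) u).
    { destruct (classic (G (x, y))) as [Gz | Nz].
      - destruct (Hcov _ Gz) as [n Hn]. exists (e n). split; [apply He|]. exists (S n). intros u Hu _.
        exists n. split; [lia|]. apply (in_rect_enlarge _ _ (x, y)); [apply He | exact Hn | lra].
      - destruct (locally_C_ball _ _ (Hop _ Nz)) as [d [Hd H]]. exists d. split; [exact Hd|].
        exists 0%nat. intros u Hu Gu. exfalso. apply (H _ Hu).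
        replace ((x, y) + (u - (x, y)))%C with u by (generalize ((x, y) : C); intros; ring). exact Gu. }
    destruct Hd as [d [Hd [m Hm]]]. exists (d / 2). split; [lra|].
    intros x1 x2 y1 y2 _ Hx _ _ Hy _ Hdx Hdy. exists m. intros z Hzx Hzy. apply Hm.
    eapply Rle_lt_trans; [apply Cmod_le_sum|].
    change (Re (z - (x, y))%C) with (Re z - x). change (Im (z - (x, y))%C) with (Im z - y).
    assert (Rabs (Re z - x) <= x2 - x1) by (apply Rabs_le; lra).
    assert (Rabs (Im z - y) <= y2 - y1) by (apply Rabs_le; lra). lra.
  - exists m. intros z Hx Hy. apply Hm; apply Rabs_le_between; assumption.
Qed.

(** The [n]-th rectangle is enlarged at a cost of at most [eps / 2^(n+1)]. Finiteness matters
    because each rectangle adds to the lattice count an error that is negligible only if the number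
    of rectangles stays fixed while the mesh tends to 0. *)
Lemma finite_cover_area (G : C -> Prop) (s X eps : R) : 0 <= X -> 0 < eps -> cover_sums G s ->
  (forall z, ~ G z -> locally z (fun u => ~ G u)) ->
  exists (Q : nat -> rect) (m : nat), lsum (fun n => rect_area (Q n)) (seq 0 m) <= s + eps /\
    forall z, Rabs (Re z) <= X -> Rabs (Im z) <= X -> G z -> exists n, (n < m)%nat /\ in_rect (Q n) z.
Proof.
  intros HX He [Q [Hcov Hsum]] Hop.
  assert (Hex : forall n, exists e, 0 < e /\ rect_area (enlarge e (Q n)) <= rect_area (Q n) + eps / 2 * (/ 2) ^ n).
  { intros n. apply enlarge_area. apply Rmult_lt_0_compat; [lra | apply pow_lt; lra]. }
  set (e := fun n => epsilon (inhabits 0) (fun e => 0 < e /\ rect_area (enlarge e (Q n)) <= rect_area (Q n) + eps / 2 * (/ 2) ^ n)).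
  assert (Hes : forall n, 0 < e n /\ rect_area (enlarge (e n) (Q n)) <= rect_area (Q n) + eps / 2 * (/ 2) ^ n).
  { intros n. apply epsilon_spec, Hex. }
  destruct (finite_cover G Q e X HX (fun n => proj1 (Hes n)) Hop Hcov) as [m Hm].
  exists (fun n => enlarge (e n) (Q n)), m. split; [|exact Hm].
  apply Rle_trans with (lsum (fun n => rect_area (Q n)) (seq 0 m) + eps / 2 * lsum (fun n => (/ 2) ^ n) (seq 0 m)).
  { rewrite <- lsum_scal, <- lsum_plus. apply lsum_le. intros n _. apply Hes. }
  assert (G1 : lsum (fun n => rect_area (Q n)) (seq 0 m) <= s).
  { destruct m as [|m]; [simpl; apply (cover_sums_nonneg G); exists Q; split; assumption|].
    eapply Rle_trans; [|apply (sum_incr (fun n => rect_area (Q n)) m s Hsum); intros; apply rect_area_nonneg].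
    apply Req_le. clear. induction m as [|m IH]; [simpl; ring|].
    rewrite seq_S, lsum_app, IH. rewrite tech5. simpl. ring. }
  assert (G2 : lsum (fun n => (/ 2) ^ n) (seq 0 m) <= 2).
  { rewrite (lsum_ext _ (fun n => (- 2 * (/ 2) ^ (S n)) - (- 2 * (/ 2) ^ n))) by (intros; simpl; field).
    rewrite (lsum_telescope (fun n => - 2 * (/ 2) ^ n)). simpl.
    assert (0 < (/ 2) ^ m) by (apply pow_lt; lra). lra. }
  nra.
Qed.

(** * Pointwise bound for the gradient *)

Definition square (d : R) (a : C) : rect := mkRect (Re a - 2 * d) (Re a + 2 * d) (Im a - 2 * d) (Im a + 2 * d).

Lemma in_square (d : R) (a x : C) : Cmod (x - a) <= 2 * d -> in_rect (square d a) x.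
Proof.
  intros H. pose proof (re_le_Cmod (x - a)) as R1. pose proof (im_le_Cmod (x - a)) as R2.
  change (Re (x - a)%C) with (Re x - Re a) in R1. change (Im (x - a)%C) with (Im x - Im a) in R2.
  assert (B1 : Rabs (Re x - Re a) <= 2 * d) by lra. assert (B2 : Rabs (Im x - Im a) <= 2 * d) by lra.
  apply Rabs_le_between in B1. apply Rabs_le_between in B2.
  unfold in_rect, square; simpl. unfold Re, Im in *. lra.
Qed.

Lemma grad_le_log_derivative (f f' : C -> C) (ka : R) (x : C) : 0 < ka -> f x <> 0%C ->
  grad f f' ka x = Cmod (f' x / f x) * (Cmod (f x) * Cmod (f x) / (Cmod (f x) * Cmod (f x) + ka * ka)).
Proof.
  intros Hk Hx. pose proof (proj1 (Cmod_gt_0 _) Hx). unfold grad. rewrite Cmod_div by exact Hx. field.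
  split; nra.
Qed.

Lemma grad_nonneg (f f' : C -> C) (ka : R) (x : C) : 0 < ka -> 0 <= grad f f' ka x.
Proof.
  intros Hk. unfold grad. pose proof (Cmod_ge_0 (f x)). pose proof (Cmod_ge_0 (f' x)).
  apply Rdiv_le_0_compat; nra.
Qed.

(** The set whose area is bounded below; near [w] its points lie in [T]. The conditions on [f] and
    [f'] are non-strict and free of division, so that failure of any condition is open wherever
    compactness needs it. *)
Definition good (f f' : C -> C) (l : list C) (q al mu Kc d : R) (x : C) : Prop :=
  inv_dist l x <= Kc * mu /\ (forall a, In a l -> 2 * d <= Cmod (x - a)) /\
  Rpower (Cmod x) q <= Cmod (f x) /\ al * mu * Cmod (f x) <= Cmod (f' x).

(* On the bad set [inv_dist > Kc mu], Markov's inequality trades the far zeros for [inv_dist] itself. *)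
Lemma grad_pointwise (f f' : C -> C) (l : list C) (p ze : C) (h R1 mu al Kc K1 Fm ka de d q : R)
  (Q : nat -> rect) (m : nat) (jl : nat * nat) :
  let x := (p + ze * lpt h jl)%C in
  Cmod ze = 1 -> 0 < ka -> 0 < mu -> 0 < al -> 0 < Kc -> 0 <= K1 -> K1 <= Kc -> 0 < de ->
  grad f f' ka x <= Fm ->
  (f x <> 0%C -> Cmod (f' x / f x) <= inv_dist l x + K1 * mu) ->
  (forall a, In a l -> f a = 0%C) ->
  (forall a, In a l -> Cmod (x - a) <= R1) ->
  (Cmod (f x) < Rpower (Cmod x) q -> 2 * Kc * (Cmod (f x) * Cmod (f x)) <= al * (ka * ka)) ->
  (good f f' l q al mu Kc d x -> exists n, (n < m)%nat /\ in_rect (Q n) x) ->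
  grad f f' ka x <=
    Fm * lsum (fun a => indic (near h ((a - p) / ze)%C jl)) l + al * mu
    + 2 * lsum (fun a => sing h de ((a - p) / ze)%C jl) l
    + 2 * (INR (length l) / (de * (Kc * mu))) * lsum (fun a => sing h R1 ((a - p) / ze)%C jl) l
    + 2 * Kc * mu * (lsum (fun a => indic (in_rect (square d a) x)) l + lsum (fun n => indic (in_rect (Q n) x)) (seq 0 m)).
Proof.
  intros x Hze Hka Hmu Hal HKc HK10 HK1 Hde HFm Hlog Hroot Hdist Hsm Hcov.
  assert (Hze0 : ze <> 0%C) by (apply Cmod_pos_neq_0; lra).
  assert (Ed : forall a, Cmod (lpt h jl - (a - p) / ze)%C = Cmod (x - a)).
  { intros a. replace (x - a)%C with (ze * (lpt h jl - (a - p) / ze))%C by (unfold x; field; exact Hze0).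
    rewrite Cmod_mult, Hze. ring. }
  pose proof (grad_nonneg f f' ka x Hka) as G0.
  assert (N1 : 0 <= lsum (fun a => indic (near h ((a - p) / ze)%C jl)) l) by (apply lsum_nonneg; intros; apply indic_bounds).
  assert (N2 : 0 <= lsum (fun a => sing h de ((a - p) / ze)%C jl) l) by (apply lsum_nonneg; intros; apply sing_nonneg).
  assert (N3 : 0 <= lsum (fun a => sing h R1 ((a - p) / ze)%C jl) l) by (apply lsum_nonneg; intros; apply sing_nonneg).
  assert (N4 : 0 <= lsum (fun a => indic (in_rect (square d a) x)) l) by (apply lsum_nonneg; intros; apply indic_bounds).
  assert (N5 : 0 <= lsum (fun n => indic (in_rect (Q n) x)) (seq 0 m)) by (apply lsum_nonneg; intros; apply indic_bounds).
  set (S1 := lsum (fun a => indic (near h ((a - p) / ze)%C jl)) l) in *.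
  set (S2 := lsum (fun a => sing h de ((a - p) / ze)%C jl) l) in *.
  set (S3 := lsum (fun a => sing h R1 ((a - p) / ze)%C jl) l) in *.
  set (S4 := lsum (fun a => indic (in_rect (square d a) x)) l) in *.
  set (S5 := lsum (fun n => indic (in_rect (Q n) x)) (seq 0 m)) in *.
  assert (HKm : 0 < Kc * mu) by (apply Rmult_lt_0_compat; assumption).
  assert (Ham : 0 < al * mu) by (apply Rmult_lt_0_compat; assumption).
  assert (Hn0 : 0 <= INR (length l)) by apply pos_INR.
  set (cc := INR (length l) / (de * (Kc * mu))).
  assert (Hcc : 0 <= cc) by (apply Rdiv_le_0_compat; [exact Hn0 | apply Rmult_lt_0_compat; assumption]).
  assert (P1 : 0 <= Fm * S1) by (apply Rmult_le_pos; lra).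
  assert (P3 : 0 <= cc * S3) by (apply Rmult_le_pos; lra).
  assert (P4 : 0 <= Kc * mu * S4) by (apply Rmult_le_pos; lra).
  assert (P5 : 0 <= Kc * mu * S5) by (apply Rmult_le_pos; lra).
  (* In the cell of a zero there is only the crude bound [Fm]. It is harmless, since the number of
     such lattice points does not grow when the lattice is refined. *)
  destruct (classic (exists a, In a l /\ near h ((a - p) / ze)%C jl)) as [[a [Ha Hna]] | Hnn].
  { assert (1 <= S1).
    { rewrite <- (indic_true _ Hna). apply (lsum_ge_term (fun a => indic (near h ((a - p) / ze)%C jl))); [intros; apply indic_bounds | exact Ha]. }
    assert (Fm <= Fm * S1) by nra. lra. }
  destruct (Ceq_dec (f x) 0) as [Efx | Nfx].
  { assert (E : grad f f' ka x = 0) by (unfold grad; rewrite Efx, Cmod_0; unfold Rdiv; ring). rewrite E. lra. }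
  specialize (Hlog Nfx).
  pose proof (proj1 (Cmod_gt_0 _) Nfx) as Hfp.
  set (ph := Cmod (f x) * Cmod (f x) / (Cmod (f x) * Cmod (f x) + ka * ka)).
  assert (Hph0 : 0 <= ph) by (unfold ph; apply Rdiv_le_0_compat; nra).
  assert (Hph1 : ph <= 1).
  { unfold ph. apply Rmult_le_reg_r with (Cmod (f x) * Cmod (f x) + ka * ka); [nra|].
    unfold Rdiv. rewrite Rmult_assoc, Rinv_l by nra. nra. }
  assert (EG := grad_le_log_derivative f f' ka x Hka Nfx). fold ph in EG.
  pose proof (Cmod_ge_0 (f' x / f x)) as Hq0.
  assert (HG : grad f f' ka x <= Cmod (f' x / f x)) by (rewrite EG; nra).
  destruct (Rle_dec (inv_dist l x) (Kc * mu)) as [HH | HH].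
  2:{ assert (E3 : inv_dist l x = S3).
    { unfold inv_dist, S3. apply lsum_ext. intros a Ha. unfold sing. rewrite Ed.
      destruct (excluded_middle_informative _) as [_ | Hno]; [reflexivity|]. exfalso. apply Hno.
      split; [apply Hdist, Ha|]. intros Hna. apply Hnn. exists a. split; assumption. }
    assert (E2 : inv_dist l x <= S2 + INR (length l) * / de).
    { unfold inv_dist, S2. rewrite <- lsum_const, <- lsum_plus. apply lsum_le. intros a Ha.
      pose proof (sing_nonneg h de ((a - p) / ze)%C jl) as Hs0.
      destruct (Rle_dec (Cmod (x - a)) de) as [Hle | Hgt].
      - unfold sing. rewrite Ed. destruct (excluded_middle_informative _) as [_ | Hno].
        + assert (0 < / de) by (apply Rinv_0_lt_compat, Hde). lra.
        + exfalso. apply Hno. split; [exact Hle|]. intros Hna. apply Hnn. exists a. split; assumption.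
      - assert (/ Cmod (x - a) <= / de) by (apply Rinv_le_contravar; lra). lra. }
    assert (E4 : INR (length l) * / de <= cc * S3).
    { rewrite <- E3. unfold cc. replace (INR (length l) * / de) with (INR (length l) / (de * (Kc * mu)) * (Kc * mu)) by (field; lra).
      apply Rmult_le_compat_l; [exact Hcc | lra]. }
    assert (K1 * mu <= Kc * mu) by (apply Rmult_le_compat_r; lra).
    lra. }
  assert (HB : Cmod (f' x / f x) <= 2 * (Kc * mu)).
  { assert (K1 * mu <= Kc * mu) by (apply Rmult_le_compat_r; lra). lra. }
  destruct (classic (exists a, In a l /\ Cmod (x - a) < 2 * d)) as [[a [Ha Hda]] | Hfar].
  { assert (1 <= S4).
    { assert (Hi : in_rect (square d a) x) by (apply in_square; lra).
      rewrite <- (indic_true _ Hi). apply (lsum_ge_term (fun a => indic (in_rect (square d a) x))); [intros; apply indic_bounds | exact Ha]. }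
    assert (Kc * mu <= Kc * mu * S4) by nra. lra. }
  (* Where [|f|] is small, the factor [ph] is small enough to bring the bound [2 Kc mu] down to
     [al mu]. *)
  destruct (Rlt_dec (Cmod (f x)) (Rpower (Cmod x) q)) as [Hlt | Hge].
  { specialize (Hsm Hlt).
    assert (Hb : 2 * Kc * ph <= al).
    { unfold ph. apply Rmult_le_reg_r with (Cmod (f x) * Cmod (f x) + ka * ka); [nra|].
      replace (2 * Kc * (Cmod (f x) * Cmod (f x) / (Cmod (f x) * Cmod (f x) + ka * ka)) * (Cmod (f x) * Cmod (f x) + ka * ka))
        with (2 * Kc * (Cmod (f x) * Cmod (f x))) by (field; nra).
      assert (0 <= al * (Cmod (f x) * Cmod (f x))) by nra. lra. }
    assert (grad f f' ka x <= al * mu).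
    { rewrite EG. apply Rle_trans with (2 * (Kc * mu) * ph); [apply Rmult_le_compat_r; assumption|].
      replace (2 * (Kc * mu) * ph) with (2 * Kc * ph * mu) by ring. apply Rmult_le_compat_r; lra. }
    lra. }
  destruct (Rlt_dec (Cmod (f' x)) (al * mu * Cmod (f x))) as [Hlt | Hge2].
  { assert (Cmod (f' x / f x) <= al * mu).
    { rewrite Cmod_div by exact Nfx. apply Rmult_le_reg_r with (Cmod (f x)); [exact Hfp|].
      unfold Rdiv. rewrite Rmult_assoc, Rinv_l by lra. lra. }
    lra. }
  destruct Hcov as [n [Hn Hi]].
  { split; [exact HH|]. split; [|split; lra]. intros a Ha. apply Rnot_lt_le. intros L. apply Hfar. exists a. split; assumption. }
  assert (1 <= S5).
  { rewrite <- (indic_true _ Hi). apply (lsum_ge_term (fun n => indic (in_rect (Q n) x))); [intros; apply indic_bounds|].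
    apply in_seq. lia. }
  assert (Kc * mu <= Kc * mu * S5) by nra. lra.
Qed.

(** * The counting argument *)

Lemma open_lt (u v : C -> R) (z : C) : continuous u z -> continuous v z -> u z < v z -> locally z (fun x => u x < v x).
Proof.
  intros Hu Hv Hlt. assert (Hd : 0 < v z - u z) by lra.
  assert (Hc : continuous (fun x => v x - u x) z) by (apply continuous_Rminus; assumption).
  assert (L := Hc _ (locally_ball (v z - u z) (mkposreal _ Hd))). unfold filtermap in L.
  revert L. apply filter_imp. intros x Hx.
  unfold ball in Hx; simpl in Hx; unfold AbsRing_ball, abs, minus, plus, opp in Hx; simpl in Hx.
  apply Rabs_def2 in Hx. lra.
Qed.

Lemma continuous_dist (a z : C) : continuous (fun x : C => Cmod (x - a)) z.
Proof. apply continuous_Cmod, continuous_Cminus; [apply continuous_id | apply continuous_const]. Qed.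

Lemma continuous_inv_dist (l : list C) (z : C) : (forall a, In a l -> Cmod (z - a) <> 0) -> continuous (inv_dist l) z.
Proof.
  intros H. unfold inv_dist. induction l as [|a l IH]; simpl; [apply continuous_const|].
  apply continuous_Rplus; [|apply IH; intros b Hb; apply H; right; exact Hb].
  apply (continuous_inv_R (fun x : C => Cmod (x - a))); [apply continuous_dist | apply H; left; reflexivity].
Qed.

Lemma continuous_Rpower_Cmod (q : R) (z : C) : 0 < Cmod z -> continuous (fun x : C => Rpower (Cmod x) q) z.
Proof.
  intros Hz. unfold Rpower. apply (continuous_Rcomp (fun x : C => q * ln (Cmod x)) exp).
  - apply continuous_Rmult; [apply continuous_const|].
    apply (continuous_Rcomp (fun x : C => Cmod x) ln); [apply continuous_Cmod, continuous_id|].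
    apply continuity_pt_filterlim, continuous_ln, Hz.
  - apply derivable_continuous_pt, derivable_pt_exp.
Qed.

(** Each condition that fails does so on a neighbourhood. The distance to the zeros is tested before
    [inv_dist], which is continuous off them, and [rad < |w|] keeps 0 away, so that
    [Rpower (Cmod x) q] is continuous. *)
Lemma good_closed (f f' : C -> C) (l : list C) (q al mu Kc d rad : R) (w : C) : entire f f' -> rad < Cmod w -> 0 < d ->
  let G := fun x => Cmod (x - w) <= rad /\ good f f' l q al mu Kc d x in
  forall z, ~ G z -> locally z (fun x => ~ G x).
Proof.
  intros Hf Hw Hd G z Hz. destruct (entire_deriv f f' Hf) as [f'' Hf'].
  assert (Cf : continuous f z) by (apply holo_continuous, (entire_holo f f'), Hf).
  assert (Cf' : continuous f' z) by (apply holo_continuous, (entire_holo f' f''), Hf').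
  destruct (Rlt_dec rad (Cmod (z - w))) as [H1 | H1].
  { generalize (open_lt (fun _ => rad) (fun x => Cmod (x - w)) z (continuous_const _ _) (continuous_dist w z) H1).
    apply filter_imp. intros x Hx [Hg _]. lra. }
  assert (Hzp : 0 < Cmod z).
  { pose proof (Cmod_rev_triangle w z). rewrite Cmod_sub_sym in H. lra. }
  destruct (classic (forall a, In a l -> 2 * d <= Cmod (z - a))) as [H2 | H2].
  2:{ apply not_all_ex_not in H2. destruct H2 as [a H2]. apply imply_to_and in H2. destruct H2 as [Ha H2].
      assert (Hlt : Cmod (z - a) < 2 * d) by lra.
      generalize (open_lt (fun x => Cmod (x - a)) (fun _ => 2 * d) z (continuous_dist a z) (continuous_const _ _) Hlt).
      apply filter_imp. intros x Hx [_ [_ [Hg _]]]. specialize (Hg a Ha). lra. }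
  destruct (Rlt_dec (Kc * mu) (inv_dist l z)) as [H3 | H3].
  { assert (Ci : continuous (inv_dist l) z).
    { apply continuous_inv_dist. intros a Ha. specialize (H2 a Ha). lra. }
    generalize (open_lt (fun _ => Kc * mu) (inv_dist l) z (continuous_const _ _) Ci H3).
    apply filter_imp. intros x Hx [_ [Hg _]]. lra. }
  destruct (Rlt_dec (Cmod (f z)) (Rpower (Cmod z) q)) as [H4 | H4].
  { generalize (open_lt (fun x => Cmod (f x)) (fun x => Rpower (Cmod x) q) z
      (continuous_Cmod f z Cf) (continuous_Rpower_Cmod q z Hzp) H4).
    apply filter_imp. intros x Hx [_ [_ [_ [Hg _]]]]. lra. }
  destruct (Rlt_dec (Cmod (f' z)) (al * mu * Cmod (f z))) as [H5 | H5].
  { assert (Ca : continuous (fun x => al * mu * Cmod (f x)) z).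
    { apply continuous_Rmult; [apply continuous_const | apply continuous_Cmod, Cf]. }
    generalize (open_lt (fun x => Cmod (f' x)) (fun x => al * mu * Cmod (f x)) z (continuous_Cmod f' z Cf') Ca H5).
    apply filter_imp. intros x Hx [_ [_ [_ [_ Hg]]]]. lra. }
  exfalso. apply Hz. split; [lra|]. split; [lra|]. split; [exact H2|]. split; lra.
Qed.

Lemma square_area (d : R) (a : C) : 0 <= d -> rect_area (square d a) = 16 * (d * d) /\
  Rmax 0 (rx2 (square d a) - rx1 (square d a)) = 4 * d /\ Rmax 0 (ry2 (square d a) - ry1 (square d a)) = 4 * d.
Proof.
  intros Hd. unfold rect_area, square; simpl.
  replace (Re a + 2 * d - (Re a - 2 * d)) with (4 * d) by ring.
  replace (Im a + 2 * d - (Im a - 2 * d)) with (4 * d) by ring.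
  rewrite Rmax_right by lra. repeat split; ring.
Qed.

(** After exchanging the sums, each zero and each rectangle is counted separately over the lattice.
    The squares about the zeros have side [4 d], whence the coefficients 32 and 16. *)
Lemma lattice_upper (F : C -> R) (l : list C) (p ze : C) (h R1 Fm am c3 c4 de d : R) (Q : nat -> rect) (m N : nat) :
  Cmod ze = 1 -> 0 < h -> h <= de -> de <= R1 -> 0 <= Fm -> 0 <= c3 -> 0 <= c4 -> 0 <= d ->
  (forall jl, In jl (lattice N) -> F (p + ze * lpt h jl)%C <=
    Fm * lsum (fun a => indic (near h ((a - p) / ze)%C jl)) l + am
    + 2 * lsum (fun a => sing h de ((a - p) / ze)%C jl) l
    + c3 * lsum (fun a => sing h R1 ((a - p) / ze)%C jl) l
    + c4 * (lsum (fun a => indic (in_rect (square d a) (p + ze * lpt h jl)%C)) l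
            + lsum (fun n => indic (in_rect (Q n) (p + ze * lpt h jl)%C)) (seq 0 m))) ->
  lsum (fun jl => F (p + ze * lpt h jl)%C) (lattice N) <=
    Fm * INR (length l) + INR N * INR N * am + 2 * (INR (length l) * (54 * de / (h * h)))
    + c3 * (INR (length l) * (54 * R1 / (h * h)))
    + c4 * (INR (length l) * (32 * (d * d) / (h * h) + 16 * d / h + 1)
            + (2 * lsum (fun n => rect_area (Q n)) (seq 0 m) / (h * h)
               + 2 * lsum (fun n => Rmax 0 (rx2 (Q n) - rx1 (Q n)) + Rmax 0 (ry2 (Q n) - ry1 (Q n))) (seq 0 m) / h + INR m)).
Proof.
  intros Hze Hh Hde HR1 HFm Hc3 Hc4 Hd HF.
  eapply Rle_trans; [apply lsum_le, HF|].
  rewrite !lsum_plus, !lsum_scal, lsum_plus, lsum_const, lattice_length.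
  rewrite (lsum_swap (fun jl a => indic (near h ((a - p) / ze)%C jl))).
  rewrite (lsum_swap (fun jl a => sing h de ((a - p) / ze)%C jl)).
  rewrite (lsum_swap (fun jl a => sing h R1 ((a - p) / ze)%C jl)).
  rewrite (lsum_swap (fun jl a => indic (in_rect (square d a) (p + ze * lpt h jl)%C))).
  rewrite (lsum_swap (fun jl n => indic (in_rect (Q n) (p + ze * lpt h jl)%C))).
  repeat apply Rplus_le_compat.
  - apply Rmult_le_compat_l; [exact HFm|]. rewrite <- (Rmult_1_r (INR (length l))).
    apply lsum_bound. intros a _. apply near_count.
  - lra.
  - apply Rmult_le_compat_l; [lra|]. apply lsum_bound. intros a _. apply singular_sum; assumption.
  - apply Rmult_le_compat_l; [exact Hc3|]. apply lsum_bound. intros a _. apply singular_sum; lra.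
  - apply Rmult_le_compat_l; [exact Hc4|]. apply Rplus_le_compat.
    + apply lsum_bound. intros a _. eapply Rle_trans; [apply rect_count; assumption|].
      destruct (square_area d a Hd) as [E1 [E2 E3]]. rewrite E1, E2, E3. apply Req_le. field. lra.
    + apply Rle_trans with (lsum (fun n => 2 / (h * h) * rect_area (Q n)
         + 2 / h * (Rmax 0 (rx2 (Q n) - rx1 (Q n)) + Rmax 0 (ry2 (Q n) - ry1 (Q n))) + 1) (seq 0 m)).
      * apply lsum_le. intros n _. eapply Rle_trans; [apply rect_count; assumption|]. apply Req_le. field. lra.
      * rewrite !lsum_plus, !lsum_scal, lsum_const, length_seq. apply Req_le. 
        rewrite lsum_plus. field. lra.
Qed.

(** Refining the lattice without bound leaves only the leading coefficients to compare. *)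
Lemma quadratic_contradiction (a b c : R) (N0 : nat) : 0 < a -> 
  (forall N : nat, (N0 <= N)%nat -> (1 <= N)%nat -> a * (INR N * INR N) <= b * INR N + c) -> False.
Proof.
  intros Ha H. destruct (INR_unbounded ((Rabs b + Rabs c) / a)) as [k Hk].
  set (N := (N0 + k + 1)%nat). specialize (H N ltac:(unfold N; lia) ltac:(unfold N; lia)).
  assert (H1 : 1 <= INR N) by (replace 1 with (INR 1) by reflexivity; apply le_INR; unfold N; lia).
  assert (H2 : INR k <= INR N) by (apply le_INR; unfold N; lia).
  assert (H3 : Rabs b + Rabs c < a * INR N).
  { apply Rmult_gt_compat_l with (r := a) in Hk; [|exact Ha].
    replace (a * ((Rabs b + Rabs c) / a)) with (Rabs b + Rabs c) in Hk by (field; lra). nra. }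
  pose proof (Rle_abs b). pose proof (Rle_abs c). pose proof (Rabs_pos c). nra.
Qed.

(** A covering of total area below [eta R1^2] would make the average gradient too small for the drop
    [c0 La] over the distance [3/10 R1]. The hypotheses [Nal] to [Neta] limit the shares of this
    drop due to small values and derivatives, to near zeros, to the set where [inv_dist] is large,
    to the squares about the zeros, and to the covering. The shares are 3/20, 1/5, 1/5, 1/10 and
    1/10, in total 3/4. *)
Lemma no_small_cover (f f' : C -> C) (w : C) (R1 La ka B c0 al ep Kc K1 D eta q Fm s : R) (l : list C) :
  entire f f' -> 0 < R1 -> Cmod w = 3 / 2 * R1 -> f w <> 0%C -> ln (Cmod (f w)) = La -> 0 < ka ->
  0 < La -> 1 <= B -> 0 < c0 -> 0 < al -> 0 < ep <= 1 -> 0 < Kc -> 0 <= K1 <= Kc -> 0 < D -> 0 < eta ->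
  (forall z, Cmod z <= 13 / 10 * R1 -> Cmod (f z) <= ka) ->
  c0 * La <= La - ln ka - ln 2 ->
  INR (length l) <= 2 * B * La ->
  (forall a, In a l -> f a = 0%C) -> (forall a, In a l -> Cmod (a - w) <= R1) ->
  (forall z, Cmod (z - w) <= R1 / 2 -> f z <> 0%C -> Cmod (f' z / f z) <= inv_dist l z + K1 * (La / R1)) ->
  (forall z, Cmod (z - w) <= 2 / 5 * R1 -> grad f f' ka z <= Fm) -> 
  (forall z, Cmod (z - w) <= 2 / 5 * R1 -> Cmod (f z) < Rpower (Cmod z) q ->
     2 * Kc * (Cmod (f z) * Cmod (f z)) <= al * (ka * ka)) ->
  al <= c0 / 2 -> 25920 * B * ep <= c0 / 5 -> 103680 * (B * B) <= c0 / 5 * (ep * Kc) ->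
  15360 * Kc * B * (D * D) <= c0 / 10 * La -> 960 * Kc * eta <= c0 / 10 ->
  cover_sums (fun x => Cmod (x - w) <= 2 / 5 * R1 /\ good f f' l q al (La / R1) Kc (D * R1 / La) x) s ->
  s < eta * (R1 * R1) -> False.
Proof.
  intros Hf HR Hw Hfw HLa Hka HLa0 HB Hc0 Hal Hep HKc HK1 HD Heta Hsmall Hdrop Hlen Hroot Hdist Hlog HFm Hq
    Nal Nep NKc NLa Neta Hcov Hs.
  set (mu := La / R1) in *. set (d := D * R1 / La) in *.
  assert (Hmu : 0 < mu) by (apply Rdiv_lt_0_compat; lra).
  assert (Hd : 0 < d) by (apply Rdiv_lt_0_compat; [apply Rmult_lt_0_compat; lra | lra]).
  destruct (finite_cover_area _ s (2 * R1) (eta * (R1 * R1)) ltac:(lra) ltac:(repeat apply Rmult_lt_0_compat; lra) Hcov)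
    as [Q [m [HQ Hm]]].
  { apply (good_closed f f' l q al mu Kc d (2 / 5 * R1) w Hf); lra. }
  set (Sa := lsum (fun n => rect_area (Q n)) (seq 0 m)) in *.
  set (Sp := lsum (fun n => Rmax 0 (rx2 (Q n) - rx1 (Q n)) + Rmax 0 (ry2 (Q n) - ry1 (Q n))) (seq 0 m)).
  set (n := INR (length l)) in *.
  assert (Hn0 : 0 <= n) by apply pos_INR.
  set (de := ep * R1). assert (Hde : 0 < de) by (apply Rmult_lt_0_compat; lra).
  set (c3 := 2 * (n / (de * (Kc * mu)))).
  assert (Hc3 : 0 <= c3).
  { unfold c3. apply Rmult_le_pos; [lra|]. apply Rdiv_le_0_compat; [exact Hn0|].
    apply Rmult_lt_0_compat; [exact Hde | apply Rmult_lt_0_compat; assumption]. }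
  assert (HFm0 : 0 <= Fm).
  { eapply Rle_trans; [apply (grad_nonneg f f' ka w Hka) | apply HFm].
    replace (w - w)%C with (RtoC 0) by ring. rewrite Cmod_0. lra. }
  destruct (INR_unbounded (/ (20 * ep))) as [N0 HN0].
  (* The upper bound is a polynomial in [N] with coefficients [X], [Y], [Z], as
     [1 / h^2 = 400 N^2 / R1^2]. They are fixed before [N], because the covering is already
     finite. *)
  set (X := al * mu + 400 / (R1 * R1) * (108 * n * de + c3 * (n * (108 * R1)) + 2 * Kc * mu * (32 * n * (d * d) + 2 * Sa))).
  set (Y := 2 * Kc * mu * (16 * d * n + 2 * Sp) * (20 / R1)).
  set (Z := Fm * n + 2 * Kc * mu * (n + INR m)).
  apply (quadratic_contradiction (c0 * La - 3 / 10 * R1 * X) (3 / 10 * R1 * Y) (3 / 10 * R1 * Z) N0).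
  - assert (Hc3b : c3 <= 4 * B / (ep * Kc)).
    { unfold c3, de, mu. replace (2 * (n / (ep * R1 * (Kc * (La / R1))))) with (n * (2 / (ep * Kc * La))) by (field; repeat split; lra).
      replace (4 * B / (ep * Kc)) with (2 * B * La * (2 / (ep * Kc * La))) by (field; repeat split; lra).
      apply Rmult_le_compat_r; [|exact Hlen]. apply Rdiv_le_0_compat; [lra|]. repeat apply Rmult_lt_0_compat; lra. }
    assert (T1 : 3 / 10 * R1 * (al * mu) <= 3 / 20 * (c0 * La)).
    { unfold mu. replace (3 / 10 * R1 * (al * (La / R1))) with (3 / 10 * al * La) by (field; lra). nra. }
    assert (T2 : 3 / 10 * R1 * (400 / (R1 * R1) * (108 * n * de)) <= c0 / 5 * La).
    { unfold de. replace (3 / 10 * R1 * (400 / (R1 * R1) * (108 * n * (ep * R1)))) with (12960 * ep * n) by (field; lra).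
      apply Rle_trans with (12960 * ep * (2 * B * La)); [apply Rmult_le_compat_l; lra|]. nra. }
    assert (T3 : 3 / 10 * R1 * (400 / (R1 * R1) * (c3 * (n * (108 * R1)))) <= c0 / 5 * La).
    { replace (3 / 10 * R1 * (400 / (R1 * R1) * (c3 * (n * (108 * R1))))) with (12960 * (c3 * n)) by (field; lra).
      apply Rle_trans with (12960 * (4 * B / (ep * Kc) * (2 * B * La))).
      - apply Rmult_le_compat_l; [lra|]. apply Rmult_le_compat; assumption.
      - replace (12960 * (4 * B / (ep * Kc) * (2 * B * La))) with (103680 * (B * B) * (La / (ep * Kc))) by (field; lra).
        replace (c0 / 5 * La) with (c0 / 5 * (ep * Kc) * (La / (ep * Kc))) by (field; lra).
        apply Rmult_le_compat_r; [|exact NKc]. apply Rdiv_le_0_compat; [lra | apply Rmult_lt_0_compat; lra]. }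
    assert (T4 : 3 / 10 * R1 * (400 / (R1 * R1) * (2 * Kc * mu * (32 * n * (d * d)))) <= c0 / 10 * La).
    { unfold mu, d.
      replace (3 / 10 * R1 * (400 / (R1 * R1) * (2 * Kc * (La / R1) * (32 * n * (D * R1 / La * (D * R1 / La)))))) with
        (7680 * Kc * (D * D) / La * n) by (field; lra).
      apply Rle_trans with (7680 * Kc * (D * D) / La * (2 * B * La)).
      - apply Rmult_le_compat_l; [|exact Hlen]. apply Rdiv_le_0_compat; [|exact HLa0]. repeat apply Rmult_le_pos; lra.
      - replace (7680 * Kc * (D * D) / La * (2 * B * La)) with (15360 * Kc * B * (D * D)) by (field; lra). exact NLa. }
    assert (T5 : 3 / 10 * R1 * (400 / (R1 * R1) * (2 * Kc * mu * (2 * Sa))) <= c0 / 10 * La).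
    { unfold mu. replace (3 / 10 * R1 * (400 / (R1 * R1) * (2 * Kc * (La / R1) * (2 * Sa)))) with
        (480 * Kc * La / (R1 * R1) * Sa) by (field; lra).
      apply Rle_trans with (480 * Kc * La / (R1 * R1) * (2 * (eta * (R1 * R1)))).
      - apply Rmult_le_compat_l; [|lra]. apply Rdiv_le_0_compat; [|nra]. repeat apply Rmult_le_pos; lra.
      - replace (480 * Kc * La / (R1 * R1) * (2 * (eta * (R1 * R1)))) with (960 * Kc * eta * La) by (field; lra).
        apply Rmult_le_compat_r; lra. }
    assert (HcL : 0 < c0 * La) by (apply Rmult_lt_0_compat; assumption).
    unfold X. rewrite !Rmult_plus_distr_l. lra.
  - intros N HN HN1.
    assert (HNr : 1 <= INR N) by (replace 1 with (INR 1) by reflexivity; apply le_INR; lia).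
    (* With [h N = R1/20] the points of a configuration stay within [R1/10] of its corner. Since the
       segment from [w] to [w'] has length [3/10 R1], everything lies within [2/5 R1] of [w]; and
       since [|w'| = 6/5 R1], the configuration at [w'] lies in the disc of radius [13/10 R1] about
       0, where [|f| <= ka]. *)
    set (h := R1 / (20 * INR N)). assert (Hh : 0 < h) by (apply Rdiv_lt_0_compat; lra).
    assert (Hhde : h <= de).
    { unfold h, de. apply Rmult_le_reg_r with (20 * INR N); [lra|].
      replace (R1 / (20 * INR N) * (20 * INR N)) with (R1 * 1) by (field; lra).
      assert (1 <= 20 * ep * INR N).
      { assert (HNN : INR N0 <= INR N) by (apply le_INR; exact HN).
        assert (L : / (20 * ep) <= INR N) by lra.
        apply Rmult_le_compat_l with (r := 20 * ep) in L; [|lra]. rewrite Rinv_r in L by lra. exact L. }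
      nra. }
    set (w' := (RtoC (4 / 5) * w)%C).
    assert (Hww : Cmod (w' - w) = 3 / 10 * R1).
    { replace (w' - w)%C with (RtoC (- (1 / 5)) * w)%C.
      2:{ unfold w'. replace (- (1 / 5)) with (4 / 5 - 1) by field. rewrite RtoC_minus. ring. }
      rewrite Cmod_mult, Cmod_R, Hw, Rabs_left by lra. field. }
    assert (Hw' : Cmod w' = 6 / 5 * R1).
    { unfold w'. rewrite Cmod_mult, Cmod_R, Hw, Rabs_pos_eq by lra. field. }
    assert (Hpt : forall jl ze, In jl (lattice N) -> Cmod ze = 1 -> Cmod (ze * lpt h jl) <= R1 / 10).
    { intros jl ze Hjl Hze. rewrite Cmod_mult, Hze, Rmult_1_l.
      eapply Rle_trans; [apply (lpt_bound h N); [lra | exact Hjl]|]. apply Req_le. unfold h. field. lra. }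
    destruct (average_gradient f f' w w' ka (map (lpt h) (lattice N)) Hf Hfw Hka) as [ze [t [Hze [Ht Havg]]]].
    { intros c ze Hc Hze. apply in_map_iff in Hc. destruct Hc as [jl [<- Hjl]]. apply Hsmall.
      eapply Rle_trans; [apply Cmod_triangle|]. specialize (Hpt jl ze Hjl Hze). lra. }
    rewrite length_map, lattice_length, lsum_map, HLa, Hww in Havg.
    set (p := (w + RtoC t * (w' - w))%C) in *.
    assert (Hp : forall jl, In jl (lattice N) -> Cmod (p + ze * lpt h jl - w) <= 2 / 5 * R1).
    { intros jl Hjl. replace (p + ze * lpt h jl - w)%C with (RtoC t * (w' - w) + ze * lpt h jl)%C by (unfold p; ring).
      eapply Rle_trans; [apply Cmod_triangle|]. rewrite Cmod_mult, Hww, Cmod_R, Rabs_pos_eq by lra.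
      specialize (Hpt jl ze Hjl Hze). nra. }
    assert (Hc4 : 0 <= 2 * Kc * mu) by (apply Rmult_le_pos; lra).
    assert (U := lattice_upper (grad f f' ka) l p ze h (2 * R1) Fm (al * mu) c3 (2 * Kc * mu) de d Q m N
      Hze Hh Hhde ltac:(unfold de; nra) HFm0 Hc3 Hc4 ltac:(lra)).
    assert (Hpw : forall jl, In jl (lattice N) -> grad f f' ka (p + ze * lpt h jl)%C <=
      Fm * lsum (fun a => indic (near h ((a - p) / ze)%C jl)) l + al * mu
      + 2 * lsum (fun a => sing h de ((a - p) / ze)%C jl) l
      + c3 * lsum (fun a => sing h (2 * R1) ((a - p) / ze)%C jl) l
      + 2 * Kc * mu * (lsum (fun a => indic (in_rect (square d a) (p + ze * lpt h jl)%C)) l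
            + lsum (fun n => indic (in_rect (Q n) (p + ze * lpt h jl)%C)) (seq 0 m))).
    { intros jl Hjl. specialize (Hp jl Hjl).
      apply (grad_pointwise f f' l p ze h (2 * R1) mu al Kc K1 Fm ka de d q Q m jl); try assumption; try lra.
      - apply HFm, Hp.
      - apply Hlog. lra.
      - intros a Ha. replace (p + ze * lpt h jl - a)%C with ((p + ze * lpt h jl - w) - (a - w))%C by ring.
        eapply Rle_trans; [apply Cmod_triangle'|]. specialize (Hdist a Ha). lra.
      - apply Hq, Hp.
      - intros Hg.
        assert (Hx : Cmod (p + ze * lpt h jl) <= 2 * R1).
        { replace (p + ze * lpt h jl)%C with ((p + ze * lpt h jl - w) + w)%C by ring.
          eapply Rle_trans; [apply Cmod_triangle|]. lra. }
        apply Hm; [eapply Rle_trans; [apply re_le_Cmod | exact Hx] | eapply Rle_trans; [apply im_le_Cmod | exact Hx] |].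
        split; [exact Hp | exact Hg]. }
    specialize (U Hpw). fold n in U. fold Sa in U. fold Sp in U.
    assert (HN2 : 0 <= INR N * INR N) by nra.
    assert (L1 : c0 * La * (INR N * INR N) <= 3 / 10 * R1 * lsum (fun jl => grad f f' ka (p + ze * lpt h jl)%C) (lattice N)).
    { eapply Rle_trans; [|exact Havg]. rewrite Rmult_comm. apply Rmult_le_compat_l; [exact HN2 | exact Hdrop]. }
    assert (E : Fm * n + INR N * INR N * (al * mu) + 2 * (n * (54 * de / (h * h)))
        + c3 * (n * (54 * (2 * R1) / (h * h)))
        + 2 * Kc * mu * (n * (32 * (d * d) / (h * h) + 16 * d / h + 1) + (2 * Sa / (h * h) + 2 * Sp / h + INR m))
        = X * (INR N * INR N) + Y * INR N + Z).
    { unfold X, Y, Z, h. field. lra. }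
    rewrite E in U.
    assert (L2 : 3 / 10 * R1 * lsum (fun jl => grad f f' ka (p + ze * lpt h jl)%C) (lattice N) <=
      3 / 10 * R1 * (X * (INR N * INR N) + Y * INR N + Z)) by (apply Rmult_le_compat_l; lra).
    lra.
Qed.

(** * The theorem *)

Lemma T_intro (f f' : C -> C) (a1 a2 q lam : R) (z : C) : 
  a1 * ln (M f (Cmod z)) <= Cmod z * Cmod (f' z / f z) ->
  Cmod z * Cmod (f' z / f z) <= a2 * ln (M f (Cmod z)) ->
  Rpower (Cmod z) q <= Cmod (f z) ->
  (forall u : C, Cmod (u - z) <= lam * Cmod z / ln (M f (Cmod z)) ->
     f u <> 0%C /\ Cmod u * Cmod (f' u / f u) <= a2 * ln (M f (Cmod u))) ->
  T f f' a1 a2 q lam z.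
Proof.
  intros H1 H2 H3 H4.
  assert (E : forall u : C, Defs.Cmod (Defs.Cdiv (Defs.Cmul u (f' u)) (f u)) = Cmod u * Cmod (f' u / f u)).
  { intros u. rewrite Defs_Cmod, Defs_Cdiv. change (Defs.Cmul u (f' u)) with (u * f' u)%C.
    rewrite <- Cmod_mult. f_equal. unfold Cdiv. ring. }
  unfold T. rewrite !E, !Defs_Cmod. repeat split; try assumption.
  - intros Hu0. apply (proj1 (H4 zeta ltac:(rewrite Defs_Cmod in H; exact H))). exact Hu0.
  - rewrite E, Defs_Cmod. apply H4. rewrite Defs_Cmod in H. exact H.
Qed.

(** [|u - a| >= |z - a| - d >= |z - a| / 2]. *)
Lemma inv_dist_near (l : list C) (z u : C) (d : R) : 0 < d -> Cmod (u - z) <= d ->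
  (forall a, In a l -> 2 * d <= Cmod (z - a)) -> inv_dist l u <= 2 * inv_dist l z.
Proof.
  intros Hd Hu Hl. unfold inv_dist. rewrite <- lsum_scal. apply lsum_le. intros a Ha. specialize (Hl a Ha).
  pose proof (Cmod_rev_triangle (z - a) (z - u)) as T1. replace (z - a - (z - u))%C with (u - a)%C in T1 by ring.
  rewrite (Cmod_sub_sym z u) in T1.
  replace (2 * / Cmod (z - a)) with (/ (Cmod (z - a) / 2)) by (field; lra).
  apply Rinv_le_contravar; lra.
Qed.

(** Passing from [z] to a point [u] at distance at most [d] at most doubles [inv_dist], so
    [|f'/f| <= 3 Kc mu]; with [|u| <= 2 R1] and [La <= B ln M] this gives the constant [6 Kc B]. The
    disc in the definition of [T] has radius at most [2 lam B R1 / La], which falls short of [d] by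
    [R1 / La]: hence [D = 2 lam B + 1], and [d > 0] even if [lam = 0]. By [10 D <= La],
    [d <= R1 / 10], and the disc stays within [R1 / 2] of [w]. *)
Lemma good_in_T (f f' : C -> C) (w z : C) (R1 La B al Kc K1 D q lam : R) (l : list C) :
  0 < R1 -> Cmod w = 3 / 2 * R1 -> 0 < La -> 1 <= B -> 0 < al -> 0 < Kc -> K1 <= Kc -> 0 <= lam -> D = 2 * lam * B + 1 ->
  10 * D <= La ->
  (forall r, R1 <= r <= 2 * R1 -> La / B <= ln (M f r) /\ ln (M f r) <= B * La) ->
  (forall z, Cmod (z - w) <= R1 / 2 -> ~ In z l -> f z <> 0%C) ->
  (forall z, Cmod (z - w) <= R1 / 2 -> f z <> 0%C -> Cmod (f' z / f z) <= inv_dist l z + K1 * (La / R1)) ->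
  Cmod (z - w) <= 2 / 5 * R1 -> good f f' l q al (La / R1) Kc (D * R1 / La) z ->
  T f f' (al / B) (6 * Kc * B) q lam z /\ annulus R1 z.
Proof.
  intros HR Hw HLa HB Hal HKc HK1 Hlam HD HLD HL Hnz Hlog Hz [G1 [G2 [G3 G4]]].
  set (mu := La / R1) in *. set (d := D * R1 / La) in *.
  assert (HD1 : 1 <= D) by (rewrite HD; nra).
  assert (Hmu : 0 < mu) by (apply Rdiv_lt_0_compat; lra).
  assert (Hd : 0 < d) by (apply Rdiv_lt_0_compat; [apply Rmult_lt_0_compat; lra | lra]).
  assert (HmuR : mu * R1 = La) by (unfold mu; field; lra).
  assert (Hrange : forall u r, Cmod (u - w) <= r -> 3 / 2 * R1 - r <= Cmod u <= 3 / 2 * R1 + r).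
  { intros u r Hu. pose proof (Cmod_rev_triangle w u) as T1. rewrite (Cmod_sub_sym w u) in T1.
    pose proof (Cmod_rev_triangle u w). lra. }
  assert (Hzr := Hrange z _ Hz).
  assert (HLz := HL (Cmod z) ltac:(lra)).
  assert (Hfz : f z <> 0%C).
  { intros E. rewrite E, Cmod_0 in G3. pose proof (exp_pos (q * ln (Cmod z))). unfold Rpower in G3. lra. }
  pose proof (proj1 (Cmod_gt_0 _) Hfz) as Hfp.
  assert (HKm : 0 < Kc * mu) by (apply Rmult_lt_0_compat; assumption).
  assert (HK1m : K1 * mu <= Kc * mu) by (apply Rmult_le_compat_r; lra).
  assert (HLB : La / B * B = La) by (field; lra).
  assert (HLB0 : 0 < La / B) by (apply Rdiv_lt_0_compat; lra).
  assert (Up : forall u, Cmod (u - z) <= d -> Cmod (u - w) <= R1 / 2 -> f u <> 0%C ->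
     Cmod u * Cmod (f' u / f u) <= 6 * Kc * B * ln (M f (Cmod u))).
  { intros u Hud Huw Hfu. assert (Hur := Hrange u _ Huw). assert (HLu := HL (Cmod u) ltac:(lra)).
    assert (Hq : Cmod (f' u / f u) <= 3 * (Kc * mu)).
    { eapply Rle_trans; [apply Hlog; assumption|].
      pose proof (inv_dist_near l z u d Hd Hud G2). lra. }
    apply Rle_trans with (2 * R1 * (3 * (Kc * mu))).
    - apply Rmult_le_compat; try apply Cmod_ge_0; lra.
    - replace (2 * R1 * (3 * (Kc * mu))) with (6 * Kc * (mu * R1)) by ring. rewrite HmuR, <- HLB.
      replace (6 * Kc * (La / B * B)) with (6 * Kc * B * (La / B)) by ring.
      apply Rmult_le_compat_l; [|lra]. repeat apply Rmult_le_pos; lra. }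
  assert (Hzz : Cmod (z - z) = 0) by (replace (z - z)%C with (RtoC 0) by ring; apply Cmod_0).
  split; [apply T_intro|].
  - apply Rle_trans with (al * La).
    + apply Rle_trans with (al / B * (B * La)).
      * apply Rmult_le_compat_l; [|lra]. apply Rdiv_le_0_compat; lra.
      * apply Req_le. field. lra.
    + rewrite Cmod_div by exact Hfz.
      assert (al * mu <= Cmod (f' z) / Cmod (f z)).
      { apply Rmult_le_reg_r with (Cmod (f z)); [exact Hfp|].
        replace (Cmod (f' z) / Cmod (f z) * Cmod (f z)) with (Cmod (f' z)) by (field; lra). exact G4. }
      rewrite <- HmuR. replace (al * (mu * R1)) with (R1 * (al * mu)) by ring.
      apply Rmult_le_compat; try lra. apply Rmult_le_pos; lra.
  - apply Up; [lra | lra | exact Hfz].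
  - exact G3.
  - intros u Hu.
    assert (Hud : Cmod (u - z) <= lam * (2 * R1) * (B / La)).
    { eapply Rle_trans; [exact Hu|]. unfold Rdiv at 1. apply Rmult_le_compat.
      - apply Rmult_le_pos; [exact Hlam | apply Cmod_ge_0].
      - left. apply Rinv_0_lt_compat. lra.
      - apply Rmult_le_compat_l; lra.
      - replace (B / La) with (/ (La / B)) by (field; lra). apply Rinv_le_contravar; lra. }
    assert (Hdd : lam * (2 * R1) * (B / La) = d - R1 / La) by (unfold d; rewrite HD; field; lra).
    assert (0 < R1 / La) by (apply Rdiv_lt_0_compat; lra).
    assert (Hd10 : d <= R1 / 10).
    { unfold d. apply Rmult_le_reg_r with La; [lra|].
      replace (D * R1 / La * La) with (D * R1) by (field; lra). nra. }
    assert (Huw : Cmod (u - w) <= R1 / 2).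
    { replace (u - w)%C with ((u - z) + (z - w))%C by ring. eapply Rle_trans; [apply Cmod_triangle|]. lra. }
    assert (Hfu : f u <> 0%C).
    { apply Hnz; [exact Huw|]. intros Hin. specialize (G2 u Hin). rewrite Cmod_sub_sym in G2. lra. }
    split; [exact Hfu|]. apply Up; [lra | exact Huw | exact Hfu].
  - unfold annulus. rewrite Defs_Cmod. lra.
Qed.

(** [Hnc] excludes the constants of modulus 1, and also 0 because [ln 0 = 0] here: they satisfy the
    growth condition. All constants up to [eta] come from the growth condition alone; [q] and [lam]
    enter only [D] and the thresholds for [R1]. *)
Theorem theorem2 (f f' : Cplx -> Cplx) (Hent : entire_with_deriv f f')
  (Hnc : exists z1 z2 : Cplx, f z1 <> f z2)
  (A B Cc r0 : R) (HA : 1 < A) (HB : 1 < B) (HC : 1 < Cc) (Hr0 : 1 < r0)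
  (Hgrowth : forall r : R, r0 <= r ->
     A * ln (M f r) <= ln (M f (Cc * r)) /\ ln (M f (Cc * r)) <= B * ln (M f r)) :
  exists a1 a2 eta : R, 0 < a1 /\ 0 < a2 /\ 0 < eta /\
    forall q lam : R, 0 <= q -> 0 <= lam ->
      exists R0 : R, forall R1 : R, R0 <= R1 ->
        dens (T f f' a1 a2 q lam) (annulus R1) > eta.
Proof.
  assert (Hf : entire f f') by (apply Defs_entire, Hent).
  destruct (M_gt_1 f f' r0 Hf Hnc) as [r1 [Hr1 [_ HM1]]].
  destruct (growth_doubling f f' A B Cc r0 8 Hf Hnc HA HB HC Hr0 Hgrowth ltac:(lra)) as [B1 [Rd [HB1 [_ Hdbl]]]].
  (* 15/13 is the ratio of [3/2 R1] to [13/10 R1]. *)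
  destruct (growth_local f f' A B Cc r0 (15 / 13) Hf Hnc HA HB HC Hr0 Hgrowth ltac:(lra)) as [c [Rl [Hc [_ Hloc]]]].
  (* By the choice of [c], the drop [La - ln ka] is at least [c / (1 + c)] times [La]. Half of it is
     [c0 La]; the other half pays for [ln 2]. *)
  set (c0 := c / (2 * (1 + c))).
  assert (Hc0 : 0 < c0) by (apply Rdiv_lt_0_compat; lra).
  assert (Hc1 : c0 <= 1).
  { apply Rmult_le_reg_r with (2 * (1 + c)); [lra|]. unfold c0, Rdiv. rewrite Rmult_assoc, Rinv_l by lra. lra. }
  set (al := c0 / 2). assert (Hal : 0 < al) by (unfold al; lra).
  (* [ep], [Kx] and [eta] are chosen in this order to meet the shares in [no_small_cover]: 129600 is
     5 times 25920, 518400 is 5 times 103680, and 9600 is 10 times 960. *)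
  set (ep := c0 / (129600 * B1)). assert (Hep : 0 < ep) by (apply Rdiv_lt_0_compat; lra).
  assert (HepB : 129600 * B1 * ep = c0) by (unfold ep; field; lra).
  assert (Hep1 : ep <= 1) by nra.
  set (K1 := 4 * exp 2 * B1). pose proof (exp_pos 2) as He2.
  assert (HK1 : 0 < K1) by (unfold K1; apply Rmult_lt_0_compat; lra).
  set (Kx := 518400 * (B1 * B1) / (ep * c0)).
  assert (HKx : 0 < Kx) by (apply Rdiv_lt_0_compat; [nra | apply Rmult_lt_0_compat; assumption]).
  assert (HKxe : Kx * (ep * c0) = 518400 * (B1 * B1)) by (unfold Kx; field; lra).
  set (Kc := K1 + Kx). assert (HKc : 0 < Kc) by (unfold Kc; lra).
  set (eta := c0 / (9600 * Kc)). assert (Heta : 0 < eta) by (apply Rdiv_lt_0_compat; lra).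
  assert (HetaK : 9600 * Kc * eta = c0) by (unfold eta; field; lra).
  (* Coverings of the set have total area at least [eta R1^2], and the annulus fits into a square of
     area [16 R1^2]; 32 instead of 16 makes the inequality strict. *)
  exists (al / B1), (6 * Kc * B1), (eta / 32).
  split; [apply Rdiv_lt_0_compat; lra|]. split; [apply Rmult_lt_0_compat; lra|]. split; [lra|].
  intros q lam Hq Hlam.
  set (D := 2 * lam * B1 + 1). assert (HD : 1 <= D) by (unfold D; nra).
  (* Three thresholds for [La]: for the term [ln 2], for the squares about the zeros, and for
     [d <= R1 / 10]. *)
  set (Q1 := Rmax (ln 2 / c0) (Rmax (153600 * Kc * B1 * (D * D) / c0) (10 * D))).
  destruct (growth_unbounded f f' A B Cc r0 Hf Hnc HA HB HC Hr0 Hgrowth Q1) as [RL [_ HRL]].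
  destruct (growth_beats_log f f' A B Cc r0 Hf Hnc HA HB HC Hr0 Hgrowth (2 * q + 1) ltac:(lra)) as [Rq [_ HRq]].
  (* A sum of nonnegative terms dominates all thresholds at once; [2 Kc / al] serves where [|f|] is
     below [|z|^q]. *)
  exists (r1 + Rabs Rd + Rabs Rl + Rabs RL + Rabs Rq + 2 + 2 * Kc / al).
  intros R1 HR1.
  pose proof (Rle_abs Rd). pose proof (Rle_abs Rl). pose proof (Rle_abs RL). pose proof (Rle_abs Rq).
  pose proof (Rabs_pos Rd). pose proof (Rabs_pos Rl). pose proof (Rabs_pos RL). pose proof (Rabs_pos Rq).
  assert (Hka0 : 0 < 2 * Kc / al) by (apply Rdiv_lt_0_compat; lra).
  assert (HRp : 2 <= R1) by lra.
  destruct (M_spec f f' (3 / 2 * R1) Hf ltac:(lra)) as [w [Hw [HMw _]]].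
  set (La := ln (Cmod (f w))).
  assert (HLa : La = ln (M f (3 / 2 * R1))) by (unfold La; rewrite HMw; reflexivity).
  assert (HQ1 : Q1 <= La) by (rewrite HLa; apply HRL; lra).
  assert (HQa : ln 2 / c0 <= La) by (eapply Rle_trans; [|exact HQ1]; apply Rmax_l).
  assert (HQb : 153600 * Kc * B1 * (D * D) / c0 <= La).
  { eapply Rle_trans; [|exact HQ1]. eapply Rle_trans; [|apply Rmax_r]. apply Rmax_l. }
  assert (HQc : 10 * D <= La).
  { eapply Rle_trans; [|exact HQ1]. eapply Rle_trans; [|apply Rmax_r]. apply Rmax_r. }
  assert (HLap : 0 < La) by lra.
  assert (Hlow : forall r s, R1 <= r -> r <= s -> ln (M f r) <= ln (M f s)).
  { intros r s Hr Hs. apply (lnM_mono f f'); [exact Hf | lra | exact Hs | apply HM1; lra]. }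
  assert (HR8 : ln (M f (8 * R1)) <= B1 * ln (M f R1)) by (apply Hdbl; lra).
  assert (HLR : ln (M f R1) <= La) by (rewrite HLa; apply Hlow; lra).
  assert (HLpos : 0 < ln (M f R1)) by (rewrite <- ln_1; apply ln_increasing; [lra | apply HM1; lra]).
  assert (Htop : forall r, R1 <= r <= 8 * R1 -> ln (M f r) <= B1 * La).
  { intros r Hr. apply Rle_trans with (ln (M f (8 * R1))); [apply Hlow; lra|].
    eapply Rle_trans; [exact HR8|]. apply Rmult_le_compat_l; lra. }
  assert (Hbot : La / B1 <= ln (M f R1)).
  { apply Rmult_le_reg_r with B1; [lra|]. unfold Rdiv. rewrite Rmult_assoc, Rinv_l by lra.
    assert (La <= ln (M f (8 * R1))) by (rewrite HLa; apply Hlow; lra). lra. }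
  assert (Hfw : f w <> RtoC 0).
  { apply Cmod_pos_neq_0. rewrite <- HMw. assert (1 < M f (3 / 2 * R1)) by (apply HM1; lra). lra. }
  set (ka := M f (13 / 10 * R1)). assert (Hka1 : 1 < ka) by (apply HM1; lra).
  (* The disc of radius [2 R1] about [w] reaches out to [7/2 R1], which the factor 8 in
     [growth_doubling] covers. *)
  set (K := M f (7 / 2 * R1)).
  destruct (local_log_derivative f f' w R1 K ltac:(lra) Hf Hfw) as [l [Hlen [Hnz [Hroot Hlog]]]].
  { intros z Hz. apply (M_disc f f'); [exact Hf|].
    replace z with ((z - w) + w)%C by ring. eapply Rle_trans; [apply Cmod_triangle|]. lra. }
  fold La in Hlen, Hlog.
  assert (HKL : ln K <= B1 * La) by (apply Htop; lra).
  assert (Hn2 : INR (length l) <= 2 * B1 * La).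
  { pose proof ln_lt_2. pose proof (pos_INR (length l)).
    assert (INR (length l) * / 2 <= INR (length l) * ln 2) by (apply Rmult_le_compat_l; lra). lra. }
  assert (Hlog' : forall z, Cmod (z - w) <= R1 / 2 -> f z <> RtoC 0 -> Cmod (f' z / f z) <= inv_dist l z + K1 * (La / R1)).
  { intros z Hz Hfz. eapply Rle_trans; [apply Hlog; assumption|]. apply Rplus_le_compat_l.
    apply Rle_trans with (4 * exp 2 / R1 * (B1 * La)).
    - apply Rmult_le_compat_l; [apply Rdiv_le_0_compat; lra | lra].
    - apply Req_le. unfold K1. field. lra. }
  assert (Hdrop : c0 * La <= La - ln ka - ln 2).
  { assert (L := Hloc (13 / 10 * R1) ltac:(lra)). fold ka in L.
    replace (15 / 13 * (13 / 10 * R1)) with (3 / 2 * R1) in L by field. rewrite <- HLa in L.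
    assert (E : La - ln ka >= 2 * c0 * La).
    { unfold c0. apply Rle_ge. apply Rmult_le_reg_l with (1 + c); [lra|].
      replace ((1 + c) * (2 * (c / (2 * (1 + c))) * La)) with (c * La) by (field; lra). lra. }
    apply Rmult_le_compat_r with (r := c0) in HQa; [|lra].
    unfold Rdiv in HQa. rewrite Rmult_assoc, Rinv_l in HQa by lra. lra. }
  assert (Hzmod : forall z, Cmod (z - w) <= 2 / 5 * R1 -> R1 <= Cmod z <= 2 * R1).
  { intros z Hz. pose proof (Cmod_rev_triangle w z) as T1. rewrite (Cmod_sub_sym w z) in T1.
    pose proof (Cmod_rev_triangle z w). lra. }
  (* The size of this bound is immaterial: it multiplies only the number of zeros, which does not
     depend on the mesh. *)
  assert (HFm : forall z, Cmod (z - w) <= 2 / 5 * R1 -> grad f f' ka z <= M f (3 * R1) / R1 / ka).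
  { intros z Hz. specialize (Hzmod z Hz).
    assert (E : Cmod (f' z) <= M f (3 * R1) / R1).
    { apply (cauchy_estimate f f' z R1); [lra | exact Hf |]. intros u Hu. apply (M_disc f f'); [exact Hf|].
      replace u with ((u - z) + z)%C by ring. eapply Rle_trans; [apply Cmod_triangle|]. lra. }
    unfold grad. pose proof (Cmod_ge_0 (f z)). pose proof (Cmod_ge_0 (f' z)).
    assert (Hden : 0 < Cmod (f z) * Cmod (f z) + ka * ka).
    { apply Rplus_le_lt_0_compat; [apply Rmult_le_pos; assumption | apply Rmult_lt_0_compat; lra]. }
    apply Rle_trans with (Cmod (f' z) / ka); [|apply Rmult_le_compat_r; [left; apply Rinv_0_lt_compat; lra | exact E]].
    apply Rmult_le_reg_r with ((Cmod (f z) * Cmod (f z) + ka * ka) * ka); [apply Rmult_lt_0_compat; lra|].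
    replace (Cmod (f z) * Cmod (f' z) / (Cmod (f z) * Cmod (f z) + ka * ka) * ((Cmod (f z) * Cmod (f z) + ka * ka) * ka))
      with (Cmod (f' z) * (Cmod (f z) * ka)) by (field; lra).
    replace (Cmod (f' z) / ka * ((Cmod (f z) * Cmod (f z) + ka * ka) * ka))
      with (Cmod (f' z) * (Cmod (f z) * Cmod (f z) + ka * ka)) by (field; lra).
    apply Rmult_le_compat_l; [assumption|]. clear - Hden Hka1. nra. }
  assert (Hqs : forall z, Cmod (z - w) <= 2 / 5 * R1 -> Cmod (f z) < Rpower (Cmod z) q ->
     2 * Kc * (Cmod (f z) * Cmod (f z)) <= al * (ka * ka)).
  { intros z Hz Hlt. specialize (Hzmod z Hz).
    set (P := Rpower (2 * R1) q).
    assert (HP : 0 < P) by apply exp_pos.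
    assert (HfP : Cmod (f z) <= P).
    { left. eapply Rlt_le_trans; [exact Hlt|]. apply Rle_Rpower_l; lra. }
    (* In the exponent [2 q + 1], the part [2 q] pays for [(2 R1)^q], since [2 R1 <= (13/10 R1)^2].
       The remaining 1 yields the factor [13/10 R1], whose square exceeds [2 Kc / al]. *)
    assert (Hka2 : P * (13 / 10 * R1) <= ka).
    { rewrite <- (exp_ln ka) by lra. rewrite <- (exp_ln (13 / 10 * R1)) by lra. unfold P, Rpower.
      rewrite <- exp_plus. assert (Hle : q * ln (2 * R1) + ln (13 / 10 * R1) <= ln ka).
      { eapply Rle_trans; [|apply (HRq (13 / 10 * R1)); lra].
        assert (Hlg : ln (2 * R1) <= 2 * ln (13 / 10 * R1)).
        { replace (2 * ln (13 / 10 * R1)) with (ln ((13 / 10 * R1) * (13 / 10 * R1))) by (rewrite ln_mult by lra; ring).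
          apply ln_mono; clear - HRp; nra. }
        apply Rmult_le_compat_l with (r := q) in Hlg; [lra | exact Hq]. }
      destruct Hle as [Hl | ->]; [left; apply exp_increasing, Hl | lra]. }
    apply Rle_trans with (2 * Kc * (P * P)).
    - apply Rmult_le_compat_l; [lra|]. apply Rmult_le_compat; try apply Cmod_ge_0; exact HfP.
    - apply Rle_trans with (al * ((P * (13 / 10 * R1)) * (P * (13 / 10 * R1)))).
      + replace (al * (P * (13 / 10 * R1) * (P * (13 / 10 * R1)))) with (al * ((13 / 10 * R1) * (13 / 10 * R1)) * (P * P)) by ring.
        apply Rmult_le_compat_r; [apply Rmult_le_pos; lra|].
        apply Rle_trans with (al * (2 * Kc / al)); [apply Req_le; field; lra|].
        apply Rmult_le_compat_l; [lra|].
        assert (Hbig : 2 * Kc / al <= R1) by lra. clear - Hbig HRp. nra.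
      + apply Rmult_le_compat_l; [lra|]. apply Rmult_le_compat; try lra; apply Rmult_le_pos; lra. }
  set (X := fun z => T f f' (al / B1) (6 * Kc * B1) q lam z /\ annulus R1 z).
  assert (Hcover : forall s, cover_sums X s -> eta * (R1 * R1) <= s).
  { intros s Hs. apply Rnot_lt_le. intros Hlt.
    apply (no_small_cover f f' w R1 La ka B1 c0 al ep Kc K1 D eta q (M f (3 * R1) / R1 / ka) s l); try assumption;
      try reflexivity; try lra.
    - unfold Kc. lra.
    - intros z Hz. apply (M_disc f f'); [exact Hf | exact Hz].
    - intros a Ha. apply Hroot, Ha.
    - intros a Ha. apply Hroot, Ha.
    - replace (103680 * (B1 * B1)) with (c0 / 5 * (ep * Kx)) by lra.
      apply Rmult_le_compat_l; [lra|]. apply Rmult_le_compat_l; [lra|]. unfold Kc. lra.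
    - apply Rmult_le_compat_r with (r := c0) in HQb; [|lra].
      unfold Rdiv in HQb. rewrite Rmult_assoc, Rinv_l in HQb by lra. lra.
    - revert Hs. apply cover_sums_subset. intros z [Hz Hg].
      apply (good_in_T f f' w z R1 La B1 al Kc K1 D q lam l); try assumption; try lra; try reflexivity.
      + unfold Kc. lra.
      + intros r Hr. split; [|apply Htop; lra]. eapply Rle_trans; [exact Hbot | apply Hlow; lra]. }
  set (box := mkRect (- (2 * R1)) (2 * R1) (- (2 * R1)) (2 * R1)).
  assert (Hbox : forall z, annulus R1 z -> in_rect box z).
  { intros z [_ Hz]. rewrite Defs_Cmod in Hz. pose proof (re_le_Cmod z) as B2. pose proof (im_le_Cmod z) as B3.
    unfold Re, Im in *. unfold in_rect, box; simpl.
    split; apply Rabs_le_between; lra. }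
  destruct (area_glb X box) as [_ GX]; [intros z [_ Hz]; apply Hbox, Hz|].
  destruct (area_glb (annulus R1) box Hbox) as [GA1 GA2].
  assert (HX : eta * (R1 * R1) <= area X) by (apply GX, Hcover).
  assert (HA1 : area (annulus R1) <= 16 * (R1 * R1)).
  { eapply Rle_trans; [apply GA1, (cover_sums_rect _ box Hbox)|]. unfold rect_area, box; simpl.
    rewrite Rmax_right by lra. apply Req_le. ring. }
  assert (HRR : 0 < R1 * R1) by (apply Rmult_lt_0_compat; lra).
  (* The annulus contains [X], so the same lower bound shows that the denominator in [dens] is
     positive. *)
  assert (HA0 : eta * (R1 * R1) <= area (annulus R1)).
  { apply GA2. intros s Hs. apply Hcover. apply (cover_sums_subset _ (annulus R1)); [intros z [_ Hz]; exact Hz | exact Hs]. }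
  assert (HAp : 0 < area (annulus R1)) by (assert (0 < eta * (R1 * R1)) by (apply Rmult_lt_0_compat; assumption); lra).
  unfold dens. fold X. apply Rlt_gt. apply Rmult_lt_reg_r with (area (annulus R1)); [exact HAp|].
  unfold Rdiv at 2. rewrite Rmult_assoc, Rinv_l by lra. rewrite Rmult_1_r.
  eapply Rlt_le_trans; [|exact HX].
  apply Rle_lt_trans with (eta / 32 * (16 * (R1 * R1))); [apply Rmult_le_compat_l; lra|].
  assert (0 < eta * (R1 * R1)) by (apply Rmult_lt_0_compat; assumption). lra.
Qed.
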